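(* Let $p\in\mathbb{S}^2$, let $\Omega\in\mathbb{R}$ with $\Omega\neq 0$, and let $\bar\omega^{RH}(x)=\Omega\,p\cdot x+Y_2(x)$ be a degree-2 zonal Rossby--Haurwitz wave, i.e. $Y_2$ is an eigenfunction with $-\Delta Y_2=6Y_2$ on $\mathbb{S}^2$ which is invariant under all rotations about the axis $p$. Then there exist $C,\bar\varepsilon>0$ such that if $\|\omega_0-\bar\omega^{RH}\|_2<\bar\varepsilon$, then for all $t\ge 0$ $$\|\omega_t-\bar\omega^{RH}\|_2\le C\,\|\omega_0-\bar\omega^{RH}\|_2^{1/2},$$ where $\{\omega_t\}_{t\ge0}$ is the solution to the Euler equation on $\mathbb{S}^2$ with initial condition $\omega_0$.
   Context: $\mathbb{S}^2\subset\mathbb{R}^3$ is the unit sphere with surface measure $\mathrm{d}\mathcal{S}$, $\Delta$ is its Laplace--Beltrami operator, and $\|\cdot\|_2$ is the $L^2(\mathbb{S}^2)$ norm. Euler equation on $\mathbb{S}^2$ (vorticity form): $\partial_t\omega+\nabla^\perp\psi\cdot\nabla\omega=0$, $\Delta\psi=\omega$ on $[0,\infty)\times\mathbb{S}^2$, $\omega|_{t=0}=\omega_0$. Here $\psi=\Delta^{-1}\omega$ is the (mean-zero) stream function, $\nabla^\perp f(x)=x\times\nabla f(x)$, and vorticities have mean zero. Solutions are understood as global solutions $\omega\in C([0,\infty);L^2(\mathbb{S}^2))$ for which the standard conservation laws hold, namely the following are constant in time: the energy $-\frac12\int_{\mathbb{S}^2}\omega\Delta^{-1}\omega\,\mathrm{d}\mathcal{S}$;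 the Casimirs $\int_{\mathbb{S}^2} f(\omega)\,\mathrm{d}\mathcal{S}$ for continuous $f:\mathbb{R}\to\mathbb{R}$ (whenever defined; in particular the $L^2$ norm); and the angular momentum $\int_{\mathbb{S}^2}\omega\,x\,\mathrm{d}\mathcal{S}\in\mathbb{R}^3$. $R_p^u\in SO(3)$ denotes the rotation about $p$ by angle $u$. Invariance of $Y_2$ under rotations about $p$ means $Y_2(R_p^ux)=Y_2(x)$ for all $u\in\mathbb{R}$, $x\in\mathbb{S}^2$. Eigenfunctions are real-valued and nonzero. *)

(* Defs.v *)
From HB Require Import structures.
From mathcomp Require Import all_boot all_order all_algebra.
From mathcomp Require Import all_classical all_reals all_analysis.
From mathcomp Require Import measurable_realfun ring lra.

Set Implicit Arguments.
Unset Strict Implicit.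
Unset Printing Implicit Defensive.

Import Order.TTheory GRing.Theory Num.Theory.
Import numFieldNormedType.Exports.

Local Open Scope classical_set_scope.
Local Open Scope ring_scope.

Section euclidean_space.
Context {R : realType}.
Implicit Types u v p x : 'rV[R]_3.

Definition dot u v : R := \sum_i u 0 i * v 0 i.

(* Indices are computed in Z/3, so component 1 is u_2 v_0 - u_0 v_2. *)
Definition cross u v : 'rV[R]_3 :=
  \row_i (u 0 (i + 1) * v 0 (i + 2) - u 0 (i + 2) * v 0 (i + 1)).

(* Rodrigues' formula for the rotation of angle a about the unit vector p. *)
Definition rodrigues p (a : R) x : 'rV[R]_3 :=
  cos a *: x + sin a *: cross p x + ((1 - cos a) * dot p x) *: p.

Definition euclidean_norm x : R := Num.sqrt (dot x x).

(* The vector (x, y, z). *)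
Definition vec3 (x y z : R) : 'rV[R]_3 := \row_(i < 3) [:: x; y; z]`_i.

Lemma dot3E u v : dot u v =
  u 0 0 * v 0 0 + u 0 1 * v 0 1 + u 0 2 * v 0 2.
Proof.
have e1 : lift ord0 ord0 = 1 :> 'I_3 by exact: val_inj.
have e2 : lift ord0 (lift ord0 ord0) = 2 :> 'I_3 by exact: val_inj.
by rewrite /dot !big_ord_recl big_ord0 addr0 addrA e1 e2.
Qed.

Lemma dot_rodrigues p a x : dot p p = 1 -> dot x x = 1 ->
  dot (rodrigues p a x) (rodrigues p a x) = 1.
Proof.
move=> p1 x1; set c := cos a; set s := sin a; set d := dot p x.
have cs : c ^+ 2 + s ^+ 2 = 1 := cos2Dsin2 a.
have i1 : (1 + 1 : 'I_3) = 2 by exact: val_inj.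
have i2 : (1 + 2 : 'I_3) = 0 by exact: val_inj.
have i3 : (2 + 1 : 'I_3) = 0 by exact: val_inj.
have i4 : (2 + 2 : 'I_3) = 1 by exact: val_inj.
have -> : dot (rodrigues p a x) (rodrigues p a x) =
  c ^+ 2 * dot x x + s ^+ 2 * (dot p p * dot x x - d ^+ 2) +
  ((1 - c) * d) ^+ 2 * dot p p + 2 * c * (1 - c) * d ^+ 2.
  rewrite !dot3E !mxE /d dot3E !add0r i1 i2 i3 i4.
  by rewrite -/c -/s; ring.
rewrite p1 x1.
transitivity (c ^+ 2 + s ^+ 2 + d ^+ 2 * (1 - (c ^+ 2 + s ^+ 2))); first by ring.
by rewrite cs subrr mulr0 addr0.
Qed.

Lemma dot_vec3 (a b c a' b' c' : R) :
  dot (vec3 a b c) (vec3 a' b' c') = a * a' + b * b' + c * c'.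
Proof. by rewrite dot3E !mxE. Qed.

End euclidean_space.

Definition S2 (R : realType) : Type := set_type [set x : 'rV[R]_3 | dot x x = 1].

Section sphere.
Context {R : realType}.

Definition coords (x : S2 R) : 'rV[R]_3 := set_val x.

Lemma coordsP (x : S2 R) : dot (coords x) (coords x) = 1.
Proof. by have := set_valP x. Qed.

Definition S2_of (x : 'rV[R]_3) (x1 : dot x x = 1) : S2 R :=
  SigSub (mem_set x1).

Lemma coordsK (x : 'rV[R]_3) (x1 : dot x x = 1) : coords (S2_of x1) = x.
Proof. by []. Qed.

Fact north_subproof : dot (vec3 0 0 1) (vec3 0 0 1) = 1 :> R.
Proof. by rewrite dot_vec3; ring. Qed.

Definition north : S2 R := S2_of north_subproof.

Definition rotation (p : S2 R) (a : R) (x : S2 R) : S2 R :=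
  S2_of (dot_rodrigues a (coordsP p) (coordsP x)).

(* The value at 0 is irrelevant. *)
Definition radial_projection (x : 'rV[R]_3) : S2 R :=
  insubd north ((euclidean_norm x)^-1 *: x).

Fact sphere_point_subproof (theta phi : R) :
  let v := vec3 (sin theta * cos phi) (sin theta * sin phi) (cos theta) in
  dot v v = 1.
Proof.
have h1 := cos2Dsin2 theta; have h2 := cos2Dsin2 phi.
rewrite /= dot_vec3.
transitivity (sin theta ^+ 2 * (cos phi ^+ 2 + sin phi ^+ 2) + cos theta ^+ 2).
  by ring.
by rewrite h2 mulr1 addrC.
Qed.

Definition sphere_point (z : R * R) : S2 R :=
  S2_of (sphere_point_subproof z.1 z.2).

End sphere.

HB.instance Definition _ (R : realType) := Topological.on (S2 R).
HB.instance Definition _ (R : realType) := isPointed.Build (S2 R) (@north R).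

Section borel_sphere.
Context {R : realType}.

Let borel : set (set (S2 R)) := <<s @open (S2 R) >>.

Fact borel_S2_0 : borel set0.
Proof. exact: sigma_algebra0. Qed.

Fact borel_S2_C A : borel A -> borel (~` A).
Proof. exact: sigma_algebraC. Qed.

Fact borel_S2_bigcup (F : (set (S2 R))^nat) :
  (forall i, borel (F i)) -> borel (\bigcup_i F i).
Proof. exact: sigma_algebra_bigcup. Qed.

HB.instance Definition _ := @isMeasurable.Build (sigma_display (@open (S2 R)))
  (S2 R) borel borel_S2_0 borel_S2_C borel_S2_bigcup.

End borel_sphere.

Section surface_measure.
Context {R : realType}.

Lemma open_measurable_prod (U : set (R * R)) : open U -> measurable U.
Proof.
move=> oU.
pose box (q : rat * rat * rat) : set (R * R) :=
  ball (ratr q.1.1 : R) (ratr q.2 : R) `*` ball (ratr q.1.2 : R) (ratr q.2 : R).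
have -> : U = \bigcup_(q in [set q | box q `<=` U]) box q.
  apply/seteqP; split=> [[x y] Uxy|xy [q /= qU] /qU//].
  have /nbhs_ballP[e /= e0 xyU] := open_nbhs_nbhs (conj oU Uxy).
  have [r /andP[r0 re]] : exists r, (0 < (ratr r : R)) && ((ratr r : R) < e / 2).
    have [|r] := @rat_in_itvoo R 0 (e / 2); first by rewrite divr_gt0.
    by rewrite in_itv/= => ?; exists r.
  have near z : exists a, ball (ratr a : R) (ratr r) z.
    have [|a] := @rat_in_itvoo R z (z + ratr r); first by rewrite ltrDl.
    rewrite in_itv/= => /andP[za ar]; exists a.
    by rewrite /ball/= ger0_norm; lra.
  have [a xa] := near x; have [b yb] := near y.
  exists ((a, b), r) => //= -[x' y'] [/= xa' yb']; apply: xyU.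
  move: xa yb xa' yb'; rewrite -!ball_normE /= prod_normE /= gt_max !ltr_norml.
  move=> /andP[? ?] /andP[? ?] /andP[? ?] /andP[? ?].
  by apply/andP; split; apply/andP; split; lra.
rewrite bigcup_mkcond; apply: countable_bigcupT_measurable => [|q]; first exact: countableP.
by case: ifPn => // _; apply: measurableX; exact: measurable_ball.
Qed.

Lemma continuous_sphere_point : continuous (@sphere_point R).
Proof.
apply: (@continuous_comp_initial (S2 R) _ _ set_val (@sphere_point R)) => z.
suff h i : (fun y => coords (sphere_point y) 0 i) @ z -->
           coords (sphere_point z) 0 i.
  apply: (proj2 (cvg_ballP _ _)) => e e0.
  have H : \forall y \near z, forall i,
      ball (coords (sphere_point z) 0 i) e (coords (sphere_point y) 0 i).
    apply: (@filter_forall _ _ (fun i y => ball (coords (sphere_point z) 0 i) e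
      (coords (sphere_point y) 0 i)) (nbhs z)) => i.
    by have /cvg_ballP/(_ _ e0) := h i.
  by apply: filterS H => y Hy; split=> // j i; rewrite ord1; exact: Hy.
have c1 : cvg_to (fst @ z) (nbhs z.1) by exact: cvg_fst.
have c2 : cvg_to (snd @ z) (nbhs z.2) by exact: cvg_snd.
have ct (f : R -> R) : continuous f -> (f y.1) @[y --> z] --> f z.1.
  by move=> cf; exact: (cvg_comp _ _ c1 (cf _)).
have cp (f : R -> R) : continuous f -> (f y.2) @[y --> z] --> f z.2.
  by move=> cf; exact: (cvg_comp _ _ c2 (cf _)).
have cs := @continuous_sin R; have cc := @continuous_cos R.
rewrite coordsK; under eq_fun do rewrite coordsK.
case: i => -[|[|[|//]]] Hi; rewrite !mxE/=; under eq_fun do rewrite !mxE/=.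
- exact: (cvgM (ct _ cs) (cp _ cc)).
- exact: (cvgM (ct _ cs) (cp _ cs)).
- exact: (ct _ cc).
Qed.

Lemma measurable_sphere_point : measurable_fun setT (@sphere_point R).
Proof.
apply: (@measurability _ _ _ _ _ _ (@open (S2 R))) => // _ [U oU <-].
rewrite setTI; apply: open_measurable_prod.
by have /continuousP := continuous_sphere_point; apply.
Qed.

Definition chart_domain : set (R * R) := `[0, pi] `*` `[0, 2 * pi].

(* Spherical coordinates: the element of area is sin theta dtheta dphi. *)
Definition surface (A : set (S2 R)) : \bar R :=
  (\int[lebesgue_measure \x lebesgue_measure]_(z in
     chart_domain `&` sphere_point @^-1` A) (sin z.1)%:E)%E.

Let measurable_chart_domain : measurable chart_domain.
Proof. by apply: measurableX; exact: measurable_itv. Qed.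

Let sin_ge0 z : chart_domain z -> (0 <= (sin z.1)%:E :> \bar R)%E.
Proof.
by case: z => a b [/=]; rewrite in_itv/= => ? _; rewrite lee_fin sin_ge0_pi.
Qed.

Let surface0 : surface set0 = 0%E.
Proof. by rewrite /surface preimage_set0 setI0 integral_set0. Qed.

Let surface_ge0 A : (0 <= surface A)%E.
Proof. by apply: integral_ge0 => z [/sin_ge0]. Qed.

Let surface_sigma_additive : semi_sigma_additive surface.
Proof.
move=> /= F mF tF mUF; rewrite /surface preimage_bigcup setI_bigcupr.
rewrite ge0_integral_bigcup/=; first 1 last.
- move=> k; apply: measurableI => //.
  by rewrite -[X in measurable X]setTI; exact: measurable_sphere_point.
- apply: measurable_funTS; apply/measurable_EFinP.
  apply: (measurableT_comp (f := @sin R)); last exact: measurable_fst.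
  by apply: continuous_measurable_fun; exact: continuous_sin.
- by move=> z [k _ [/sin_ge0]].
- apply/trivIsetP => i j _ _ ij; rewrite setIACA setIid -preimage_setI.
  by move/trivIsetP : tF => ->//; rewrite preimage_set0 setI0.
apply: is_cvg_ereal_nneg_natsum_cond => k _ _.
by apply: integral_ge0 => z [/sin_ge0].
Qed.

HB.instance Definition _ := isMeasure.Build _ _ _
  surface surface0 surface_ge0 surface_sigma_additive.

End surface_measure.

Section calculus_on_sphere.
Context {R : realType}.
Implicit Types (f : S2 R -> R) (x : S2 R).

(* The extension x |-> f (x / |x|), homogeneous of degree 0. Its derivatives at
   a point of the sphere are the tangential derivatives of f. *)
Definition extend f : 'rV[R]_3 -> R := f \o radial_projection.

Definition partial (i : 'I_3) (F : 'rV[R]_3 -> R) : 'rV[R]_3 -> R :=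
  'D_(delta_mx 0 i) F.

(* C^infinity: every iterated partial derivative of the extension is
   differentiable away from the origin. *)
Definition smooth f : Prop :=
  forall (s : seq 'I_3) (x : 'rV[R]_3), x != 0 ->
    differentiable (foldr partial (extend f) s) x.

Definition grad f x : 'rV[R]_3 := \row_i partial i (extend f) (coords x).

Definition divergence (V : S2 R -> 'rV[R]_3) x : R :=
  \sum_i grad (fun y => V y 0 i) x 0 i.

Definition laplacian f : S2 R -> R := divergence (grad f).

Definition grad_perp f x : 'rV[R]_3 := cross (coords x) (grad f x).

Definition eigenfunction (lambda : R) f : Prop :=
  [/\ smooth f, exists x, f x != 0 & forall x, - laplacian f x = lambda * f x].

End calculus_on_sphere.

Section euler.
Context {R : realType}.
Local Notation sigma := (@surface R).

Definition L2 : {pred S2 R -> R} := Lfun sigma 2%:E.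

Definition normL2 (f : S2 R -> R) : R := fine ('N[sigma]_2%:E[EFin \o f])%E.

Definition mean_zero (f : S2 R -> R) : Prop := \int[sigma]_x f x = 0.

Definition vorticity (omega : S2 R -> R) : Prop :=
  omega \in L2 /\ mean_zero omega.

(* psi = Delta^-1 omega, in the sense of distributions. *)
Definition stream_function (omega psi : S2 R -> R) : Prop :=
  [/\ psi \in L2, mean_zero psi & forall eta, smooth eta ->
    \int[sigma]_x (psi x * laplacian eta x) = \int[sigma]_x (omega x * eta x)].

(* u = nabla^perp psi, in the sense of distributions: the i-th component of
   nabla^perp is the derivative along the divergence-free field
   x |-> cross e_i x, so it is skew-adjoint in L^2. *)
Definition weak_grad_perp (psi : S2 R -> R) (u : S2 R -> 'rV[R]_3) : Prop :=
  forall i, (fun x => u x 0 i) \in L2 /\ forall eta, smooth eta ->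
    \int[sigma]_x (u x 0 i * eta x) =
    - \int[sigma]_x (psi x * grad_perp eta x 0 i).

Definition continuous_in_L2 (omega : R -> S2 R -> R) : Prop :=
  forall t, 0 <= t ->
    normL2 (omega s \- omega t) @[s --> within `[0, +oo[ (nbhs t)] --> 0.

(* d_t omega + u . nabla omega = 0 integrated against test functions on [0, t];
   the transport term is in divergence form because div u = 0. *)
Definition weak_transport (omega : R -> S2 R -> R)
    (u : R -> S2 R -> 'rV[R]_3) : Prop :=
  forall eta, smooth eta -> forall t, 0 <= t ->
    \int[sigma]_x (omega t x * eta x) = \int[sigma]_x (omega 0 x * eta x) +
      \int[lebesgue_measure]_(s in `[0, t])
        (\int[sigma]_x (omega s x * dot (u s x) (grad eta x))).

Definition energy (omega psi : S2 R -> R) : R :=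
  - 2^-1 * \int[sigma]_x (omega x * psi x).

Definition energy_conserved (omega psi : R -> S2 R -> R) : Prop :=
  forall t, 0 <= t -> energy (omega t) (psi t) = energy (omega 0) (psi 0).

Definition casimirs_conserved (omega : R -> S2 R -> R) : Prop :=
  forall f : R -> R, continuous f -> forall s t, 0 <= s -> 0 <= t ->
    sigma.-integrable setT (EFin \o (f \o omega s)) ->
    sigma.-integrable setT (EFin \o (f \o omega t)) ->
    \int[sigma]_x f (omega s x) = \int[sigma]_x f (omega t x).

Definition angular_momentum (omega : S2 R -> R) : 'rV[R]_3 :=
  \row_i \int[sigma]_x (omega x * coords x 0 i).

Definition angular_momentum_conserved (omega : R -> S2 R -> R) : Prop :=
  forall t, 0 <= t -> angular_momentum (omega t) = angular_momentum (omega 0).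

(* Only the restriction of omega to times t >= 0 is constrained. *)
Definition euler_solution (omega0 : S2 R -> R) (omega : R -> S2 R -> R) : Prop :=
  [/\ {ae sigma, forall x, omega 0 x = omega0 x},
      forall t, 0 <= t -> vorticity (omega t),
      continuous_in_L2 omega,
      casimirs_conserved omega /\ angular_momentum_conserved omega &
      exists (psi : R -> S2 R -> R) (u : R -> S2 R -> 'rV[R]_3),
        [/\ forall t, 0 <= t -> stream_function (omega t) (psi t),
            forall t, 0 <= t -> weak_grad_perp (psi t) (u t),
            weak_transport omega u & energy_conserved omega psi]].

Definition rossby_haurwitz (p : S2 R) (Omega : R) (Y : S2 R -> R) : S2 R -> R :=
  fun x => Omega * dot (coords p) (coords x) + Y x.

Definition rotation_invariant (p : S2 R) (Y : S2 R -> R) : Prop :=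
  forall (a : R) x, Y (rotation p a x) = Y x.

End euler.

(* Main.v *)
Require Import Defs.
From HB Require Import structures.
From mathcomp Require Import all_boot all_order all_algebra.
From mathcomp Require Import all_classical all_reals all_analysis.
From mathcomp Require Import measurable_realfun zify ring lra.

Set Implicit Arguments.
Unset Strict Implicit.
Unset Printing Implicit Defensive.

Import Order.TTheory GRing.Theory Num.Theory.
Import numFieldNormedType.Exports.

Local Open Scope classical_set_scope.
Local Open Scope ring_scope.

(** Decompose a mean-zero vorticity as w = l + q + r, where l is the restriction to
    the sphere of a linear form b.x, q that of a traceless quadratic form x^T A x, and
    r is orthogonal to all polynomials of degree at most two. A conserved angular
    momentum means that b does not move.

    High modes. A function orthogonal to the polynomials of degree at most two satisfies
    - <r, Delta^-1 r> <= |r|^2 / 12 ([spectral_gap]), whereas this quotient is exactly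
    1/2 on linear and 1/6 on quadratic harmonics. Hence |w|^2 + 6 <w, Delta^-1 w>, which
    is conserved, does not see q, has a constant contribution from l, and lies between
    |r|^2 / 2 and |r|^2 on the rest: the high modes stay as small as they were
    ([high_modes_stable]). The conservation of |w|^2 then controls |A| from above
    ([quad_part_bound]).

    The quadratic part. It remains to prevent A from rotating on its sphere. By
    [zonal_eigenfunctionE] the reference wave has b = Omega p and the uniaxial matrix
    A0 = c (3 p p^T - I), of norm |A0|^2 = 6 c^2. The cubic Casimir of l + q is

      8 pi / 5 * b^T A b + 32 pi / 105 * tr A^3

    ([cubic_integral]). Among the matrices A with |A|^2 <= 6 c^2 and for c > 0 both terms
    are maximal at A0: the first because A0 is a multiple of the traceless part of p p^T, the
    second by tr A^3 <= |A|^3 / sqrt 6 ([tr3_le]). So near conservation of the cubic Casimir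
    up to an error eps gives p^T A0 p - p^T A p <= C eps, and |A - A0|^2 is an affine
    function of p^T A p on a sphere: |A - A0|^2 <= C eps ([axial_stability]). This is where
    the exponent 1/2 comes from, and where Omega <> 0 is used. For c < 0 all signs are
    reversed. Since the cube of a square integrable vorticity need not be integrable, the
    cube is replaced by the cube of a truncation at a level that l + q never reaches
    ([clamp3]); it is Lipschitz, so replacing w by l + q costs only O(eps).

    The spectral gap rests on three facts about polynomials on the sphere: the Laplacian
    is symmetric on them ([laplacian_sym], a consequence of the recurrence satisfied by the
    moments of monomials), it acts on polynomials of degree n+1 as - (n+1) (n+2) up to
    polynomials of degree n ([polyS_laplacian_top]), and they are dense in L^2
    ([polynomials_dense]). Together they diagonalise the Laplacian without reference to
    explicit spherical harmonics. *)

(** * Integration in spherical coordinates *)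

Section surface_integral.
Context {R : realType}.
Local Notation sigma := (@surface R).
Local Notation leb := (@lebesgue_measure R).
Local Notation chart := (@chart_domain R).

Lemma measurable_chart : measurable chart.
Proof. by apply: measurableX; exact: measurable_itv. Qed.

Lemma chart_sin_ge0 z : chart z -> 0 <= sin z.1.
Proof. by case: z => a b [/=]; rewrite in_itv/= => ? _; rewrite sin_ge0_pi. Qed.

Lemma measurable_chart_sin D : measurable_fun D (fun z : R * R => (sin z.1)%:E).
Proof.
apply: measurable_funTS; apply/measurable_EFinP.
apply: (measurableT_comp (f := @sin R)); last exact: measurable_fst.
by apply: continuous_measurable_fun; exact: continuous_sin.
Qed.

Import HBNNSimple.

(** The surface measure is the image under spherical coordinates of the measure of
    density sin theta, but it is given directly by its values on sets; the formula for
    functions follows by monotone approximation by simple functions. *)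
Lemma surface_integral_ge0 (f : S2 R -> \bar R) :
  measurable_fun setT f -> (forall x, 0 <= f x)%E ->
  (\int[sigma]_x f x =
   \int[leb \x leb]_(z in chart) (f (sphere_point z) * (sin z.1)%:E))%E.
Proof.
move=> mf f0; pose h := nnsfun_approx measurableT mf.
have msp := @measurable_sphere_point R.
have mc := measurable_chart.
have -> : (\int[sigma]_x f x = limn (fun n => \int[sigma]_x (h n x)%:E))%E.
  rewrite -monotone_convergence//.
  - apply: eq_integral => y _; apply/esym/cvg_lim => //.
    by apply: cvg_nnsfun_approx=> // *; apply: f0; rewrite inE.
  - by move=> n; exact/measurable_EFinP/measurable_funP.
  - by move=> n y _; rewrite lee_fin.
  - by move=> y _ m n mn; rewrite lee_fin; exact/lefP/nd_nnsfun_approx.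
have -> : (\int[leb \x leb]_(z in chart) (f (sphere_point z) * (sin z.1)%:E) =
   limn (fun n => \int[leb \x leb]_(z in chart) ((h n (sphere_point z))%:E * (sin z.1)%:E)))%E.
  rewrite -monotone_convergence//.
  - apply: eq_integral => y yc; apply/esym/cvg_lim => //.
    apply: cvgeZr => //.
    by apply: cvg_nnsfun_approx=> // *; apply: f0; rewrite inE.
  - move=> n; apply: emeasurable_funM; last exact: measurable_chart_sin.
    apply/measurable_EFinP; apply: measurable_funTS.
    by apply: (measurableT_comp _ msp); exact: measurable_funP.
  - by move=> n y /chart_sin_ge0 ?; rewrite mule_ge0// lee_fin.
  - move=> y /chart_sin_ge0 ? m n mn; rewrite lee_wpmul2r// lee_fin//.
    exact/lefP/nd_nnsfun_approx.
congr (lim _); congr (_ @ \oo)%classic; apply/funext => n.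
have sum_ge0 y : forall x, (0 <= (y * \1_(h n @^-1` [set y]) x)%:E :> \bar R)%E.
  move=> x; rewrite lee_fin indicE; case: (boolP (x \in _)); rewrite ?mulr0//.
  by rewrite inE /= => <-; rewrite mulr1.
under eq_integral do rewrite fimfunE -fsumEFin//.
rewrite ge0_integral_fsum//; last first.
  by move=> y; exact/measurable_EFinP/measurable_funM.
under [RHS]eq_integral => z zc.
  rewrite fimfunE -fsumEFin// ge0_mule_fsuml//.
  over.
rewrite ge0_integral_fsum//; last 2 first.
  - move=> y; apply: emeasurable_funM; last exact: measurable_chart_sin.
    apply/measurable_EFinP; apply: measurable_funM => //; apply: measurable_funTS.
    by apply: (measurableT_comp _ msp); exact: measurable_indic.
  - by move=> y z /chart_sin_ge0 ?; rewrite mule_ge0// lee_fin.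
apply: eq_fsbigr => y /[!inE] -[x _ xy].
have y0 : 0 <= y by rewrite -xy.
have mA : measurable (h n @^-1` [set y]) by exact: measurable_sfunP.
under eq_integral do rewrite EFinM.
rewrite ge0_integralZl//; last first.
  exact/measurable_EFinP.
under [RHS]eq_integral do rewrite EFinM -muleA.
rewrite ge0_integralZl//; last 2 first.
  - apply: emeasurable_funM; last exact: measurable_chart_sin.
    apply/measurable_EFinP; apply: measurable_funTS.
    by apply: (measurableT_comp _ msp); exact: measurable_indic.
  - by move=> u /chart_sin_ge0 ?; rewrite mule_ge0// lee_fin.
congr (_ * _)%E; rewrite integral_indic// setIT /surface.
rewrite [LHS]integral_mkcondr; apply: eq_integral => z zc.
rewrite patchE indicE; have -> : (z \in sphere_point @^-1` (h n @^-1` [set y])) =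
  (sphere_point z \in h n @^-1` [set y]) by apply/idP/idP; rewrite !inE.
by case: ifPn; rewrite ?mul1e ?mul0e.
Qed.

Lemma surface_setT : (sigma setT < +oo)%E.
Proof.
rewrite /surface preimage_setT setIT.
apply: (@le_lt_trans _ _ (\int[leb \x leb]_(z in chart) (cst 1%:E) z)%E).
  apply: ge0_le_integral => //.
  - exact: measurable_chart.
  - by move=> z /chart_sin_ge0; rewrite lee_fin.
  - exact: measurable_chart_sin.
  - by move=> z _; rewrite lee_fin sin_le1.
rewrite integral_cst; last exact: measurable_chart.
have E : ((leb \x leb) chart = leb `[0%R, pi] * leb `[0%R, (2 * pi)%R])%E.
  by apply: product_measure1E; exact: measurable_itv.
rewrite mul1e [X in (X < _)%E]E.
by rewrite !lebesgue_measure_itv/= !lte_fin pi_gt0 mulr_gt0 ?pi_gt0// ltry.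
Qed.

Let surface_fin : fin_num_fun sigma.
Proof. by apply: lty_fin_num_fun; exact: surface_setT. Qed.

HB.instance Definition _ := Measure_isFinite.Build _ _ _ sigma surface_fin.

Lemma surface_integralE (f : S2 R -> R) :
  sigma.-integrable setT (EFin \o f) ->
  (leb \x leb)%E.-integrable chart (fun z => (f (sphere_point z) * sin z.1)%:E) /\
  (\int[sigma]_x (f x)%:E =
   \int[leb \x leb]_(z in chart) (f (sphere_point z) * sin z.1)%:E)%E.
Proof.
move=> fi; have mf : measurable_fun setT (EFin \o f) by exact: measurable_int fi.
have mc := measurable_chart; have msp := @measurable_sphere_point R.
have key (g : S2 R -> \bar R) : (forall x, 0 <= g x)%E -> sigma.-integrable setT g ->
  (leb \x leb)%E.-integrable chart (fun z => (g (sphere_point z) * (sin z.1)%:E)%E).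
  move=> g0 gi; have mg := measurable_int _ gi.
  apply/integrableP; split.
    apply: emeasurable_funM; last exact: measurable_chart_sin.
    by apply: measurable_funTS; exact: measurableT_comp mg msp.
  under eq_integral => z /[!inE] zc.
    rewrite gee0_abs; last by rewrite mule_ge0// lee_fin chart_sin_ge0.
    over.
  rewrite -surface_integral_ge0//.
  have /integrableP[_] := gi; under eq_integral do rewrite gee0_abs//.
  done.
have ip := key _ (fun x => funepos_ge0 _ x) (integrable_funepos measurableT fi).
have im := key _ (fun x => funeneg_ge0 _ x) (integrable_funeneg measurableT fi).
have E z : ((f (sphere_point z) * sin z.1)%:E =
   ((EFin \o f)^\+ (sphere_point z) * (sin z.1)%:E) -
   ((EFin \o f)^\- (sphere_point z) * (sin z.1)%:E))%E.
  rewrite -muleBl//; last exact: add_def_funeposneg.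
  by rewrite EFinM; congr (_ * _)%E; exact: (congr1 (fun g => g (sphere_point z)) (funeposneg (EFin \o f))).
split.
  by under eq_fun do rewrite E; exact: integrableB.
under [RHS]eq_integral do rewrite E.
rewrite integralB// [LHS]integralE.
by rewrite (surface_integral_ge0 (measurable_funepos mf))// (surface_integral_ge0 (measurable_funeneg mf)).
Qed.

End surface_integral.

(** * Moments of monomials on the sphere *)

Section moments.
Context {R : realType}.
Local Notation sigma := (@surface R).
Local Notation leb := (@lebesgue_measure R).

Lemma Rintegral_is_derive (f F : R -> R) (a b : R) : a < b -> continuous f ->
  (forall x : R, is_derive x 1 F (f x)) ->
  \int[leb]_(x in `[a, b]) f x = F b - F a.
Proof.
move=> ab cf dF.
have cF : continuous F.
  by move=> x; apply/differentiable_continuous/derivable1_diffP; exact: (@ex_derive _ _ _ _ _ _ _ (dF x)).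
rewrite /Rintegral (@continuous_FTC2 _ f F a b) //.
- exact: continuous_subspaceT.
- split.
  + by move=> x _; exact: (@ex_derive _ _ _ _ _ _ _ (dF x)).
  + by apply: cvg_at_right_filter; exact: cF.
  + by apply: cvg_at_left_filter; exact: cF.
- by move=> x _; rewrite derive1E; exact: derive_val.
Qed.

Lemma continuous_integrable_itv (f : R -> R) (a b : R) :
  continuous f -> leb.-integrable `[a, b] (EFin \o f).
Proof.
move=> cf; apply: continuous_compact_integrable; first exact: segment_compact.
exact: continuous_subspaceT.
Qed.

Definition sincos m c (t : R) := sin t ^+ m * cos t ^+ c.

Lemma continuous_sincos m c : continuous (sincos m c).
Proof.
move=> t; apply: cvgM; first exact: (cvg_comp _ _ (@continuous_sin R t) (@exprn_continuous _ _ _)).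
exact: (cvg_comp _ _ (@continuous_cos R t) (@exprn_continuous _ _ _)).
Qed.

Lemma is_derive_sincos m c (t : R) : is_derive t 1 (sincos m.+1 c.+1)
  (m.+1%:R * sincos m c.+2 t - c.+1%:R * sincos m.+2 c t).
Proof.
have h := @is_deriveM _ _ _ _ t 1 _ _ (@is_deriveX _ _ _ m.+1 t 1 _ (is_derive_sin t)) (@is_deriveX _ _ _ c.+1 t 1 _ (is_derive_cos t)).
have -> : sincos m.+1 c.+1 = (@sin R ^+ m.+1) * (@cos R ^+ c.+1).
  by apply/funext => x; rewrite /sincos !fctE.
apply: (is_derive_eq h).
rewrite /sincos /= !fctE /= /GRing.scale /= !exprS; ring.
Qed.

Lemma is_derive_sin_pow m (t : R) : is_derive t 1 (@sin R ^+ m.+1)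
  (m.+1%:R * sincos m 1 t).
Proof.
have h := @is_deriveX _ _ _ m.+1 t 1 _ (is_derive_sin t).
apply: (is_derive_eq h).
by rewrite /sincos /GRing.scale /= expr1; ring.
Qed.

Lemma is_derive_cos_pow m (t : R) : is_derive t 1 (@cos R ^+ m.+1)
  (- m.+1%:R * sincos 1 m t).
Proof.
have h := @is_deriveX _ _ _ m.+1 t 1 _ (is_derive_cos t).
apply: (is_derive_eq h).
by rewrite /sincos /GRing.scale /= expr1; ring.
Qed.

Definition sincos_int (b : R) m c := \int[leb]_(t in `[0, b]) sincos m c t.

(** Integrate the derivative of sin^(m+1) cos^(c+1), which vanishes at both ends. *)
Lemma sincos_int_rec b m c : 0 < b -> sin b = 0 ->
  c.+1%:R * sincos_int b m.+2 c = m.+1%:R * sincos_int b m c.+2.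
Proof.
move=> b0 sb; apply/esym/eqP; rewrite -subr_eq0; apply/eqP.
have ci m' c' := @continuous_integrable_itv _ 0 b (@continuous_sincos m' c').
rewrite /sincos_int -!RintegralZl// -RintegralB//; last 2 first.
- by apply: (integrableZl _ m.+1%:R (ci m c.+2)).
- by apply: (integrableZl _ c.+1%:R (ci m.+2 c)).
rewrite (@Rintegral_is_derive _ _ _ _ b0 _ (is_derive_sincos m c)).
  by rewrite /sincos sb sin0 !exprS !mul0r subrr.
by move=> t; apply: cvgB; apply: cvgZr; exact: continuous_sincos.
Qed.

Lemma sincos_int1 b m : 0 < b -> sin b = 0 -> sincos_int b m 1 = 0.
Proof.
move=> b0 sb; apply/eqP; have m0 : m.+1%:R != 0 :> R by rewrite pnatr_eq0.
rewrite -(mulrI_eq0 _ (mulfI m0)); apply/eqP.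
rewrite /sincos_int -RintegralZl//; last first.
  exact: continuous_integrable_itv (@continuous_sincos m 1).
rewrite (@Rintegral_is_derive _ _ _ _ b0 _ (is_derive_sin_pow m)).
  by rewrite !fctE sb sin0 !exprS !mul0r subrr.
by move=> t; apply: cvgZr; exact: continuous_sincos.
Qed.

Lemma sincos_int_period c : sincos_int (2 * pi) 1 c = 0.
Proof.
apply/eqP; have m0 : - c.+1%:R != 0 :> R by rewrite oppr_eq0 pnatr_eq0.
rewrite -(mulrI_eq0 _ (mulfI m0)); apply/eqP.
rewrite /sincos_int -RintegralZl//; last first.
  exact: continuous_integrable_itv (@continuous_sincos 1 c).
rewrite (@Rintegral_is_derive _ _ _ _ _ _ (is_derive_cos_pow c)).
- by rewrite !fctE mulr_natl cos2pi cos0 subrr.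
- by rewrite mulr_gt0// pi_gt0.
- by move=> t; apply: cvgZr; exact: continuous_sincos.
Qed.

Lemma continuous_S2_measurable (f : S2 R -> R) : continuous f -> measurable_fun setT f.
Proof.
move=> /continuousP cf; apply: (measurability _ (RGenOpens.measurableE R)).
move=> _ [_ [a [b ->] <-]]; rewrite setTI.
by apply: sub_sigma_algebra; exact/cf/interval_open.
Qed.

Lemma continuous_coord (i : 'I_3) : continuous (fun x : S2 R => coords x 0 i).
Proof.
move=> x; apply: (@cvg_comp _ _ _ (@coords R) (fun y : 'rV[R]_3 => y 0 i) _ (nbhs (coords x))).
  exact: (@initial_continuous _ _ (@set_val _ [set x : 'rV[R]_3 | dot x x = 1])).
exact: coord_continuous.
Qed.

Lemma coord_le1 (x : S2 R) (i : 'I_3) : `|coords x 0 i| <= 1.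
Proof.
rewrite -(@ler_sqr R) ?nnegrE// expr1n real_normK ?num_real//.
rewrite -(coordsP x) /dot (bigD1 i)//= -expr2 lerDl; apply: sumr_ge0 => j _.
by rewrite -expr2 sqr_ge0.
Qed.

Definition mon (a b c : nat) (x : S2 R) : R :=
  coords x 0 0 ^+ a * coords x 0 1 ^+ b * coords x 0 2 ^+ c.

Lemma continuous_mon a b c : continuous (mon a b c).
Proof.
have h i n : continuous (fun x : S2 R => coords x 0 i ^+ n).
  by move=> x; exact: (cvg_comp _ _ (@continuous_coord i x) (@exprn_continuous _ _ _)).
by move=> x; exact: (cvgM (cvgM (h 0 a x) (h 1 b x)) (h 2 c x)).
Qed.

Lemma mon_le1 a b c x : `|mon a b c x| <= 1.
Proof.
by rewrite !normrM !normrX !mulr_ile1 ?mulr_ge0 ?exprn_ge0// exprn_ile1// coord_le1.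
Qed.

Lemma bounded_integrable (f : S2 R -> R) (M : R) : measurable_fun setT f ->
  (forall x, `|f x| <= M) -> sigma.-integrable setT (EFin \o f).
Proof.
move=> mf fM; apply: measurable_bounded_integrable => //.
  exact: surface_setT.
exists M; split; first exact: num_real.
by move=> y My x _ /=; rewrite (le_trans (fM x))// ltW.
Qed.

Definition moment (a b c : nat) : R := \int[sigma]_x mon a b c x.

(** A monomial separates in spherical coordinates, so Fubini's theorem factors its integral. *)
Lemma momentE a b c :
  moment a b c = sincos_int pi (a + b).+1 c * sincos_int (2 * pi) b a.
Proof.
pose g : R -> R := (sincos (a + b).+1 c) \_ `[0, pi].
pose h : R -> R := (sincos b a) \_ `[0, 2 * pi].
have gi : leb.-integrable setT (EFin \o g).
  rewrite /g -restrict_EFin; apply: (iffLR (@integrable_mkcond _ _ _ leb `[0, pi] _ _)) => //.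
  exact: continuous_integrable_itv (@continuous_sincos _ _).
have hi : leb.-integrable setT (EFin \o h).
  rewrite /h -restrict_EFin; apply: (iffLR (@integrable_mkcond _ _ _ leb `[0, 2 * pi] _ _)) => //.
  exact: continuous_integrable_itv (@continuous_sincos _ _).
have [ci sE] := surface_integralE (bounded_integrable
  (continuous_S2_measurable (@continuous_mon a b c)) (mon_le1 a b c)).
have mcd := @measurable_chart R.
(* Extended by zero outside the chart, the integrand is a product. *)
have ghE : (fun z : R * R => (g z.1 * h z.2)%:E) =
    (fun z : R * R => (mon a b c (sphere_point z) * sin z.1)%:E) \_ (@chart_domain R).
  apply/funext => -[t u]; rewrite /g /h !patchE.
  have -> : ((t, u) \in @chart_domain R) = (t \in `[0, pi]%classic) && (u \in `[0, 2 * pi]%classic).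
    apply/idP/andP => [/set_mem[]|[/set_mem ? /set_mem ?]].
      by move=> /mem_set ? /mem_set.
    by apply/mem_set; split.
  case: ifPn => _ /=; last by rewrite mul0r.
  case: ifPn => _ /=; last by rewrite mulr0.
  rewrite /mon coordsK !mxE /= /sincos; congr (_%:E).
  by rewrite !exprMn exprS exprD; ring.
have gh_int : (leb \x leb)%E.-integrable setT (fun z : R * R => (g z.1 * h z.2)%:E).
  have X := fun mm => (integrable_mkcond _ mm).1 ci.
  by rewrite ghE; apply: X; apply: measurableX; exact: measurable_itv.
rewrite /moment /Rintegral sE integral_mkcond -ghE -integral12_prod_meas1//=.
have -> : (fun x => \int[leb]_y (g x * h y)%:E)%E = (fun x => (g x)%:E * \int[leb]_y (h y)%:E)%E.
  by apply/funext => x; under eq_integral do rewrite EFinM; rewrite integralZl.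
have hfin : (\int[leb]_y (h y)%:E)%E \is a fin_num by exact: integrable_fin_num.
rewrite -(fineK hfin) integralZr// fineM//; last exact: integrable_fin_num.
by rewrite /sincos_int [X in _ = X * _]Rintegral_mkcond [X in _ = _ * X]Rintegral_mkcond.
Qed.

End moments.

Section moment_values.
Context {R : realType}.
Local Notation SC := (@sincos_int R).

Lemma sincos_int_split b m c : SC b m c = SC b m.+2 c + SC b m c.+2.
Proof.
rewrite /sincos_int -RintegralD//; try exact: continuous_integrable_itv (@continuous_sincos _ _ _).
apply: eq_Rintegral => t _; rewrite /sincos.
by rewrite -[LHS]mulr1 -(cos2Dsin2 t) !exprS; ring.
Qed.

Lemma sincos_int_cos2 b m c : 0 < b -> sin b = 0 ->
  (m + c).+2%:R * SC b m c.+2 = c.+1%:R * SC b m c.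
Proof.
move=> b0 sb; rewrite (sincos_int_split b m c) mulrDr (sincos_int_rec _ _ b0 sb) -mulrDl.
by congr (_ * _); rewrite -natrD; congr (_%:R); lia.
Qed.

Lemma sincos_int_sin2 b m c : 0 < b -> sin b = 0 ->
  (m + c).+2%:R * SC b m.+2 c = m.+1%:R * SC b m c.
Proof.
move=> b0 sb; rewrite (sincos_int_split b m c) mulrDr -(sincos_int_rec _ _ b0 sb) -mulrDl.
by congr (_ * _); rewrite -natrD; congr (_%:R); lia.
Qed.

Let pi2_gt0 : 0 < 2 * pi :> R. Proof. by rewrite mulr_gt0// pi_gt0. Qed.
Let sin_2pi : sin (2 * pi) = 0 :> R. Proof. by rewrite mulr_natl sin2pi. Qed.
Let piP := pi_gt0 R.
Let sinpi0 := @sinpi R.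

(** The three recurrences express I(a+2,b,c) = (a+1)/(a+b+c+3) I(a,b,c), symmetrically
    in the three exponents. They carry all the information on the surface measure that
    the symmetry of the Laplacian needs. *)
Lemma moment_rec_z a b c :
  (a + b + c).+3%:R * (@moment R) a b c.+2 = c.+1%:R * (@moment R) a b c.
Proof.
have h := @sincos_int_cos2 pi (a + b).+1 c piP sinpi0.
by rewrite !momentE !mulrA -h addSn.
Qed.

Lemma moment_rec_x a b c :
  (a + b + c).+3%:R * (@moment R) a.+2 b c = a.+1%:R * (@moment R) a b c.
Proof.
have h1 := @sincos_int_sin2 pi (a + b).+1 c piP sinpi0.
have h2 := @sincos_int_cos2 (2 * pi) b a pi2_gt0 sin_2pi.
rewrite !momentE; have n0 : (a + b).+2%:R != 0 :> R by rewrite pnatr_eq0.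
apply: (mulfI n0).
have -> : (a.+2 + b).+1 = (a + b).+3 by lia.
move: h1 h2; rewrite addSn (addnC b a) => h1 h2.
transitivity (((a + b + c).+3%:R * SC pi (a + b).+3 c) * ((a + b).+2%:R * SC (2 * pi) b a.+2)); first by ring.
by rewrite h1 h2; ring.
Qed.

Lemma moment_rec_y a b c :
  (a + b + c).+3%:R * (@moment R) a b.+2 c = b.+1%:R * (@moment R) a b c.
Proof.
have h1 := @sincos_int_sin2 pi (a + b).+1 c piP sinpi0.
have h2 := @sincos_int_sin2 (2 * pi) b a pi2_gt0 sin_2pi.
rewrite !momentE; have n0 : (a + b).+2%:R != 0 :> R by rewrite pnatr_eq0.
apply: (mulfI n0).
have -> : (a + b.+2).+1 = (a + b).+3 by lia.
move: h1 h2; rewrite addSn (addnC b a) => h1 h2.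
transitivity (((a + b + c).+3%:R * SC pi (a + b).+3 c) * ((a + b).+2%:R * SC (2 * pi) b.+2 a)); first by ring.
by rewrite h1 h2; ring.
Qed.

Lemma moment_z1 a b : (@moment R) a b 1 = 0.
Proof. by rewrite momentE sincos_int1// mul0r. Qed.

Lemma moment_x1 b c : (@moment R) 1 b c = 0.
Proof. by rewrite momentE sincos_int1// mulr0. Qed.

Lemma moment_y1 a c : (@moment R) a 1 c = 0.
Proof. by rewrite momentE sincos_int_period mulr0. Qed.

Lemma moment000 : (@moment R) 0 0 0 = 4 * pi.
Proof.
rewrite momentE /sincos_int.
have -> : \int[lebesgue_measure]_(t in `[0, 2 * pi]) sincos 0 0 t = 2 * pi :> R.
  have d (x : R) : is_derive x 1 id (sincos 0 0 x).
    by rewrite /sincos !expr0 mulr1; exact: is_derive_id.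
  by rewrite (Rintegral_is_derive pi2_gt0 (@continuous_sincos R 0 0) d) subr0.
have -> : \int[lebesgue_measure]_(t in `[0, pi]) sincos 1 0 t = 2 :> R.
  have d (x : R) : is_derive x 1 (- cos) (sincos 1 0 x).
    have := is_deriveN (is_derive_cos x).
    by rewrite opprK /sincos expr1 expr0 mulr1.
  by rewrite (Rintegral_is_derive piP (@continuous_sincos R 1 0) d) !fctE cospi cos0; ring.
by ring.
Qed.

End moment_values.

(** * The inner product of square integrable functions *)

Section L2_inner_product.
Context {R : realType}.
Local Notation sigma := (@surface R).
Local Notation fn := (S2 R -> R).
Implicit Types f g h : fn.

Definition ip f g : R := \int[sigma]_x (f x * g x).

Lemma L2_measurable f : f \in @L2 R -> measurable_fun setT f.
Proof. by rewrite inE => /andP[]; rewrite inE. Qed.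

(** Square integrability in terms of the integral of the square, free of the power
    function in which the norm is expressed. *)
Lemma L2P f : f \in @L2 R <->
  measurable_fun setT f /\ sigma.-integrable setT (EFin \o (fun x => f x ^+ 2)).
Proof.
split=> [fL|[mf fi]]; first by split; [exact: L2_measurable|exact: Lfun2_integrable_sqr].
rewrite inE; apply/andP; split; rewrite inE//= /finite_norm.
rewrite (@lty_poweRy _ _ 2)// powR_Lnorm//.
have /integrableP[_] := fi; apply: le_lt_trans; apply: ge0_le_integral => //=.
- apply/measurable_EFinP; apply: (measurableT_comp (measurable_powR _)) => //.
  exact: measurableT_comp.
- by apply/measurable_EFinP/measurableT_comp => //; exact: measurable_funX.
- by move=> x _; rewrite lee_fin normrX powR_mulrn.
Qed.

Lemma ip_integrable f g : f \in @L2 R -> g \in @L2 R ->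
  sigma.-integrable setT (EFin \o (fun x => f x * g x)).
Proof. by move=> fL gL; apply/Lfun1_integrable; exact: Lfun2_mul_Lfun1. Qed.

Lemma L2_bounded f M : measurable_fun setT f -> (forall x, `|f x| <= M) -> f \in @L2 R.
Proof.
move=> mf fM; apply/L2P; split=> //; apply: (@bounded_integrable _ _ (M ^+ 2)).
  exact: measurable_funX.
by move=> x; rewrite normrX lerXn2r// nnegrE// (le_trans _ (fM x)).
Qed.

Lemma L2D f g : f \in @L2 R -> g \in @L2 R -> f + g \in @L2 R.
Proof. exact: (@Lfun_addr_closed _ _ _ sigma 2%:E (lee1n 2)).2. Qed.

Lemma L2_cst a : cst a \in @L2 R.
Proof. exact: Lfun_cst. Qed.

Lemma L2Z a f : f \in @L2 R -> cst a * f \in @L2 R.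
Proof.
move=> fL; have -> : cst a * f = a \o* f by apply/funext => x; rewrite !fctE mulrC.
by apply: Lfun_scale => //; rewrite ler1n.
Qed.

Lemma L2N f : f \in @L2 R -> - f \in @L2 R.
Proof. by move=> fL; rewrite -[- f]mulN1r; exact: (@L2Z (-1)). Qed.

Lemma L2B f g : f \in @L2 R -> g \in @L2 R -> f - g \in @L2 R.
Proof. by move=> fL gL; apply: L2D => //; exact: L2N. Qed.

Lemma ipC f g : ip f g = ip g f.
Proof. by apply: eq_Rintegral => x _; rewrite mulrC. Qed.

Lemma ipDl f g h : f \in @L2 R -> g \in @L2 R -> h \in @L2 R ->
  ip (f + g) h = ip f h + ip g h.
Proof.
move=> fL gL hL; rewrite /ip -RintegralD//; try exact: ip_integrable.
by apply: eq_Rintegral => x _; rewrite mulrDl.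
Qed.

Lemma ipZl a f g : f \in @L2 R -> g \in @L2 R -> ip (cst a * f) g = a * ip f g.
Proof.
move=> fL gL; rewrite /ip -RintegralZl//; try exact: ip_integrable.
by apply: eq_Rintegral => x _; rewrite mulrA.
Qed.

Lemma ipNl f g : f \in @L2 R -> g \in @L2 R -> ip (- f) g = - ip f g.
Proof. by move=> fL gL; rewrite -[- f]mulN1r (@ipZl (-1))// mulN1r. Qed.

Lemma ipBl f g h : f \in @L2 R -> g \in @L2 R -> h \in @L2 R ->
  ip (f - g) h = ip f h - ip g h.
Proof. by move=> fL gL hL; rewrite ipDl ?ipNl ?L2N. Qed.

Lemma ipDr f g h : f \in @L2 R -> g \in @L2 R -> h \in @L2 R ->
  ip h (f + g) = ip h f + ip h g.
Proof. by move=> *; rewrite ipC ipDl// !(ipC h). Qed.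

Lemma ipBr f g h : f \in @L2 R -> g \in @L2 R -> h \in @L2 R ->
  ip h (f - g) = ip h f - ip h g.
Proof. by move=> *; rewrite ipC ipBl// !(ipC h). Qed.

Lemma ipZr a f g : f \in @L2 R -> g \in @L2 R -> ip f (cst a * g) = a * ip f g.
Proof. by move=> *; rewrite ipC ipZl// ipC. Qed.

Lemma ip_ge0 f : 0 <= ip f f.
Proof. by apply: Rintegral_ge0 => x _; rewrite -expr2 sqr_ge0. Qed.

Lemma ip_CS f g : f \in @L2 R -> g \in @L2 R -> ip f g ^+ 2 <= ip f f * ip g g.
Proof.
move=> fL gL; have q t : 0 <= ip f f - 2 * t * ip f g + t ^+ 2 * ip g g.
  have -> : ip f f - 2 * t * ip f g + t ^+ 2 * ip g g = ip (f - cst t * g) (f - cst t * g).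
    by rewrite ipBl ?ipBr ?ipZl ?ipZr ?L2Z ?L2B ?L2Z// (ipC g f); ring.
  exact: ip_ge0.
have gg0 := ip_ge0 g; have ff0 := ip_ge0 f.
have [g0|gn0] := eqVneq (ip g g) 0.
  have [->|fg0] := eqVneq (ip f g) 0; first by rewrite expr0n/= mulr_ge0.
  have := q ((ip f f + 1) / (2 * ip f g)); rewrite g0 mulr0 addr0.
  have -> : 2 * ((ip f f + 1) / (2 * ip f g)) * ip f g = ip f f + 1 by field.
  by lra.
have gp : 0 < ip g g by rewrite lt_def gn0.
have := q (ip f g / ip g g).
have -> : ip f f - 2 * (ip f g / ip g g) * ip f g + (ip f g / ip g g) ^+ 2 * ip g g
  = (ip f f * ip g g - ip f g ^+ 2) / ip g g by field.
by rewrite pmulr_lge0 ?invr_gt0// subr_ge0.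
Qed.

(** The inner product is only semi-definite on functions; this replaces the
    definiteness that would hold on classes modulo null sets. *)
Lemma ip_eq0l f g : f \in @L2 R -> g \in @L2 R -> ip f f = 0 -> ip f g = 0.
Proof.
move=> fL gL f0; apply/eqP; rewrite -sqrf_eq0 eq_le sqr_ge0 andbT.
by rewrite (le_trans (ip_CS fL gL))// f0 mul0r.
Qed.

Lemma normL2_ge0 f : 0 <= normL2 f.
Proof. by rewrite fine_ge0// Lnorm_ge0. Qed.

Lemma normL2_sqr f : f \in @L2 R -> normL2 f ^+ 2 = ip f f.
Proof.
move=> fL; rewrite /normL2 /ip -powR_mulrn ?fine_ge0 ?Lnorm_ge0//.
have fin : ('N[sigma]_2%:E[EFin \o f] \is a fin_num)%E.
  rewrite ge0_fin_numE ?Lnorm_ge0//.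
  by move: fL; rewrite inE => /andP[_]; rewrite inE.
have -> : fine ('N[sigma]_2%:E[EFin \o f])%E `^ 2 = fine ('N[sigma]_2%:E[EFin \o f] `^ 2)%E.
  by rewrite -(fineK fin).
rewrite powR_Lnorm// /Rintegral; congr fine; apply: eq_integral => x _.
by rewrite /= powR_mulrn// ?real_normK ?num_real// expr2.
Qed.

Lemma ip_triangle f g : f \in @L2 R -> g \in @L2 R ->
  Num.sqrt (ip (f + g) (f + g)) <= Num.sqrt (ip f f) + Num.sqrt (ip g g).
Proof.
move=> fL gL; rewrite -(@ler_sqr R) ?nnegrE ?addr_ge0 ?sqrtr_ge0//.
rewrite sqr_sqrtr ?ip_ge0// sqrrD !sqr_sqrtr ?ip_ge0//.
rewrite ipDl ?ipDr ?L2D// (ipC g f).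
have : ip f g <= Num.sqrt (ip f f) * Num.sqrt (ip g g).
  rewrite -sqrtrM ?ip_ge0//; apply: le_trans (ler_norm _) _.
  by rewrite -sqrtr_sqr ler_sqrt ?mulr_ge0 ?ip_ge0// ip_CS.
by lra.
Qed.

End L2_inner_product.

(** * Rational functions of the coordinates and the norm *)

(** The difference of the two functions vanishes near the point, hence has differential 0. *)
Lemma near_eq_differentiable (R : numFieldType) (V W : normedModType R)
    (f g : V -> W) (a : V) :
  (\near a, f a = g a) -> differentiable f a -> differentiable g a.
Proof.
move=> fg df; pose k := g - f.
have ka : k a = 0 by rewrite /k !fctE (nbhs_singleton fg) subrr.
have kE : k \o shift a = cst (k a) + (\0 : V -> W) +o_ 0 id.
  apply/eqaddoP => e e0; rewrite ka.
  have : \forall h \near (0 : V), f (h + a) = g (h + a).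
    by move: fg; rewrite (near_shift (0 : V)) subr0.
  apply: filterS => h fgh /=.
  by rewrite /k !fctE /= fgh subrr addr0 subrr normr0 mulr_ge0// ltW.
have dk0 : 'd k a = \0 :> (V -> W) by apply: diff_unique kE; exact: cst_continuous.
have dk : differentiable k a.
  by apply/diff_locallyP; rewrite dk0; split => //; exact: cst_continuous.
by have := differentiableD df dk; rewrite /k addrC subrK.
Qed.

Section ratfun.
Context {R : realType}.
Local Notation V := ('rV[R]_3).

Definition rho (x : V) : R := (euclidean_norm x)^-1.

Lemma dot_gt0 (x : V) : x != 0 -> 0 < dot x x.
Proof.
move=> x0; rewrite lt_def; apply/andP; split; last first.
  by apply: sumr_ge0 => i _; rewrite -expr2 sqr_ge0.
apply: contra x0; rewrite psumr_eq0; last by move=> i _; rewrite -expr2 sqr_ge0.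
move=> /allP h; apply/eqP/rowP => i; rewrite mxE.
by have := h i (mem_index_enum _); rewrite /= mulf_eq0 orbb => /eqP.
Qed.

Lemma near_neq0 (x : V) : x != 0 -> \forall y \near x, y != 0.
Proof.
move=> x0; have := @open_nbhs_nbhs _ x [set y | y != 0].
apply; split => //; rewrite (_ : [set y | y != 0] = ~` [set 0]).
  by apply: closed_openC; apply: accessible_closed_set1; apply: hausdorff_accessible; exact: norm_hausdorff.
by apply/seteqP; split=> y /= /eqP.
Qed.

Lemma differentiable_coordinate (i : 'I_3) (x : V) : differentiable (fun y : V => y 0 i) x.
Proof. exact: differentiable_coord. Qed.

Lemma differentiable_dot (x : V) : differentiable (fun y : V => dot y y) x.
Proof.
have -> : (fun y : V => dot y y) = \sum_i (fun y : V => y 0 i * y 0 i).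
  by apply/funext => y; rewrite fct_sumE.
apply: differentiable_sum => i; apply: (@differentiableM _ _ (fun y : V => y 0 i) (fun y => y 0 i)); exact: differentiable_coordinate.
Qed.

Lemma differentiable_rho (x : V) : x != 0 -> differentiable rho x.
Proof.
move=> x0; have p := dot_gt0 x0.
apply: (@differentiableV _ _ (fun y => Num.sqrt (dot y y))); last by rewrite gt_eqF// sqrtr_gt0.
apply: (@differentiable_comp _ _ _ _ (fun y => dot y y) (@Num.sqrt R)); first exact: differentiable_dot.
by apply/derivable1_diffP; exact: (@ex_derive _ _ _ _ _ _ _ (is_derive1_sqrt p)).
Qed.

(** A class closed under partial derivatives that contains the homogeneous extensions
    of the polynomials. The last rule makes the value at the origin immaterial. *)
Inductive ratfun : (V -> R) -> Prop :=
| ratfun_cst a : ratfun (cst a)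
| ratfun_coord i : ratfun (fun x => x 0 i)
| ratfun_rho : ratfun rho
| ratfunD f g : ratfun f -> ratfun g -> ratfun (f + g)
| ratfunM f g : ratfun f -> ratfun g -> ratfun (f * g)
| ratfun_ext f g : ratfun f -> (forall x, x != 0 -> f x = g x) -> ratfun g.

Lemma ratfun_differentiable f : ratfun f -> forall x, x != 0 -> differentiable f x.
Proof.
elim=> {f} [a|i||f g _ hf _ hg|f g _ hf _ hg|f g _ hf fg] x x0.
- exact: differentiable_cst.
- exact: differentiable_coordinate.
- exact: differentiable_rho.
- by apply: differentiableD; [exact: hf|exact: hg].
- by apply: differentiableM; [exact: hf|exact: hg].
- apply: near_eq_differentiable (hf _ x0).
  by apply: filterS (near_neq0 x0) => y; exact: fg.
Qed.

Lemma derive_coordinate (v x : V) (j : 'I_3) : 'D_v (fun y : V => y 0 j) x = v 0 j.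
Proof.
have h : derivable (@id V) x v by exact: derivable_id.
have := derive_mx h; rewrite derive_id => /rowP /(_ j); rewrite mxE => ->.
by congr ('D_v _ x).
Qed.

Lemma derivable_coordinate (v x : V) (j : 'I_3) : derivable (fun y : V => y 0 j) x v.
Proof. exact/diff_derivable/differentiable_coordinate. Qed.

Lemma is_derive_coordinate (v x : V) (j : 'I_3) :
  is_derive x v (fun y : V => y 0 j) (v 0 j).
Proof.
by apply: DeriveDef; [exact: derivable_coordinate|exact: derive_coordinate].
Qed.

Lemma rho_sqr (x : V) : x != 0 -> rho x ^+ 2 * dot x x = 1.
Proof.
move=> x0; have p := dot_gt0 x0.
by rewrite /rho /euclidean_norm exprVn sqr_sqrtr ?ltW// mulVf// gt_eqF.
Qed.

Lemma derive_dot (v x : V) : 'D_v (fun y : V => dot y y) x = 2 * dot v x.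
Proof.
have -> : (fun y : V => dot y y) = (fun y => y 0 0) * (fun y => y 0 0) +
    (fun y => y 0 1) * (fun y => y 0 1) + (fun y => y 0 2) * (fun y => y 0 2).
  by apply/funext => y; rewrite dot3E.
have d i := @is_deriveM _ _ _ _ x v _ _ (is_derive_coordinate v x i) (is_derive_coordinate v x i).
rewrite (@derive_val _ _ _ _ _ _ _ (is_deriveD (is_deriveD (d 0) (d 1)) (d 2))).
by rewrite dot3E /GRing.scale /=; ring.
Qed.

(** Differentiate rho^2 |x|^2 = 1. *)
Lemma derive_rho (v x : V) : x != 0 -> 'D_v rho x = - dot v x * rho x ^+ 3.
Proof.
move=> x0; have dr : derivable rho x v by exact/diff_derivable/differentiable_rho.
have dd : derivable (fun y : V => dot y y) x v by exact/diff_derivable/differentiable_dot.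
have : 'D_v (rho * rho * (fun y : V => dot y y)) x = 'D_v (cst (1 : R)) x.
  apply: near_eq_derive; apply: filterS (near_neq0 x0) => y y0.
  by rewrite /= !fctE -expr2 rho_sqr.
have hr : is_derive x v rho ('D_v rho x) by exact: DeriveDef.
have hd : is_derive x v (fun y : V => dot y y) (2 * dot v x) by apply: DeriveDef => //; exact: derive_dot.
rewrite derive_cst (@derive_val _ _ _ _ _ _ _ (is_deriveM (is_deriveM hr hr) hd)).
rewrite /GRing.scale /= !fctE.
have h := rho_sqr x0; have p := dot_gt0 x0.
set D := 'D_v rho x => e.
have : dot x x * (D - (- dot v x * rho x ^+ 3)) * rho x = 0.
  transitivity ((rho x * rho x * (2 * dot v x) + dot x x * (rho x * D + rho x * D)) / 2
    + dot v x * rho x ^+ 2 * (rho x ^+ 2 * dot x x - 1)); first by field.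
  by rewrite e h subrr mulr0 mul0r addr0.
move/eqP; rewrite !mulf_eq0 (gt_eqF p) /= => /orP[]; first by rewrite subr_eq0 => /eqP.
move=> /eqP r0; move: h; rewrite r0 expr0n/= mul0r => /esym/eqP.
by rewrite oner_eq0.
Qed.

Lemma derive_ratfun f (v : V) : ratfun f -> ratfun ('D_v f).
Proof.
elim=> {f} [a|i||f g rf hf rg hg|f g rf hf rg hg|f g rf hf fg].
- by apply: ratfun_ext (ratfun_cst 0) _ => x _; rewrite derive_cst.
- by apply: ratfun_ext (ratfun_cst (v 0 i)) _ => x _; rewrite derive_coordinate.
- have rd : ratfun (fun x => dot v x).
    have -> : (fun x => dot v x) = cst (v 0 0) * (fun x : V => x 0 0) +
       cst (v 0 1) * (fun x : V => x 0 1) + cst (v 0 2) * (fun x : V => x 0 2).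
      by apply/funext => x; rewrite dot3E.
    by apply: ratfunD; [apply: ratfunD|]; apply: ratfunM; constructor.
  have r := ratfun_rho.
  apply: (@ratfun_ext (cst (-1) * (fun x => dot v x) * (rho * rho * rho))).
    by apply: ratfunM; [apply: ratfunM => //; constructor | do 2 apply: ratfunM => //].
  by move=> x x0; rewrite derive_rho// !fctE /=; ring.
- apply: ratfun_ext (ratfunD hf hg) _ => x x0.
  by rewrite deriveD//; apply: diff_derivable; exact: ratfun_differentiable.
- apply: ratfun_ext (ratfunD (ratfunM rf hg) (ratfunM rg hf)) _ => x x0.
  by rewrite deriveM//; apply: diff_derivable; exact: ratfun_differentiable.
- apply: ratfun_ext hf _ => x x0; apply: near_eq_derive.
  by apply: filterS (near_neq0 x0) => y; exact: fg.
Qed.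

Lemma ratfun_smooth (f : S2 R -> R) : ratfun (extend f) -> smooth f.
Proof.
move=> rf s x x0; apply: ratfun_differentiable x0.
by elim: s => //= i s; exact: derive_ratfun.
Qed.

End ratfun.

(** * Gradient and Laplacian of monomials *)

Section sphere_calculus.
Context {R : realType}.
Local Notation V := ('rV[R]_3).
Local Notation fn := (S2 R -> R).
Implicit Types (f g : fn) (x : S2 R).

Lemma sum3 (T : nmodType) (F : 'I_3 -> T) : \sum_i F i = F 0 + F 1 + F 2.
Proof.
have e1 : lift ord0 ord0 = 1 :> 'I_3 by exact: val_inj.
have e2 : lift ord0 (lift ord0 ord0) = 2 :> 'I_3 by exact: val_inj.
by rewrite !big_ord_recl big_ord0 addr0 addrA e1 e2.
Qed.

Lemma ord3_ind (Q : 'I_3 -> Prop) : Q 0 -> Q 1 -> Q 2 -> forall i, Q i.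
Proof.
move=> q0 q1 q2 [[|[|[|//]]] i3].
- by rewrite (_ : Ordinal i3 = 0)//; exact: val_inj.
- by rewrite (_ : Ordinal i3 = 1)//; exact: val_inj.
- by rewrite (_ : Ordinal i3 = 2)//; exact: val_inj.
Qed.

Lemma crossE (u v : V) : [/\ cross u v 0 0 = u 0 1 * v 0 2 - u 0 2 * v 0 1,
  cross u v 0 1 = u 0 2 * v 0 0 - u 0 0 * v 0 2 &
  cross u v 0 2 = u 0 0 * v 0 1 - u 0 1 * v 0 0].
Proof.
have i1 : (1 + 1 : 'I_3) = 2 by exact: val_inj.
have i2 : (1 + 2 : 'I_3) = 0 by exact: val_inj.
have i3 : (2 + 1 : 'I_3) = 0 by exact: val_inj.
have i4 : (2 + 2 : 'I_3) = 1 by exact: val_inj.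
by rewrite !mxE !add0r i1 i2 i3 i4.
Qed.

Lemma vec_ext (u v : V) : u 0 0 = v 0 0 -> u 0 1 = v 0 1 -> u 0 2 = v 0 2 -> u = v.
Proof. by move=> h0 h1 h2; apply/rowP => i; elim/ord3_ind: i. Qed.

Lemma coords_neq0 x : coords x != 0.
Proof.
apply/eqP => x0; have := coordsP x; rewrite x0 dot3E !mxE !mul0r !addr0 => /esym/eqP.
by rewrite oner_eq0.
Qed.

Lemma coords_inj : injective (@coords R).
Proof. exact: val_inj. Qed.

Lemma rho_coords x : rho (coords x) = 1.
Proof. by rewrite /rho /euclidean_norm coordsP sqrtr1 invr1. Qed.

Lemma coords_radial (y : V) : y != 0 -> coords (radial_projection y) = rho y *: y.
Proof.
move=> y0; rewrite /radial_projection /coords; apply: insubdK.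
rewrite inE /= dot3E !mxE -(rho_sqr y0) dot3E /rho; ring.
Qed.

Lemma radial_coords x : radial_projection (coords x) = x.
Proof. by apply: coords_inj; rewrite coords_radial ?coords_neq0// rho_coords scale1r. Qed.

Lemma extend_coords f x : extend f (coords x) = f x.
Proof. by rewrite /extend /= radial_coords. Qed.

(** The i-th Cartesian component of the tangential gradient; a derivation on functions
    on the sphere. *)
Definition pd i f : fn := fun x => grad f x 0 i.

Lemma pdE i f x : pd i f x = 'D_(delta_mx 0 i) (extend f) (coords x).
Proof. by rewrite /pd mxE. Qed.

Lemma laplacianE f : laplacian f = pd 0 (pd 0 f) + pd 1 (pd 1 f) + pd 2 (pd 2 f).
Proof. by apply/funext => x; rewrite /laplacian /divergence sum3. Qed.

(** Sums and products of such functions are again of this kind because extension by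
    homogeneity commutes with pointwise operations. *)
Definition ratS f := ratfun (extend f).

Lemma ratS_derivable f i x : ratS f -> derivable (extend f) (coords x) (delta_mx 0 i).
Proof. by move=> rf; apply/diff_derivable/ratfun_differentiable => //; exact: coords_neq0. Qed.

Lemma ratS_cst a : ratS (cst a).
Proof. exact: ratfun_cst. Qed.

Lemma ratSD f g : ratS f -> ratS g -> ratS (f + g).
Proof. exact: ratfunD. Qed.

Lemma ratSM f g : ratS f -> ratS g -> ratS (f * g).
Proof. exact: ratfunM. Qed.

Definition crd i : fn := fun x => coords x 0 i.

Lemma extend_crd i (y : V) : y != 0 -> extend (crd i) y = rho y * y 0 i.
Proof. by move=> y0; rewrite /extend /crd /= coords_radial// mxE. Qed.

Lemma ratS_crd i : ratS (crd i).
Proof.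
apply: (ratfun_ext (ratfunM (@ratfun_rho R) (ratfun_coord i))) => y y0.
by rewrite extend_crd.
Qed.

Lemma ratSX f n : ratS f -> ratS (f ^+ n).
Proof.
by move=> rf; elim: n => [|n IH]; [exact: ratS_cst|rewrite exprS; exact: ratSM].
Qed.

Lemma pd_cst i a : pd i (cst a) = 0.
Proof. by apply/funext => x; rewrite pdE (_ : extend _ = cst a)// derive_cst. Qed.

Lemma pdD i f g : ratS f -> ratS g -> pd i (f + g) = pd i f + pd i g.
Proof.
move=> rf rg; apply/funext => x; rewrite !fctE !pdE.
by rewrite (_ : extend (f + g) = extend f + extend g)// deriveD//; exact: ratS_derivable.
Qed.

Lemma pdM i f g : ratS f -> ratS g -> pd i (f * g) = f * pd i g + g * pd i f.
Proof.
move=> rf rg; apply/funext => x; rewrite !fctE !pdE.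
rewrite (_ : extend (f * g) = extend f * extend g)// deriveM; try exact: ratS_derivable.
by rewrite !extend_coords.
Qed.

Lemma pdZ i a f : ratS f -> pd i (cst a * f) = cst a * pd i f.
Proof. by move=> rf; rewrite pdM ?pd_cst ?mulr0 ?addr0//; exact: ratS_cst. Qed.

(** The tangential gradient of x_j is the projection e_j - x_j x. *)
Lemma pd_crd i j : pd i (crd j) = cst (i == j)%:R - crd i * crd j.
Proof.
apply/funext => x; rewrite pdE.
have x0 := coords_neq0 x.
have -> : 'D_(delta_mx 0 i) (extend (crd j)) (coords x) =
    'D_(delta_mx 0 i) (rho * (fun y : V => y 0 j)) (coords x).
  by apply: near_eq_derive; apply: filterS (near_neq0 x0) => y; exact: extend_crd.
rewrite deriveM; first last.
- exact: derivable_coordinate.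
- exact/diff_derivable/differentiable_rho.
rewrite derive_coordinate derive_rho// rho_coords expr1n mulr1 /GRing.scale /= mul1r.
rewrite !fctE !mxE /= (eq_sym j) mulrN; congr (_ - _).
rewrite /crd mulrC; congr (_ * _).
rewrite /dot (bigD1 i)//= !mxE !eqxx mul1r big1 ?addr0// => k ki.
by rewrite mxE (negbTE ki) andbF mul0r.
Qed.

Lemma pdX i f n : ratS f -> pd i (f ^+ n) = cst n%:R * f ^+ n.-1 * pd i f.
Proof.
move=> rf; elim: n => [|n IH].
  by rewrite expr0 pd_cst; apply/funext => x; rewrite !fctE !mul0r.
rewrite exprS pdM//; last exact: ratSX.
rewrite IH; case: n {IH} => [|n].
  by apply/funext => x; rewrite !fctE /= !expr0; ring.
by apply/funext => x; rewrite !fctE /= !exprS; ring.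
Qed.

Lemma monE a b c : mon a b c = crd 0 ^+ a * crd 1 ^+ b * crd 2 ^+ c.
Proof. by apply/funext => x; rewrite /mon !fctE /=. Qed.

Lemma ratS_mon a b c : ratS (mon a b c).
Proof. by rewrite monE; do ?apply: ratSM; apply: ratSX; exact: ratS_crd. Qed.

(** Leibniz' rule: the gradient of a homogeneous f of degree n is grad f - n f x. *)
Lemma pd_mon i a b c : pd i (mon a b c) =
  cst (a%:R * (i == 0)%:R) * mon a.-1 b c + cst (b%:R * (i == 1)%:R) * mon a b.-1 c
  + cst (c%:R * (i == 2)%:R) * mon a b c.-1 - cst (a + b + c)%:R * crd i * mon a b c.
Proof.
have r j n : ratS (crd j ^+ n) by apply: ratSX; exact: ratS_crd.
have r' j : ratS (crd j) by exact: ratS_crd.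
rewrite !monE (pdM i (ratSM (r 0 a) (r 1 b)) (r 2 c)) (pdM i (r 0 a) (r 1 b)).
rewrite (pdX i a (r' 0)) (pdX i b (r' 1)) (pdX i c (r' 2)) !pd_crd.
apply/funext => x; rewrite !fctE /= !natrD.
case: a => [|a]; case: b => [|b]; case: c => [|c] /=; rewrite ?exprS; ring.
Qed.

Let pd2_aux i a (f g : fn) n : ratS f -> ratS g -> pd i (cst a * f - cst n * crd i * g) =
  cst a * pd i f - cst n * (crd i * pd i g + g * pd i (crd i)).
Proof.
move=> rf rg; have rc : ratS (crd i) by exact: ratS_crd.
have -> : cst a * f - cst n * crd i * g = cst a * f + cst (- n) * (crd i * g).
  by apply/funext => x; rewrite !fctE /=; ring.
rewrite pdD ?pdZ ?pdM//; try by do ?apply: ratSM => //; exact: ratS_cst.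
by apply/funext => x; rewrite !fctE /=; ring.
Qed.

Let pd2_mon (i : 'I_3) (a b c : nat) (m1 m2 : fn) (k : R) : k = (nth 0 [:: a; b; c] i)%:R ->
  ratS m1 -> pd i (mon a b c) = cst k * m1 - cst (a + b + c)%:R * crd i * mon a b c ->
  cst k * pd i m1 = cst (k * (k - 1)) * m2 - cst (k * ((a + b + c)%:R - 1)) * mon a b c ->
  cst k * (crd i * m1) = cst k * mon a b c ->
  pd i (pd i (mon a b c)) = cst (k * (k - 1)) * m2 +
    cst ((a + b + c)%:R * ((a + b + c)%:R + 1)) * (crd i ^+ 2) * mon a b c
    - cst (2 * k * (a + b + c)%:R - k + (a + b + c)%:R) * mon a b c.
Proof.
move=> kE rm Dm Dm1 cm; rewrite {1}Dm pd2_aux//; last exact: ratS_mon.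
rewrite Dm1 Dm pd_crd eqxx; apply/funext => x.
move: (congr1 (fun f => f x) cm); rewrite !fctE /= => e.
have e' : k * (coords x 0 i * m1 x) = k * mon a b c x by exact: e.
rewrite /crd; ring: e'.
Qed.

(** For a homogeneous polynomial of degree n, the Laplacian on the sphere is the one of
    the ambient space minus n (n+1). *)
Lemma laplacian_mon a b c : laplacian (mon a b c : fn) =
  cst (a%:R * (a%:R - 1)) * mon a.-2 b c + cst (b%:R * (b%:R - 1)) * mon a b.-2 c
  + cst (c%:R * (c%:R - 1)) * mon a b c.-2
  - cst ((a + b + c)%:R * ((a + b + c)%:R + 1)) * mon a b c.
Proof.
have rm := ratS_mon.
rewrite laplacianE.
rewrite (@pd2_mon 0 a b c (mon a.-1 b c) (mon a.-2 b c) a%:R) //; first last.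
- by apply/funext => x; rewrite !monE !fctE /=; case: a => [|a]; rewrite ?exprS; ring.
- rewrite pd_mon; apply/funext => x; rewrite !monE !fctE /= !natrD.
  by case: a => [|a] /=; rewrite ?exprS; ring.
- by rewrite pd_mon; apply/funext => x; rewrite !fctE /=; ring.
rewrite (@pd2_mon 1 a b c (mon a b.-1 c) (mon a b.-2 c) b%:R) //; first last.
- by apply/funext => x; rewrite !monE !fctE /=; case: b => [|b]; rewrite ?exprS; ring.
- rewrite pd_mon; apply/funext => x; rewrite !monE !fctE /= !natrD.
  by case: b => [|b] /=; rewrite ?exprS; ring.
- by rewrite pd_mon; apply/funext => x; rewrite !fctE /=; ring.
rewrite (@pd2_mon 2 a b c (mon a b c.-1) (mon a b c.-2) c%:R) //; first last.
- by apply/funext => x; rewrite !monE !fctE /=; case: c => [|c]; rewrite ?exprS; ring.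
- rewrite pd_mon; apply/funext => x; rewrite !monE !fctE /= !natrD.
  by case: c => [|c] /=; rewrite ?exprS; ring.
- by rewrite pd_mon; apply/funext => x; rewrite !fctE /=; ring.
apply/funext => x; have s1 : crd 0 x ^+ 2 + crd 1 x ^+ 2 + crd 2 x ^+ 2 = 1.
  by rewrite -(coordsP x) dot3E /crd !expr2.
have e : crd 0 x ^+ 2 = 1 - crd 1 x ^+ 2 - crd 2 x ^+ 2 by rewrite -s1; ring.
rewrite !fctE /= !natrD e; ring.
Qed.

End sphere_calculus.

(** * Polynomials on the sphere and symmetry of the Laplacian *)

Section sphere_polynomials.
Context {R : realType}.
Local Notation fn := (S2 R -> R).
Implicit Types (f g : fn).

(** Restrictions to the sphere of polynomials of degree at most n. Being restrictions,
    they have many expressions as combinations of monomials. *)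
Inductive polyS (n : nat) : fn -> Prop :=
| polyS_mon a b c : (a + b + c <= n)%N -> polyS n (mon a b c)
| polySD f g : polyS n f -> polyS n g -> polyS n (f + g)
| polySZ k f : polyS n f -> polyS n (cst k * f).

Lemma polyS0 n : polyS n 0.
Proof.
have -> : 0 = cst 0 * mon 0 0 0 :> fn by apply/funext => x; rewrite !fctE mul0r.
by apply: polySZ; exact: polyS_mon.
Qed.

Lemma polySN n f : polyS n f -> polyS n (- f).
Proof. by move=> /(polySZ (-1)); rewrite mulN1r. Qed.

Lemma polySB n f g : polyS n f -> polyS n g -> polyS n (f - g).
Proof. by move=> pf /polySN; exact: polySD. Qed.

Lemma polyS_le m n f : (m <= n)%N -> polyS m f -> polyS n f.
Proof.
move=> mn; elim=> [a b c abc|g h _ pg _ ph|k g _ pg].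
- by apply: polyS_mon; exact: leq_trans mn.
- exact: polySD.
- exact: polySZ.
Qed.

Lemma mon_mul a b c a' b' c' :
  mon a b c * mon a' b' c' = mon (a + a') (b + b') (c + c') :> fn.
Proof. by apply/funext => x; rewrite /mon !fctE !exprD; ring. Qed.

Lemma polySM m n f g : polyS m f -> polyS n g -> polyS (m + n) (f * g).
Proof.
move=> pf pg; elim: pf => [a b c abc|h k _ ph _ pk|k h _ ph].
- elim: pg => [a' b' c' abc'|h k _ ph _ pk|k h _ ph].
  + by rewrite mon_mul; apply: polyS_mon; lia.
  + by rewrite mulrDr; exact: polySD.
  + by rewrite mulrCA; exact: polySZ.
- by rewrite mulrDl; exact: polySD.
- by rewrite -mulrA; exact: polySZ.
Qed.

Lemma polyS_cst n k : polyS n (cst k).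
Proof.
have -> : cst k = cst k * mon 0 0 0 :> fn.
  by apply/funext => x; rewrite /mon !fctE !expr0 !mulr1.
by apply: polySZ; exact: polyS_mon.
Qed.

Lemma polyS_crd i : polyS 1 (crd i).
Proof.
elim/ord3_ind: i.
- have -> : crd 0 = mon 1 0 0 :> fn; last exact: polyS_mon.
  by apply/funext => x; rewrite /mon /crd !expr0 !mulr1 expr1.
- have -> : crd 1 = mon 0 1 0 :> fn; last exact: polyS_mon.
  by apply/funext => x; rewrite /mon /crd !expr0 mulr1 mul1r expr1.
- have -> : crd 2 = mon 0 0 1 :> fn; last exact: polyS_mon.
  by apply/funext => x; rewrite /mon /crd !expr0 mulr1 mul1r expr1.
Qed.

Lemma polyS_ratS n f : polyS n f -> ratS f.
Proof.
elim=> [a b c _|g h _ rg _ rh|k g _ rg]; first exact: ratS_mon.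
  exact: ratSD.
by apply: ratSM => //; exact: ratS_cst.
Qed.

Lemma polyS_smooth n f : polyS n f -> smooth f.
Proof. by move=> /polyS_ratS; exact: ratfun_smooth. Qed.

Lemma polyS_measurable n f : polyS n f -> measurable_fun setT f.
Proof.
elim=> [a b c _|g h _ rg _ rh|k g _ rg].
- exact: (continuous_S2_measurable (@continuous_mon R a b c)).
- exact: measurable_funD.
- exact: measurable_funM.
Qed.

Lemma polyS_bounded n f : polyS n f -> exists2 M, 0 <= M & forall x, `|f x| <= M.
Proof.
elim=> [a b c _|g h _ [M M0 gM] _ [N N0 hN]|k g _ [M M0 gM]].
- by exists 1 => // x; exact: mon_le1.
- exists (M + N); first exact: addr_ge0.
  by move=> x; rewrite (le_trans (ler_normD _ _))// lerD.
- exists (`|k| * M); first exact: mulr_ge0.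
  by move=> x; rewrite normrM ler_wpM2l.
Qed.

Lemma polyS_L2 n f : polyS n f -> f \in @L2 R.
Proof.
move=> pf; have [M _ fM] := polyS_bounded pf.
exact: (L2_bounded (polyS_measurable pf) fM).
Qed.

Lemma polyS_grad i n f : polyS n f -> polyS n.+1 (pd i f).
Proof.
elim=> [a b c abc|g h pg dg ph dh|k g pg dg].
- rewrite pd_mon; apply: polySB; last first.
    rewrite -mulrA; apply: polySZ; apply: (@polySM 1); first exact: polyS_crd.
    exact: polyS_mon.
  by do ?apply: polySD; apply: polySZ; apply: polyS_mon; lia.
- by rewrite pdD; [exact: polySD|exact: polyS_ratS pg|exact: polyS_ratS ph].
- by rewrite pdZ; [exact: polySZ|exact: polyS_ratS pg].
Qed.

Lemma laplacianD m n f g : polyS m f -> polyS n g ->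
  laplacian (f + g) = laplacian f + laplacian g.
Proof.
move=> pf pg; have rf := polyS_ratS pf; have rg := polyS_ratS pg.
have rDf i := polyS_ratS (polyS_grad i pf); have rDg i := polyS_ratS (polyS_grad i pg).
rewrite !laplacianE !(pdD _ rf rg) !(pdD _ (rDf _) (rDg _)).
by rewrite [in RHS]addrACA [X in _ = X + _]addrACA.
Qed.

Lemma laplacianZ n k f : polyS n f -> laplacian (cst k * f) = cst k * laplacian f.
Proof.
move=> pf; have rf := polyS_ratS pf; have rDf i := polyS_ratS (polyS_grad i pf).
by rewrite !laplacianE !(pdZ _ _ rf) !(pdZ _ _ (rDf _)) !mulrDr.
Qed.

Lemma cst0_mul f : cst 0 * f = 0.
Proof. exact: mul0r. Qed.

(** The coefficient a (a-1) vanishes exactly when the truncated exponent a.-2 is wrong. *)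
Lemma polyS_second_difference n a (m : nat -> fn) :
  (forall k, (k.+2 <= a)%N -> polyS n (m k)) -> polyS n (cst (a%:R * (a%:R - 1)) * m a.-2).
Proof.
case: a => [|[|a]] h.
- by rewrite mul0r cst0_mul; exact: polyS0.
- by rewrite subrr mulr0 cst0_mul; exact: polyS0.
- by apply: polySZ; exact: h.
Qed.

Lemma laplacian_mon_low n a b c : (a + b + c <= n.+2)%N ->
  polyS n (cst (a%:R * (a%:R - 1)) * mon a.-2 b c + cst (b%:R * (b%:R - 1)) * mon a b.-2 c
  + cst (c%:R * (c%:R - 1)) * mon a b c.-2).
Proof.
move=> abc; do ?apply: polySD.
- by apply: (@polyS_second_difference _ _ (fun k => mon k b c)) => k ka; apply: polyS_mon; lia.
- by apply: (@polyS_second_difference _ _ (fun k => mon a k c)) => k ka; apply: polyS_mon; lia.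
- by apply: (@polyS_second_difference _ _ (fun k => mon a b k)) => k ka; apply: polyS_mon; lia.
Qed.

Lemma polyS_laplacian n f : polyS n f -> polyS n (laplacian f).
Proof.
elim=> [a b c abc|g h pg dg ph dh|k g pg dg].
- rewrite laplacian_mon; apply: polySB; last exact/polySZ/polyS_mon.
  by apply: laplacian_mon_low; lia.
- by rewrite (laplacianD pg ph); exact: polySD.
- by rewrite (laplacianZ k pg); exact: polySZ.
Qed.

(** The top-degree part is an eigenvector modulo lower degrees: the ambient Laplacian
    lowers the degree by two. *)
Lemma polyS_laplacian_top n f : polyS n.+1 f ->
  polyS n (laplacian f + cst (n.+1%:R * n.+2%:R) * f).
Proof.
elim=> [a b c|g h pg dg ph dh|k g pg dg].
- rewrite leq_eqVlt ltnS => /orP[/eqP abc|abc]; last first.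
    by apply: polySD; [exact/polyS_laplacian/polyS_mon|exact/polySZ/polyS_mon].
  rewrite laplacian_mon abc natr1 subrK.
  by apply: laplacian_mon_low; lia.
- rewrite (laplacianD pg ph) mulrDr addrACA; exact: polySD.
- by rewrite (laplacianZ k pg) mulrCA -mulrDr; exact: polySZ.
Qed.

Lemma ip_mon a b c a' b' c' :
  ip (mon a b c) (mon a' b' c' : fn) = moment (a + a') (b + b') (c + c').
Proof. by rewrite /ip /moment; apply: eq_Rintegral => x _; rewrite -[LHS]/((mon a b c * mon a' b' c' : fn) x) mon_mul. Qed.

Lemma mon_L2 a b c : (mon a b c : fn) \in @L2 R.
Proof. exact: polyS_L2 (@polyS_mon (a + b + c) a b c (leqnn _)). Qed.

Let M := @moment R.

(** One coordinate's share in <Delta m, m'> - <m, Delta m'>: since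
    a (a-1) - a' (a'-1) = (a - a') (a + a' - 1), the moment recurrence turns it into
    a multiple of the moment of m m'. *)
Let symmetry_defect (I : nat -> R) (a a' : nat) (N : R) : I 1%N = 0 ->
  (forall k, k.+2 = (a + a')%N -> (N + 1) * I k.+2 = k.+1%:R * I k) ->
  a%:R * (a%:R - 1) * I (a.-2 + a')%N - a'%:R * (a'%:R - 1) * I (a + a'.-2)%N =
  (N + 1) * (a%:R - a'%:R) * I (a + a')%N.
Proof.
move=> I1 h; have [|aa] := ltnP 1 (a + a'); last first.
  move: {h} aa; case: a => [|[|a]]; case: a' => [|[|a']] //= _;
  by rewrite ?I1; ring.
case E : (a + a')%N => [|[|k]] // _.
have -> : a%:R * (a%:R - 1) * I (a.-2 + a')%N = a%:R * (a%:R - 1) * I k.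
  move: E; case: a {h} => [|[|a]] E; rewrite ?subrr ?mulr0 ?mul0r//=.
  by congr (_ * I _); lia.
have -> : a'%:R * (a'%:R - 1) * I (a + a'.-2)%N = a'%:R * (a'%:R - 1) * I k.
  move: E; case: a' {h} => [|[|a']] E; rewrite ?subrr ?mulr0 ?mul0r//=.
  by congr (_ * I _); lia.
have e : a%:R = k.+2%:R - a'%:R :> R by rewrite -E natrD addrK.
rewrite [RHS]mulrAC (h k)// e; rewrite -!natr1; ring.
Qed.

Let ip_lin4 (m1 m2 m3 m4 g : fn) (k1 k2 k3 k4 : R) : m1 \in @L2 R -> m2 \in @L2 R ->
  m3 \in @L2 R -> m4 \in @L2 R -> g \in @L2 R ->
  ip (cst k1 * m1 + cst k2 * m2 + cst k3 * m3 - cst k4 * m4) g =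
  k1 * ip m1 g + k2 * ip m2 g + k3 * ip m3 g - k4 * ip m4 g.
Proof.
move=> L1 L2' L3 L4 Lg; have Z (k : R) m := @L2Z R k m.
by rewrite ipBl ?ipDl ?ipZl// ?L2D// ?Z// L2D// Z.
Qed.

(** The shares of the three coordinates add up to (N+1) (n-n') times the moment of m m',
    where n + n' = N, and this equals n (n+1) - n' (n'+1) times that moment. *)
Lemma laplacian_sym_mon a b c a' b' c' :
  ip (laplacian (mon a b c)) (mon a' b' c' : fn) = ip (mon a b c) (laplacian (mon a' b' c')).
Proof.
have mL := mon_L2; rewrite [RHS]ipC !laplacian_mon !ip_lin4// !ip_mon.
rewrite (addnC a'.-2) (addnC b'.-2) (addnC c'.-2) !(addnC a' a) !(addnC b' b) !(addnC c' c) -/M.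
pose A := (a + a')%N; pose B := (b + b')%N; pose C := (c + c')%N; pose T : R := (A + B + C)%:R.
have r0 : a%:R * (a%:R - 1) * M (a.-2 + a') B C - a'%:R * (a'%:R - 1) * M (a + a'.-2) B C =
  (T + 1) * (a%:R - a'%:R) * M A B C.
  apply: (@symmetry_defect (fun k => M k B C)) => [|k e]; first exact: moment_x1.
  by rewrite /M -moment_rec_x; congr (_ * _); rewrite natr1; congr (_%:R); lia.
have r1 : b%:R * (b%:R - 1) * M A (b.-2 + b') C - b'%:R * (b'%:R - 1) * M A (b + b'.-2) C =
  (T + 1) * (b%:R - b'%:R) * M A B C.
  apply: (@symmetry_defect (fun k => M A k C)) => [|k e]; first exact: moment_y1.
  by rewrite /M -moment_rec_y; congr (_ * _); rewrite natr1; congr (_%:R); lia.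
have r2 : c%:R * (c%:R - 1) * M A B (c.-2 + c') - c'%:R * (c'%:R - 1) * M A B (c + c'.-2) =
  (T + 1) * (c%:R - c'%:R) * M A B C.
  apply: (@symmetry_defect (fun k => M A B k)) => [|k e]; first exact: moment_z1.
  by rewrite /M -moment_rec_z; congr (_ * _); rewrite natr1; congr (_%:R); lia.
have TE : T = a%:R + a'%:R + (b%:R + b'%:R) + (c%:R + c'%:R) by rewrite /T !natrD.
move: r0 r1 r2; rewrite TE !natrD -/A -/B -/C => r0 r1 r2.
apply/eqP; rewrite -subr_eq0; apply/eqP.
move: r0 r1 r2; set m1 := M (a.-2 + a') B C; set m2 := M A (b.-2 + b') C.
set m3 := M A B (c.-2 + c'); set m1' := M (a + a'.-2) B C.
set m2' := M A (b + b'.-2) C; set m3' := M A B (c + c'.-2) => r0 r1 r2.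
transitivity ((a%:R * (a%:R - 1) * m1 - a'%:R * (a'%:R - 1) * m1') +
  (b%:R * (b%:R - 1) * m2 - b'%:R * (b'%:R - 1) * m2') +
  (c%:R * (c%:R - 1) * m3 - c'%:R * (c'%:R - 1) * m3') -
  ((a%:R + b%:R + c%:R) * (a%:R + b%:R + c%:R + 1) -
   (a'%:R + b'%:R + c'%:R) * (a'%:R + b'%:R + c'%:R + 1)) * M A B C); first by ring.
by rewrite r0 r1 r2; ring.
Qed.

Lemma laplacian_sym m n f g : polyS m f -> polyS n g ->
  ip (laplacian f) g = ip f (laplacian g).
Proof.
have lL n' h : polyS n' h -> laplacian h \in @L2 R.
  by move=> ph; exact: polyS_L2 (polyS_laplacian ph).
have key a b c : polyS n g -> ip (laplacian (mon a b c)) g = ip (mon a b c) (laplacian g).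
  have mL := mon_L2 a b c; have mL' := lL _ _ (@polyS_mon (a + b + c) a b c (leqnn _)).
  elim=> {g} [a' b' c' _|h k ph eh pk ek|k h ph eh]; first exact: laplacian_sym_mon.
  - rewrite (laplacianD ph pk) (ipDr (lL _ _ ph) (lL _ _ pk) mL).
    by rewrite [LHS](ipDr (polyS_L2 ph) (polyS_L2 pk) mL') eh ek.
  - by rewrite (laplacianZ k ph) (ipZr _ mL (lL _ _ ph)) [LHS](ipZr _ mL' (polyS_L2 ph)) eh.
move=> pf pg; have gL := polyS_L2 pg; have gL' := lL _ _ pg.
elim: pf => [a b c _|h k ph eh pk ek|k h ph eh]; first exact: key.
- rewrite (laplacianD ph pk) (ipDl (lL _ _ ph) (lL _ _ pk) gL).
  by rewrite [RHS](ipDl (polyS_L2 ph) (polyS_L2 pk) gL') eh ek.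
- by rewrite (laplacianZ k ph) (ipZl _ (lL _ _ ph) gL) [RHS](ipZl _ (polyS_L2 ph) gL') eh.
Qed.

(** The polynomial Delta h + (n+1)(n+2) h has degree n, and it is orthogonal to all
    polynomials of degree n by symmetry; so it has norm zero, although it is not shown
    to vanish pointwise. *)
Lemma harmonic_eigen n h (g : fn) : polyS n.+1 h -> (forall q, polyS n q -> ip h q = 0) ->
  g \in @L2 R -> ip g (laplacian h) = - (n.+1%:R * n.+2%:R) * ip g h.
Proof.
move=> ph hq gL; pose e := laplacian h + cst (n.+1%:R * n.+2%:R) * h.
have pe : polyS n e by exact: polyS_laplacian_top.
have [hL eL] := (polyS_L2 ph, polyS_L2 pe).
have lL := polyS_L2 (polyS_laplacian ph).
have e0 : ip e e = 0.
  rewrite {1}/e ipDl ?L2Z// ipZl// hq// mulr0 addr0.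
  by rewrite (laplacian_sym ph pe) hq//; exact: polyS_laplacian.
have := ip_eq0l eL gL e0; rewrite ipC /e ipDr ?L2Z// ipZr// => /eqP.
by rewrite addr_eq0 mulNr => /eqP.
Qed.

End sphere_polynomials.

(** * Density of polynomials *)

Section density.
Context {R : realType}.
Local Notation sigma := (@surface R).
Local Notation fn := (S2 R -> R).
Implicit Types (f g h : fn).

(** Dominated convergence applied to the squares of the differences. *)
Lemma L2_dominated_cvg (f_ : nat -> fn) f g e : (forall n, measurable_fun setT (f_ n)) ->
  measurable_fun setT f -> g \in @L2 R -> (forall n x, `|f_ n x| <= g x) ->
  (forall x, f_ n x @[n --> \oo] --> f x) -> 0 < e ->
  exists n, ip (f - f_ n) (f - f_ n) < e.
Proof.
move=> mf_ mf gL f_g f_f e0.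
have fg x : `|f x| <= g x.
  have c : `|f_ n x| @[n --> \oo] --> `|f x| by apply: cvg_norm; exact: f_f.
  rewrite -(cvg_lim (@Rhausdorff R) c); apply: limr_le; first by apply/cvg_ex; exists `|f x|.
  by apply: nearW => n; exact: f_g.
pose F n x : \bar R := ((f x - f_ n x) * (f x - f_ n x))%:E.
have mF n : measurable_fun setT (F n).
  by apply/measurable_EFinP/measurable_funM; exact: measurable_funB.
have ig : sigma.-integrable setT (fun x => (4 * (g x * g x))%:E).
  have -> : (fun x => (4 * (g x * g x))%:E) =
      (fun x => 4%:E * (EFin \o (fun x => g x * g x)%R) x)%E by apply/funext => x; rewrite EFinM.
  by apply: integrableZl => //; exact: ip_integrable.
have F0 : {ae sigma, forall x, setT x -> F n x @[n --> \oo] --> cst 0%E x}.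
  apply: aeW => x _; apply: cvg_EFin; first exact: nearW.
  have h : (f x - f_ n x) @[n --> \oo] --> f x - f x.
    by apply: cvgB; [exact: cvg_cst|exact: f_f].
  have := cvgM h h; rewrite subrr mulr0; exact.
have Fg : {ae sigma, forall x n, setT x -> (`|F n x| <= (4 * (g x * g x))%:E)%E}.
  apply: aeW => x n _; rewrite lee_fin normrM.
  have a : `|f x - f_ n x| <= 2 * g x.
    by rewrite (le_trans (ler_normB _ _))// mulr_natl mulr2n lerD.
  have -> : 4 * (g x * g x) = (2 * g x) * (2 * g x) by ring.
  by rewrite ler_pM.
have [_ _] := dominated_convergence measurableT mF (measurable_cst 0%E) F0 ig Fg.
rewrite integral0 => /fine_cvgP[_] /cvgrPdist_lt /(_ _ e0) [n _ /(_ n (leqnn n))].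
rewrite sub0r normrN /= => h; exists n; apply: le_lt_trans h.
exact: ler_norm.
Qed.

Definition nrm f := Num.sqrt (ip f f).

Lemma nrm_ge0 f : 0 <= nrm f. Proof. exact: sqrtr_ge0. Qed.

Lemma nrmD f g : f \in @L2 R -> g \in @L2 R -> nrm (f + g) <= nrm f + nrm g.
Proof. exact: ip_triangle. Qed.

Lemma nrm_sqr f : nrm f ^+ 2 = ip f f.
Proof. by rewrite sqr_sqrtr// ip_ge0. Qed.

Lemma le_nrm f g : f \in @L2 R -> g \in @L2 R -> (forall x, `|f x| <= `|g x|) -> nrm f <= nrm g.
Proof.
move=> fL gL fg; rewrite ler_sqrt ?ip_ge0//; apply: le_Rintegral => //;
  [exact: ip_integrable|exact: ip_integrable|].
by move=> x _; rewrite -!expr2 -[leLHS]real_normK ?num_real// -[leRHS]real_normK ?num_real// ler_sqr.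
Qed.

Lemma nrmZ k f : f \in @L2 R -> nrm (cst k * f) = `|k| * nrm f.
Proof.
move=> fL; rewrite /nrm ipZl ?ipZr ?L2Z// mulrA -expr2 sqrtrM ?sqr_ge0//.
by rewrite sqrtr_sqr.
Qed.

Definition poly_approx f := f \in @L2 R /\
  forall e, 0 < e -> exists n q, polyS n q /\ nrm (f - q) < e.

Lemma poly_approx_poly n q : polyS n q -> poly_approx q.
Proof.
move=> pq; split; first exact: polyS_L2 pq.
move=> e e0; exists n, q; split => //.
have -> : q - q = cst 0 * q by rewrite subrr; apply/esym; exact: mul0r.
by rewrite nrmZ ?normr0 ?mul0r//; exact: polyS_L2 pq.
Qed.

Lemma poly_approx_lim f : f \in @L2 R ->
  (forall e, 0 < e -> exists g, poly_approx g /\ nrm (f - g) < e) -> poly_approx f.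
Proof.
move=> fL h; split => // e e0; have [|g [[gL gP] fg]] := h (e / 2); first by rewrite divr_gt0.
have [|n [q [pq gq]]] := gP (e / 2); first by rewrite divr_gt0.
exists n, q; split => //; have qL := polyS_L2 pq.
have -> : f - q = (f - g) + (g - q) by rewrite addrA subrK.
rewrite (le_lt_trans (nrmD _ _)) ?L2B//.
by rewrite [ltRHS]splitr ltrD.
Qed.

Lemma poly_approxD f g : poly_approx f -> poly_approx g -> poly_approx (f + g).
Proof.
move=> [fL fP] [gL gP]; split; first exact: L2D.
move=> e e0; have e2 : 0 < e / 2 by rewrite divr_gt0.
have [n [q [pq fq]]] := fP _ e2; have [m [r [pr gr]]] := gP _ e2.
have [qL rL] := (polyS_L2 pq, polyS_L2 pr).
exists (maxn n m), (q + r); split.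
  by apply: polySD; [apply: polyS_le pq|apply: polyS_le pr]; rewrite ?leq_maxl ?leq_maxr.
have -> : f + g - (q + r) = (f - q) + (g - r) by rewrite opprD addrACA.
rewrite (le_lt_trans (nrmD _ _)) ?L2B//.
by rewrite [ltRHS]splitr ltrD.
Qed.

(** Bounded functions that are limits of polynomials in L^2. Boundedness makes the
    class an algebra, which plain limits in L^2 do not form. *)
Definition bounded_approx f := exists2 M, 0 <= M /\ (forall x, `|f x| <= M) & poly_approx f.

Lemma bounded_approx_poly n q : polyS n q -> bounded_approx q.
Proof.
move=> pq; have [M M0 qM] := polyS_bounded pq.
by exists M => //; exact: poly_approx_poly pq.
Qed.

Lemma bounded_approx_cst k : bounded_approx (cst k).
Proof. exact: bounded_approx_poly (polyS_cst 0 k). Qed.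

Lemma bounded_approxD f g : bounded_approx f -> bounded_approx g -> bounded_approx (f + g).
Proof.
move=> [M [M0 fM] fP] [N [N0 gN] gP]; exists (M + N); last exact: poly_approxD.
by split=> [|x]; rewrite ?addr_ge0// (le_trans (ler_normD _ _))// lerD.
Qed.

(** Approximate g by r first, then f by q with a precision that depends on the bound
    of r: f g - q r = f (g - r) + r (f - q). *)
Lemma bounded_approxM f g : bounded_approx f -> bounded_approx g -> bounded_approx (f * g).
Proof.
move=> [M [M0 fM] [fL fP]] [N [N0 gN] [gL gP]].
have key h k B : h \in @L2 R -> k \in @L2 R -> (forall x, `|h x| <= B) -> h * k \in @L2 R /\
    nrm (h * k) <= B * nrm k.
  move=> hL kL hB.
  have mhk : measurable_fun setT (h * k).
    by apply: measurable_funM; exact: L2_measurable.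
  have bk x : `|(h * k) x| <= `|(cst B * k) x|.
    by rewrite !fctE !normrM ler_wpM2r// (le_trans (hB x))// ler_norm.
  have hkL : h * k \in @L2 R.
    apply/L2P; split => //.
    have [_ /integrableP[_ BL]] := (L2P (cst B * k)).1 (L2Z _ kL).
    apply/integrableP; split.
      by apply/measurable_EFinP; exact: measurable_funX.
    apply: le_lt_trans BL; apply: ge0_le_integral => //=.
    - by apply/measurable_EFinP/measurableT_comp => //; exact: measurable_funX.
    - apply/measurable_EFinP/measurableT_comp => //; apply: measurable_funX.
      by apply: measurable_funM => //; exact: L2_measurable.
    - by move=> x _; rewrite lee_fin !normrX lerXn2r// nnegrE.
  split=> //; have B0 : 0 <= B := le_trans (normr_ge0 _) (hB (@north R)).
  by rewrite (le_trans (le_nrm _ _ bk)) ?L2Z// nrmZ// ger0_norm.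
exists (M * N); first by split=> [|x]; rewrite ?mulr_ge0// normrM ler_pM.
split; first by have [] := key _ _ _ fL gL fM.
move=> e e0.
have [|m [r [pr gr]]] := gP (e / 2 / (M + 1)).
  by rewrite !divr_gt0// ltr_wpDl.
have [B B0 rB] := polyS_bounded pr; have rL := polyS_L2 pr.
have [|n [q [pq fq]]] := fP (e / 2 / (B + 1)).
  by rewrite !divr_gt0// ltr_wpDl.
have qL := polyS_L2 pq.
exists (n + m)%N, (q * r); split; first exact: polySM.
have -> : f * g - q * r = f * (g - r) + r * (f - q).
  by apply/funext => x; rewrite !fctE; ring.
have [L1 n1] := key _ _ _ fL (L2B gL rL) fM.
have [L2' n2] := key _ _ _ rL (L2B fL qL) rB.
rewrite (le_lt_trans (nrmD L1 L2'))// [ltRHS]splitr.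
have aux (A t : R) : 0 <= A -> 0 <= t -> t < e / 2 / (A + 1) -> A * t < e / 2.
  move=> A0 t0; rewrite ltr_pdivlMr ?ltr_wpDl// => h; apply: le_lt_trans h.
  by rewrite mulrDr mulr1 (mulrC t) lerDl.
by rewrite ltrD// (le_lt_trans n1, le_lt_trans n2)// aux// nrm_ge0.
Qed.

Lemma bounded_approx_cvg (f_ : nat -> fn) f M : (forall n, bounded_approx (f_ n)) ->
  (forall n x, `|f_ n x| <= M) -> (forall x, f_ n x @[n --> \oo] --> f x) ->
  bounded_approx f.
Proof.
move=> af fM ff.
have mf_ n : measurable_fun setT (f_ n) by have [_ _ [/L2_measurable]] := af n.
have mf : measurable_fun setT f by apply: measurable_fun_cvg mf_ _ => x _; exact: ff.
have fM' x : `|f x| <= M.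
  have c : `|f_ n x| @[n --> \oo] --> `|f x| by apply: cvg_norm; exact: ff.
  rewrite -(cvg_lim (@Rhausdorff R) c); apply: limr_le; first by apply/cvg_ex; exists `|f x|.
  by apply: nearW => n; exact: fM.
have M0 : 0 <= M := le_trans (normr_ge0 _) (fM' (@north R)).
exists M => //; apply: poly_approx_lim; first exact: L2_bounded fM'.
move=> e e0.
have [|n] := @L2_dominated_cvg f_ f (cst M) (e ^+ 2) mf_ mf (L2_cst _) fM ff.
  by rewrite exprn_gt0.
rewrite -nrm_sqr ltr_sqr ?nnegrE ?nrm_ge0 ?ltW// => h.
by exists (f_ n); split => //; have [] := af n.
Qed.

End density.

Section borel_density.
Context {R : realType}.
Local Notation sigma := (@surface R).
Local Notation fn := (S2 R -> R).
Implicit Types (f g h : fn).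

(** Its iterates on [-1, 1] converge to the sign function, so that indicators of
    half-spaces become limits of polynomials without a uniform approximation theorem. *)
Definition smoothstep (u : R) : R := 3 / 2 * u - 1 / 2 * u ^+ 3.

Lemma smoothstepN u : smoothstep (- u) = - smoothstep u.
Proof. by rewrite /smoothstep; field. Qed.

Lemma smoothstep0 : smoothstep 0 = 0.
Proof. by rewrite /smoothstep; ring. Qed.

Lemma smoothstep_pos u : 0 <= u <= 1 -> 0 <= smoothstep u <= 1.
Proof.
move=> /andP[u0 u1]; apply/andP; split.
  have -> : smoothstep u = u * ((1 - u) * (1 + u) + 2) / 2 by rewrite /smoothstep; field.
  rewrite divr_ge0// mulr_ge0// addr_ge0// mulr_ge0//; lra.
rewrite -subr_ge0; have -> : 1 - smoothstep u = (1 - u) ^+ 2 * (2 + u) / 2.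
  by rewrite /smoothstep; field.
by rewrite divr_ge0// mulr_ge0 ?sqr_ge0//; lra.
Qed.

(** With v the current iterate, 1 - s(v) = (1 - v) t with
    t = (1 - v) (2 + v) / 2, and t <= 1 - u / 2 because v >= u: convergence is geometric. *)
Lemma smoothstep_iter_pos (u : R) : 0 < u <= 1 -> iter n smoothstep u @[n --> \oo] --> (1 : R).
Proof.
move=> /andP[u0 u1].
have b n : u <= iter n smoothstep u <= 1 /\ 1 - iter n smoothstep u <= (1 - u / 2) ^+ n.
  elim: n => [|n [/andP[ul l1] le]]; first by rewrite /= expr0; split; [rewrite lexx|lra].
  rewrite iterS; set v := iter n smoothstep u in ul l1 le *.
  have v0 : 0 <= v <= 1 by rewrite l1 (le_trans _ ul)// ltW.
  have e : smoothstep v - v = v * (1 - v) * (1 + v) / 2 by rewrite /smoothstep; field.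
  have e2 : 1 - smoothstep v = (1 - v) * ((1 - v) * (2 + v) / 2) by rewrite /smoothstep; field.
  have /andP[_ s1] := smoothstep_pos v0; split.
    rewrite s1 andbT (le_trans ul)// -subr_ge0 e divr_ge0// !mulr_ge0//; lra.
  rewrite e2 exprS mulrC ler_pM//; try lra.
    by rewrite divr_ge0// mulr_ge0//; lra.
  have : 0 <= v * v by rewrite mulr_ge0//; lra.
  by lra.
have q : `|1 - u / 2| < 1 by rewrite ltr_norml; lra.
have c : (1 - (1 - u / 2) ^+ n) @[n --> \oo] --> (1 - 0 : R).
  by apply: cvgB; [exact: cvg_cst|exact: cvg_expr].
rewrite subr0 in c; have c1 : (1 : R) @[n --> \oo] --> (1 : R) by exact: cvg_cst.
apply: squeeze_cvgr c c1.
apply: nearW => n; have [/andP[_ l1] le] := b n; rewrite l1 andbT; lra.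
Qed.

Lemma smoothstep_iter (u : R) : `|u| <= 1 -> iter n smoothstep u @[n --> \oo] --> Num.sg u.
Proof.
move=> u1; have [u0|u0|->] := ltgtP u 0.
- rewrite ltr0_sg//.
  have c : - iter n smoothstep (- u) @[n --> \oo] --> (-1 : R).
    by apply: cvgN; apply: smoothstep_iter_pos; move: u1; rewrite ler_norml => /andP[? ?]; lra.
  have e n : iter n smoothstep u = - iter n smoothstep (- u).
    by elim: n => [|n IH]; rewrite ?opprK// !iterS IH smoothstepN.
  by under eq_cvg => n do rewrite e.
- rewrite gtr0_sg//; apply: smoothstep_iter_pos; rewrite u0.
  by rewrite (le_trans (ler_norm _) u1).
- have e n : iter n smoothstep 0 = 0 by elim: n => //= n ->; exact: smoothstep0.
  by rewrite sgr0; under eq_cvg => n do rewrite e; exact: cvg_cst.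
Qed.

Lemma bounded_approx_sg f : bounded_approx f -> bounded_approx (fun x => Num.sg (f x)).
Proof.
move=> af; have [M [M0 fM] _] := af.
pose u : fn := cst (M + 1)^-1 * f; have M1 : 0 < M + 1 by rewrite ltr_wpDl.
have u1 x : `|u x| <= 1.
  rewrite normrM normfV (gtr0_norm M1) mulrC ler_pdivrMr// mul1r.
  by rewrite (le_trans (fM x))// lerDl.
have -> : (fun x => Num.sg (f x)) = (fun x => Num.sg (u x)).
  by apply/funext => x; rewrite /u !fctE sgrM (gtr0_sg (x := _^-1)) ?mul1r// invr_gt0.
apply: (@bounded_approx_cvg _ (fun n x => iter n smoothstep (u x)) _ 1).
- elim => [|n IH]; first by apply: bounded_approxM => //; exact: bounded_approx_cst.
  have -> : (fun x => iter n.+1 smoothstep (u x)) =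
     cst (3 / 2) * (fun x => iter n smoothstep (u x)) + cst (- (1 / 2)) *
       ((fun x => iter n smoothstep (u x)) * ((fun x => iter n smoothstep (u x)) * (fun x => iter n smoothstep (u x)))).
    by apply/funext => x; rewrite !fctE /= {1}/smoothstep; ring.
  have C := @bounded_approx_cst R.
  by apply: bounded_approxD; apply: bounded_approxM => //; do 2?apply: bounded_approxM.
- move=> n x; suff : `|iter n smoothstep (u x)| <= 1 by [].
  elim: n => [|n IH]; first exact: u1.
  rewrite iterS; set v := iter _ _ _ in IH *.
  have [v0|v0] := leP 0 v.
    have /andP[s0 s1] : 0 <= smoothstep v <= 1.
      by apply: smoothstep_pos; rewrite v0 (le_trans (ler_norm _) IH).
    by rewrite ger0_norm.
  have /andP[s0 s1] : 0 <= smoothstep (- v) <= 1.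
    by apply: smoothstep_pos; rewrite oppr_ge0 ltW// -(ltr0_norm v0).
  by rewrite -normrN -smoothstepN ger0_norm.
- by move=> x; exact: smoothstep_iter.
Qed.

Definition approx_set (A : set (S2 R)) := bounded_approx (\1_A : fn).

Lemma approx_setC A : approx_set A -> approx_set (~` A).
Proof.
move=> aA; rewrite /approx_set; have -> : \1_(~` A) = cst 1 + cst (-1) * \1_A :> fn.
  apply/funext => x; rewrite !fctE !indicE in_setC.
  by case: (x \in A); rewrite /= ?mulr1 ?mulr0 ?addr0 ?subrr.
apply: bounded_approxD; first exact: bounded_approx_cst.
by apply: bounded_approxM => //; exact: bounded_approx_cst.
Qed.

Lemma approx_setI A B : approx_set A -> approx_set B -> approx_set (A `&` B).
Proof.
by move=> aA aB; rewrite /approx_set indicI; exact: bounded_approxM.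
Qed.

Lemma approx_setT : approx_set setT.
Proof. by rewrite /approx_set indicT; exact: bounded_approx_cst. Qed.

(** A countable intersection is the pointwise limit of finite ones. *)
Lemma approx_set_bigcap (F : (set (S2 R))^nat) : (forall n, approx_set (F n)) ->
  approx_set (\bigcap_n F n).
Proof.
move=> aF; pose G n := \big[setI/setT]_(i < n) F i.
apply: (@bounded_approx_cvg _ (fun n => \1_(G n)) _ 1).
- elim => [|n IH]; first by rewrite /G big_ord0; exact: approx_setT.
  by rewrite /G big_ord_recr; exact: approx_setI.
- by move=> n x; rewrite indicE; case: (_ \in _); rewrite ?normr0 ?normr1.
- move=> x; have [xF|xF] := pselect ((\bigcap_n F n) x).
    apply: cvg_near_cst; apply: nearW => n; rewrite !indicE !mem_set//.
    by rewrite /G -bigcap_mkord => i _; exact: xF.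
  have [n nF] : exists n, ~ F n x by apply: contra_notP xF => /forallNP xF n _; apply: contrapT; exact: xF.
  apply: cvg_near_cst; exists n.+1 => // m /= nm; rewrite !indicE memNset ?memNset//.
  by rewrite /G -bigcap_mkord => /(_ n nm).
Qed.

Lemma approx_set_sigma : sigma_algebra setT approx_set.
Proof.
split.
- by rewrite -setCT; exact/approx_setC/approx_setT.
- by move=> A aA; rewrite setTD; exact: approx_setC.
- move=> F aF; rewrite -[\bigcup_k F k]setCK setC_bigcup.
  by apply/approx_setC/approx_set_bigcap => n; exact: approx_setC.
Qed.

Lemma approx_set_gt f : bounded_approx f -> approx_set [set x | 0 < f x].
Proof.
move=> af; have as_ := bounded_approx_sg af.
rewrite /approx_set; have -> : \1_[set x | 0 < f x] = cst (1 / 2) * ((fun x => Num.sg (f x)) *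
    (fun x => Num.sg (f x)) + (fun x => Num.sg (f x))) :> fn.
  apply/funext => x; rewrite !fctE indicE /=.
  have [f0|f0|f0] := ltgtP (f x) 0.
  - by rewrite ltr0_sg// memNset /=; [ring|rewrite ltNge ltW].
  - by rewrite gtr0_sg// mem_set//=; field.
  - by rewrite f0 sgr0 memNset /=; [ring|rewrite f0 ltxx].
apply: bounded_approxM; first exact: bounded_approx_cst.
by apply: bounded_approxD => //; exact: bounded_approxM.
Qed.

(** An open set is a countable union of rational boxes, and a box is an intersection
    of six half-spaces. *)
Lemma approx_set_open (U : set (S2 R)) : open U -> approx_set U.
Proof.
move=> [W oW WU].
pose box (q : rat * rat * rat * rat) : set (S2 R) :=
  [set x | forall i, `|coords x 0 i - nth 0 [:: ratr q.1.1.1; ratr q.1.1.2; ratr q.1.2] i| < ratr q.2].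
have abox q : approx_set (box q).
  pose c i : R := nth 0 [:: ratr q.1.1.1; ratr q.1.1.2; ratr q.1.2] i.
  pose H (i : 'I_3) := [set x : S2 R | 0 < (crd i + cst (ratr q.2 - c i)) x] `&`
                       [set x : S2 R | 0 < (cst (-1) * crd i + cst (ratr q.2 + c i)) x].
  have aH i : approx_set (H i).
    have ac : bounded_approx (crd i : fn) by exact: bounded_approx_poly (polyS_crd i).
    apply: approx_setI; apply: approx_set_gt; apply: bounded_approxD => //; try exact: bounded_approx_cst.
    by apply: bounded_approxM => //; exact: bounded_approx_cst.
  have -> : box q = H 0 `&` H 1 `&` H 2.
    have HE (i : 'I_3) x : `|coords x 0 i - c i| < ratr q.2 <-> H i x.
      rewrite /H /= !fctE /crd /= ltr_norml; split => [/andP[? ?]|[? ?]]; first by split; lra.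
      by apply/andP; split; lra.
    apply/seteqP; split=> [x h|x [[/HE h0 /HE h1] /HE h2] i].
      by split; [split|]; apply/HE; exact: h.
    by elim/ord3_ind: i.
  by apply: approx_setI => //; exact: approx_setI.
(* The rational boxes contained in U, listed along an enumeration of their parameters. *)
have UE : U = \bigcup_n (if unpickle n is Some q then (if `[< box q `<=` U >] then box q else set0) else set0).
  apply/seteqP; split=> [x Ux|x [n _]]; last first.
    by case: (unpickle n) => // q; case: asboolP => // + xq; apply.
  have Wx : W (coords x) by move: Ux; rewrite -WU.
  have /nbhs_ballP[e /= e0 We] := open_nbhs_nbhs (conj oW Wx).
  have [r /andP[r0 re]] : exists r, (0 < (ratr r : R)) && ((ratr r : R) < e / 2).
    have [|r] := @rat_in_itvoo R 0 (e / 2); first by rewrite divr_gt0.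
    by rewrite in_itv/= => ?; exists r.
  have near z : exists a, `|z - (ratr a : R)| < ratr r.
    have [|a] := @rat_in_itvoo R z (z + ratr r); first by rewrite ltrDl.
    by rewrite in_itv/= => /andP[za ar]; exists a; rewrite ltr_norml; lra.
  have [a0 h0] := near (coords x 0 0); have [a1 h1] := near (coords x 0 1).
  have [a2 h2] := near (coords x 0 2); pose q := (a0, a1, a2, r).
  have xq : box q x by apply: ord3_ind.
  exists (pickle q); [exact: I|rewrite pickleK].
  case: asboolP => // -[]; move=> y yq; rewrite -WU; apply: We => /=.
  split=> // i j; rewrite ord1 -ball_normE /=.
  have := xq j; have := yq j; rewrite !ltr_norml => /andP[? ?] /andP[? ?].
  by apply/andP; split; lra.
rewrite UE; have [s0 _ sU] := approx_set_sigma; apply: sU => n.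
by case: (unpickle n) => // q; case: asboolP.
Qed.

Lemma approx_set_measurable (A : set (S2 R)) : measurable A -> approx_set A.
Proof. by apply: smallest_sub; [exact: approx_set_sigma|exact: approx_set_open]. Qed.

Import HBNNSimple.

(** The simple functions increasing to f are combinations of indicators, and f itself
    dominates them. *)
Lemma polynomials_dense_ge0 f : f \in @L2 R -> (forall x, 0 <= f x) -> poly_approx f.
Proof.
move=> fL f0; have mf := L2_measurable fL.
have mEf : measurable_fun setT (EFin \o f) by exact/measurable_EFinP.
pose h := nnsfun_approx measurableT mEf.
have hf x : h n x @[n --> \oo] --> f x.
  have Ef0 y : setT y -> (0 <= (EFin \o f) y)%E by move=> _; rewrite /= lee_fin.
  by have /fine_cvgP[_] := @cvg_nnsfun_approx _ _ _ _ measurableT _ mEf Ef0 x I.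
have nd x : nondecreasing_seq (fun n => h n x).
  by move=> m n mn; have /lefP := nd_nnsfun_approx measurableT mEf mn; apply.
have hle n x : h n x <= f x.
  rewrite -(cvg_lim (@Rhausdorff R) (hf x)); apply: nondecreasing_cvgn_le => //.
  by apply/cvg_ex; exists (f x).
have ah n : poly_approx (h n).
  have -> : h n = \sum_(y <- finmap.enum_fset (fset_set (range (h n)))) (cst y * \1_(h n @^-1` [set y])) :> fn.
    apply/funext => x; rewrite fct_sumE fimfunE fsbig_finite//.
  elim/big_ind : _ => [||y _]; first exact: poly_approx_poly (polyS0 0).
    exact: poly_approxD.
  have [_ _ ] // : bounded_approx (cst y * \1_(h n @^-1` [set y])).
  apply: bounded_approxM; first exact: bounded_approx_cst.
  by apply: approx_set_measurable; exact: measurable_sfunP.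
apply: poly_approx_lim => // e e0.
have mh n : measurable_fun setT (h n : fn) by exact: measurable_funP.
have hb n x : `|(h n : fn) x| <= f x by rewrite ger0_norm.
have e2 : 0 < e ^+ 2 by rewrite exprn_gt0.
have [n] := L2_dominated_cvg mh mf fL hb hf e2.
rewrite -nrm_sqr ltr_sqr ?nnegrE ?nrm_ge0 ?ltW// => lt.
by exists (h n).
Qed.

Lemma polynomials_dense f : f \in @L2 R -> poly_approx f.
Proof.
move=> fL; have mf := L2_measurable fL.
have nL : (fun x => `|f x|) \in @L2 R.
  apply/L2P; split; first exact: measurableT_comp.
  have [_] := (L2P f).1 fL; congr (_.-integrable _ _).
  by apply/funext => x /=; rewrite real_normK ?num_real.
have -> : f = cst (1 / 2) * ((fun x => `|f x|) + f) + cst (- (1 / 2)) * ((fun x => `|f x|) - f).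
  by apply/funext => x; rewrite !fctE; field.
have C (k : R) g : poly_approx g -> poly_approx (cst k * g).
  move=> [gL gP]; split=> [|e e0]; first exact: L2Z.
  have k1 : 0 < `|k| + 1 by rewrite ltr_wpDl.
  have [|n [q [pq gq]]] := gP (e / (`|k| + 1)); first by rewrite divr_gt0.
  exists n, (cst k * q); split; first exact: polySZ.
  have qL := polyS_L2 pq; rewrite -mulrBr nrmZ ?L2B//.
  move: gq; rewrite ltr_pdivlMr// mulrDr mulr1 mulrC; apply: le_lt_trans.
  by rewrite lerDl nrm_ge0.
apply: poly_approxD; apply: C; apply: polynomials_dense_ge0.
- exact: L2D.
- by move=> x; rewrite !fctE; have := ler_norm (- f x); rewrite normrN; lra.
- exact: L2B.
- by move=> x; rewrite !fctE; have := ler_norm (f x); lra.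
Qed.

End borel_density.

(** * The spectral gap *)

Section spectral_gap.
Context {R : realType}.
Local Notation fn := (S2 R -> R).
Implicit Types (f g h : fn).

Lemma CS_nrm f g : f \in @L2 R -> g \in @L2 R -> `|ip f g| <= nrm f * nrm g.
Proof.
move=> fL gL; rewrite /nrm -sqrtrM ?ip_ge0// -sqrtr_sqr ler_sqrt ?mulr_ge0 ?ip_ge0//.
exact: ip_CS.
Qed.

(** Gram-Schmidt with a semi-definite product: a vector whose residue has norm zero is
    skipped. The last property says that p lies in the span of the family, which is what
    the induction uses. *)
Lemma projection_seq (T : eqType) (m : T -> fn) n (s : seq T) f :
  (forall t, t \in s -> polyS n (m t)) -> f \in @L2 R ->
  exists p, [/\ polyS n p, forall t, t \in s -> ip (f - p) (m t) = 0 &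
    forall g, g \in @L2 R -> (forall t, t \in s -> ip g (m t) = 0) -> ip g p = 0].
Proof.
elim: s f => [|t s IH] f pm fL.
  exists 0; split=> //; first exact: polyS0.
  move=> g gL _; rewrite (_ : 0 = cst 0 * g); last by rewrite cst0_mul.
  rewrite ipZr//; exact: mul0r.
have pm' u : u \in s -> polyS n (m u) by move=> us; apply: pm; rewrite inE us orbT.
have pmt : polyS n (m t) by apply: pm; rewrite mem_head.
have mtL := polyS_L2 pmt.
have [p [pp fp sp]] := IH f pm' fL; have [q [pq mq sq]] := IH (m t) pm' mtL.
have [pL qL] := (polyS_L2 pp, polyS_L2 pq).
pose m' := m t - q; have m'L : m' \in @L2 R by exact: L2B.
have pm'' : polyS n m' by exact: polySB.
have fpL : f - p \in @L2 R by exact: L2B.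
have mtE : m t = m' + q by rewrite /m' subrK.
pose k := ip (f - p) m' / ip m' m'.
have kL : cst k * m' \in @L2 R by exact: L2Z.
have key : ip (f - p - cst k * m') m' = 0.
  rewrite (ipBl fpL kL m'L) ipZl//.
  have [m0|m0] := eqVneq (ip m' m') 0; last by rewrite /k divfK// subrr.
  by rewrite m0 mulr0 subr0 ipC; exact: ip_eq0l.
exists (p + cst k * m').
have E : f - (p + cst k * m') = f - p - cst k * m' by rewrite opprD addrA.
have eL : f - p - cst k * m' \in @L2 R by exact: L2B.
have sP u : u \in s -> ip (f - (p + cst k * m')) (m u) = 0.
  move=> us; have muL := polyS_L2 (pm' _ us).
  by rewrite E (ipBl fpL kL muL) ipZl// fp// mq// mulr0 subr0.
split.
- by apply: polySD => //; exact: polySZ.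
- move=> u; rewrite inE => /predU1P[->|]; last exact: sP.
  rewrite mtE E (ipDr m'L qL eL) key add0r; apply: sq => // v vs.
  by rewrite -E sP.
- move=> g gL gs; have gs' u : u \in s -> ip g (m u) = 0 by move=> us; apply: gs; rewrite inE us orbT.
  rewrite (ipDr pL kL gL) sp// ipZr// (ipBr mtL qL gL) sq// gs ?mem_head//.
  by rewrite subrr mulr0 addr0.
Qed.

Lemma projection_exists n f : f \in @L2 R ->
  exists2 p, polyS n p & forall q, polyS n q -> ip (f - p) q = 0.
Proof.
move=> fL; pose T : finType := ('I_n.+1 * 'I_n.+1 * 'I_n.+1)%type.
pose s := [seq t : T <- enum T | (t.1.1 + t.1.2 + t.2 <= n)%N].
have [|p [pp fp _]] := @projection_seq T (fun t : T => mon t.1.1 t.1.2 t.2) n s f _ fL.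
  by move=> t; rewrite mem_filter => /andP[tn _]; exact: polyS_mon.
exists p => // q; have fpL : f - p \in @L2 R by apply: L2B => //; exact: polyS_L2 pp.
elim=> {q} [a b c abc|g h pg eg ph eh|k g pg eg].
- have [an bn cn] : [/\ (a < n.+1)%N, (b < n.+1)%N & (c < n.+1)%N] by split; lia.
  have := fp (Ordinal an, Ordinal bn, Ordinal cn); apply.
  by rewrite mem_filter mem_enum /= abc.
- by rewrite (ipDr (polyS_L2 pg) (polyS_L2 ph) fpL) eg eh addr0.
- by rewrite (ipZr _ fpL (polyS_L2 pg)) eg mulr0.
Qed.

Lemma projection_best n f p q : f \in @L2 R -> polyS n p ->
  (forall q, polyS n q -> ip (f - p) q = 0) -> polyS n q -> nrm (f - p) <= nrm (f - q).
Proof.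
move=> fL pp fp pq; have [pL qL] := (polyS_L2 pp, polyS_L2 pq).
have aL : f - p \in @L2 R by exact: L2B.
have bL : p - q \in @L2 R by exact: L2B.
have e : f - q = (f - p) + (p - q) by rewrite addrA subrK.
rewrite ler_sqrt ?ip_ge0// e (ipDl aL bL (L2D aL bL)) (ipDr aL bL aL) (ipDr aL bL bL).
rewrite (ipC (p - q) (f - p)) (fp (p - q) (polySB pp pq)).
by rewrite addr0 add0r lerDl ip_ge0.
Qed.

(** Project g on the polynomials of degree N+2; the increment h from one degree to the
    next is an eigenvector by the last hypothesis and contributes
    |h|^2 / ((N+3) (N+4)) <= |h|^2 / 12 to - <g, psi>. Density lets N tend to infinity. *)
Lemma spectral_gap g psi : g \in @L2 R -> psi \in @L2 R ->
  (forall q, polyS 2 q -> ip g q = 0) ->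
  (forall n h, (1 < n)%N -> polyS n.+1 h -> (forall q, polyS n q -> ip h q = 0) ->
     n.+1%:R * n.+2%:R * ip psi h = - ip g h) ->
  0 <= - ip g psi <= ip g g / 12.
Proof.
move=> gL psiL g2 eig.
have step N : exists p, [/\ polyS N.+2 p, forall q, polyS N.+2 q -> ip (g - p) q = 0 &
    0 <= - ip psi p <= ip p p / 12].
  elim: N => [|N [p [pp gp /andP[p0 p1]]]].
    exists 0; split; first exact: polyS0.
      by move=> q pq; rewrite subr0; exact: g2.
    have z : 0 = cst 0 * g by rewrite cst0_mul.
    by rewrite z !ipZr ?ipZl ?L2Z// !mul0r oppr0 lexx.
  have [p' pp' gp'] := @projection_exists N.+3 g gL.
  pose h := p' - p; have ph : polyS N.+3 h by apply: polySB => //; apply: polyS_le pp.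
  have [[pL p'L] hL] := (polyS_L2 pp, polyS_L2 pp', polyS_L2 ph).
  have gpL : g - p \in @L2 R by exact: L2B.
  have gp'L : g - p' \in @L2 R by exact: L2B.
  have hE : h = (g - p) - (g - p') by rewrite opprB addrC subrKA.
  have h0 q : polyS N.+2 q -> ip h q = 0.
    move=> pq; rewrite hE (ipBl gpL gp'L (polyS_L2 pq)) gp// gp' ?subrr//.
    exact: polyS_le pq.
  have p'E : p' = p + h by rewrite /h addrC subrK.
  have ghE : ip g h = ip h h.
    have -> : g = (g - p') + (p + h) by rewrite -p'E subrK.
    rewrite (ipDl gp'L (L2D pL hL) hL) gp'// (ipDl pL hL hL) (ipC p h) h0//.
    by rewrite !add0r.
  exists p'; split=> //.
  have e := eig N.+2 h isT ph h0; rewrite ghE in e.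
  have -> : ip psi p' = ip psi p + ip psi h by rewrite {1}p'E ipDr.
  have -> : ip p' p' = ip p p + ip h h.
    by rewrite p'E (ipDl pL hL (L2D pL hL)) !(ipDr pL hL) // (ipC p h) h0// addr0 add0r.
  have hh0 := ip_ge0 h.
  have c12 : 12 <= N.+3%:R * N.+4%:R :> R by rewrite -natrM ler_nat; lia.
  have hE2 : ip psi h = - (ip h h / (N.+3%:R * N.+4%:R)).
    have K0 : N.+3%:R * N.+4%:R != 0 :> R by rewrite gt_eqF// (lt_le_trans _ c12).
    by apply: (mulfI K0); rewrite e mulrN mulrC divfK.
  have q0 : 0 <= ip h h / (N.+3%:R * N.+4%:R).
    by rewrite divr_ge0// (le_trans _ c12).
  have q1 : ip h h / (N.+3%:R * N.+4%:R) <= ip h h / 12.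
    have Kp : 0 < N.+3%:R * N.+4%:R :> R by rewrite (lt_le_trans _ c12).
    by rewrite ler_wpM2l// lef_pV2 ?posrE.
  move: q0 q1; rewrite hE2; move: (ip h h / _) => y q0 q1.
  by apply/andP; split; lra.
(* Both bounds up to an arbitrary d, from a polynomial close to g. *)
have lim d : 0 < d -> - d <= - ip g psi <= ip g g / 12 + d.
  move=> d0; have n1 : 0 < nrm psi + 1 by rewrite ltr_wpDl// nrm_ge0.
  have [_ /(_ (d / (nrm psi + 1)))] := polynomials_dense gL.
  rewrite divr_gt0// => /(_ isT)[n [q [pq gq]]].
  have [p [pp gp /andP[p0 p1]]] := step n.
  have pL := polyS_L2 pp; have gpL : g - p \in @L2 R by exact: L2B.
  have pq' : polyS n.+2 q by apply: polyS_le pq; lia.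
  have le1 : nrm (g - p) <= d / (nrm psi + 1).
    exact: le_trans (projection_best gL pp gp pq') (ltW gq).
  have le2 : `|ip (g - p) psi| <= d.
    rewrite (le_trans (CS_nrm gpL psiL))//.
    rewrite (le_trans (ler_wpM2r (nrm_ge0 _) le1))// mulrAC ler_pdivrMr//.
    by rewrite ler_wpM2l ?lerDl ?ltW.
  have gE : ip g psi = ip psi p + ip (g - p) psi.
    by rewrite (ipBl gL pL psiL) (ipC psi p) addrC subrK.
  have pg : ip p p <= ip g g.
    have -> : g = (g - p) + p by rewrite subrK.
    rewrite (ipDl gpL pL (L2D gpL pL)) (ipDr gpL pL gpL) (ipDr gpL pL pL).
    by rewrite (ipC p (g - p)) (gp p pp) addr0 add0r lerDr ip_ge0.
  by move: le2; rewrite ler_norml gE => /andP[? ?]; apply/andP; split; lra.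
apply/andP; split.
  by apply/ler_addgt0Pr => d /lim /andP[? _]; lra.
by apply/ler_addgt0Pr => d /lim /andP[_].
Qed.

End spectral_gap.

(** * Zonal eigenfunctions of degree two *)

Section legendre.
Context {R : realType}.

(** The difference z of y and the multiple of 3 cos^2 - 1 with the same value at 0 solves
    the same equation, and its energy z'^2 + 6 z^2 has derivative - 2 cot t z'^2 <= 0 up to
    pi / 2 and vanishes at 0. This handles the singular point 0 without any
    theory of singular equations. *)
Lemma legendre_ode (y y1 y2 : R -> R) :
  (forall t : R, is_derive t 1 y (y1 t)) -> (forall t : R, is_derive t 1 y1 (y2 t)) ->
  y1 0 = 0 ->
  (forall t, 0 < t < pi -> sin t * y2 t + cos t * y1 t + 6 * sin t * y t = 0) ->
  forall t, 0 <= t <= pi / 2 -> y t = y 0 / 2 * (3 * cos t ^+ 2 - 1).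
Proof.
move=> dy dy1 y10 ode t0 t0P; set k := y 0 / 2.
pose z : R -> R := y - (k * 3) \*: (@cos R * @cos R) + cst k.
pose z1 : R -> R := y1 + (k * 6) \*: (@cos R * @sin R).
pose E : R -> R := z1 * z1 + 6 \*: (z * z).
have dz (t : R) : is_derive t 1 z (z1 t).
  have h := is_deriveD (is_deriveB (dy t) (is_deriveZ (k * 3) (is_deriveM (is_derive_cos t) (is_derive_cos t)))) (is_derive_cst k t 1).
  by apply: (is_derive_eq h); rewrite /z1 /= !fctE /= /GRing.scale /=; ring.
have dz1 (t : R) : is_derive t 1 z1 (y2 t + k * 6 * (cos t ^+ 2 - sin t ^+ 2)).
  have h := is_deriveD (dy1 t) (is_deriveZ (k * 6) (is_deriveM (is_derive_cos t) (is_derive_sin t))).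
  by apply: (is_derive_eq h); rewrite /= /GRing.scale /=; ring.
have dE (t : R) : is_derive t 1 E (2 * z1 t * (y2 t + k * 6 * (cos t ^+ 2 - sin t ^+ 2) + 6 * z t)).
  have h := is_deriveD (is_deriveM (dz1 t) (dz1 t)) (is_deriveZ 6 (is_deriveM (dz t) (dz t))).
  by apply: (is_derive_eq h); rewrite /= /GRing.scale /=; ring.
have E0 : E 0 = 0.
  by rewrite /E /z /z1 !fctE /= /GRing.scale /= y10 cos0 sin0 /k; field.
(* The energy decreases; the equation only gives this after multiplication by sin t > 0. *)
have neg t : 0 < t < pi / 2 -> 2 * z1 t * (y2 t + k * 6 * (cos t ^+ 2 - sin t ^+ 2) + 6 * z t) <= 0.
  move=> /andP[tp tlt].
  have s0 : 0 < sin t by rewrite sin_gt0_pi// tp /= (lt_le_trans tlt)// ler_pdivrMr// ler_peMr ?pi_ge0// ler1n.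
  have c0 : 0 <= cos t by rewrite cos_ge0_pihalf// (le_trans _ (ltW tp)) ?oppr_le0 ?divr_ge0 ?pi_ge0//= ltW.
  have tpi : 0 < t < pi by rewrite tp /= (lt_trans tlt)// ltr_pdivrMr// ltr_pMr ?pi_gt0// ltr1n.
  have o := ode t tpi; have cs := cos2Dsin2 t.
  rewrite -(pmulr_rle0 _ s0).
  have -> : sin t * (2 * z1 t * (y2 t + k * 6 * (cos t ^+ 2 - sin t ^+ 2) + 6 * z t)) =
     2 * z1 t * (sin t * y2 t + cos t * y1 t + 6 * sin t * y t) - 2 * cos t * (z1 t) ^+ 2
     + 12 * k * sin t * z1 t * (1 - (cos t ^+ 2 + sin t ^+ 2)).
    by rewrite /z /z1 !fctE /= /GRing.scale /=; ring.
  rewrite o cs subrr !mulr0 add0r addr0 oppr_le0 mulr_ge0 ?sqr_ge0// mulr_ge0//.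
have Et : E t0 <= 0.
  have cE : {within `[0, pi / 2], continuous E}.
    apply: continuous_subspaceT => x; apply: differentiable_continuous.
    by apply/derivable1_diffP; exact: (@ex_derive _ _ _ _ _ _ _ (dE x)).
  rewrite -E0; apply: (ler0_derive1_le_cc _ _ cE) => //.
  - move=> x; rewrite in_itv /= => xP; rewrite derive1E (@derive_val _ _ _ _ _ _ _ (dE x)).
    exact: neg.
  - by rewrite in_itv /= lexx divr_ge0// pi_ge0.
  - by case/andP: t0P.
have z0 : z t0 = 0.
  move: Et; rewrite /E !fctE /= /GRing.scale /= => Et.
  have := sqr_ge0 (z1 t0); have := sqr_ge0 (z t0); rewrite !expr2 => a b.
  have /eqP : z t0 * z t0 = 0 by lra.
  by rewrite mulf_eq0 orbb => /eqP.
by move: z0; rewrite /z !fctE /= /GRing.scale /= => z0; rewrite -[LHS]subr0 -z0; ring.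
Qed.

End legendre.

Section zonal.
Context {R : realType}.
Local Notation V := ('rV[R]_3).
Implicit Types (f : S2 R -> R).

Lemma diff_sum_partial (H : V -> R) (y u : V) : differentiable H y ->
  'd H y u = \sum_i u 0 i * 'D_(delta_mx 0 i) H y.
Proof.
move=> dH; rewrite {1}[u]row_sum_delta linear_sum; apply: eq_bigr => i _.
by rewrite linearZ deriveE.
Qed.

(** Meridians, and the orbits of rotations around an axis, are both of this form. *)
Definition curve (e a b : V) (t : R) : V := e + cos t *: a + sin t *: b.

Definition curve' (a b : V) (t : R) : V := cos t *: b - sin t *: a.

Lemma is_derive_curve_coord e a b (t : R) i :
  is_derive t 1 (fun t => curve e a b t 0 i) (curve' a b t 0 i).
Proof.
have -> : (fun t => curve e a b t 0 i) = cst (e 0 i) + (a 0 i) \*: @cos R + (b 0 i) \*: @sin R.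
  apply/funext => s; rewrite /curve !mxE !fctE /= /GRing.scale /=; ring.
have h := is_deriveD (is_deriveD (is_derive_cst (e 0 i) t 1) (is_deriveZ (a 0 i) (is_derive_cos t)))
   (is_deriveZ (b 0 i) (is_derive_sin t)).
by apply: (is_derive_eq h); rewrite /curve' !mxE /= /GRing.scale /=; ring.
Qed.

Lemma is_derive_curve'_coord a b (t : R) i :
  is_derive t 1 (fun t => curve' a b t 0 i) (- (cos t * a 0 i + sin t * b 0 i)).
Proof.
have -> : (fun t => curve' a b t 0 i) = (b 0 i) \*: @cos R - (a 0 i) \*: @sin R.
  by apply/funext => s; rewrite /curve' !mxE !fctE /= /GRing.scale /=; ring.
have h := is_deriveB (is_deriveZ (b 0 i) (is_derive_cos t)) (is_deriveZ (a 0 i) (is_derive_sin t)).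
by apply: (is_derive_eq h); rewrite /= /GRing.scale /=; ring.
Qed.

Lemma is_derive_curve e a b (t : R) : is_derive t 1 (curve e a b) (curve' a b t).
Proof.
have d : derivable (curve e a b) t 1.
  apply/derivable_mxP => i j; rewrite ord1.
  exact: (@ex_derive _ _ _ _ _ _ _ (is_derive_curve_coord e a b t j)).
apply: DeriveDef => //; rewrite derive_mx//; apply/rowP => j; rewrite mxE.
exact: (@derive_val _ _ _ _ _ _ _ (is_derive_curve_coord e a b t j)).
Qed.

Lemma is_derive_along (H : V -> R) e a b (t : R) : differentiable H (curve e a b t) ->
  is_derive t 1 (H \o curve e a b)
    (\sum_i curve' a b t 0 i * 'D_(delta_mx 0 i) H (curve e a b t)).
Proof.
move=> dH; have dc := is_derive_curve e a b t.
have dfc : differentiable (curve e a b) t.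
  by apply/derivable1_diffP; exact: (@ex_derive _ _ _ _ _ _ _ dc).
have dHc : differentiable (H \o curve e a b) t by exact: differentiable_comp.
apply: DeriveDef; first exact/diff_derivable.
have e1 : 'd (curve e a b) t 1 = curve' a b t.
  by rewrite -deriveE// (@derive_val _ _ _ _ _ _ _ dc).
by rewrite deriveE// diff_comp//= e1; exact: diff_sum_partial.
Qed.

Lemma rhoZ (k : R) (y : V) : 0 < k -> rho (k *: y) = k^-1 * rho y.
Proof.
move=> k0; rewrite /rho /euclidean_norm.
have -> : dot (k *: y) (k *: y) = k ^+ 2 * dot y y by rewrite !dot3E !mxE; ring.
by rewrite sqrtrM ?sqr_ge0// sqrtr_sqr gtr0_norm// invfM.
Qed.

Lemma extendZ f (k : R) (y : V) : 0 < k -> y != 0 -> extend f (k *: y) = extend f y.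
Proof.
move=> k0 y0; rewrite /extend /=; congr (f _); apply: coords_inj.
rewrite !coords_radial//; last by rewrite scaler_eq0 (gt_eqF k0).
by rewrite rhoZ// scalerA mulrAC mulVf ?mul1r// gt_eqF.
Qed.

(** The extension is constant on rays. *)
Lemma radial_derivative f (x : S2 R) : differentiable (extend f) (coords x) ->
  \sum_i coords x 0 i * 'D_(delta_mx 0 i) (extend f) (coords x) = 0.
Proof.
move=> df; rewrite -diff_sum_partial// -deriveE//.
apply/cvg_lim => //; apply: (@cvg_near_cst _ _ 0).
apply: nbhs_dnbhs; exists 1 => //= h; rewrite /ball_ /= sub0r normrN ltr_norml => /andP[h1 _].
have -> : h *: coords x + coords x = (1 + h) *: coords x by rewrite addrC scalerDl scale1r.
rewrite extendZ ?coords_neq0//; first by rewrite subrr scaler0.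
by lra.
Qed.

Lemma differentiable_extend f : smooth f -> forall y : V, y != 0 -> differentiable (extend f) y.
Proof. by move=> sf y y0; exact: (sf [::] y y0). Qed.

Lemma differentiable_extend_pd f j : smooth f ->
  forall y : V, y != 0 -> differentiable (extend (pd j f)) y.
Proof.
move=> sf y y0; pose P : V -> V := fun y => rho y *: y.
have dP : differentiable P y.
  have -> : P = \sum_i (fun y => (rho y * y 0 i) *: delta_mx 0 i).
    apply/funext => z; rewrite fct_sumE /P [X in _ *: X = _]row_sum_delta scaler_sumr.
    by apply: eq_bigr => i _; rewrite scalerA.
  apply: differentiable_sum => i; apply: differentiableZl.
  apply: (@differentiableM _ _ rho (fun y : V => y 0 i)); first exact: differentiable_rho.
  exact: differentiable_coordinate.
apply: (@near_eq_differentiable _ _ _ (partial j (extend f) \o P)).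
  apply: filterS (near_neq0 y0) => z z0 /=.
  by rewrite /extend /= pdE coords_radial.
apply: differentiable_comp => //; apply: (sf [:: j]).
by rewrite /P -coords_radial// coords_neq0.
Qed.

(** The derivative at x along u, written on the sphere so that it makes sense for any u. *)
Definition dirD f (x : S2 R) (u : V) : R := \sum_j u 0 j * pd j f x.

(** The second derivative of the extension of f, except that the inner gradient is first
    restricted to the sphere; in tangential directions this changes nothing. *)
Definition Hess f (x : S2 R) (u w : V) : R :=
  \sum_j w 0 j * \sum_i u 0 i * 'D_(delta_mx 0 i) (extend (pd j f)) (coords x).

Lemma curve_derivatives f e a b (h : forall t, dot (curve e a b t) (curve e a b t) = 1) :
  smooth f -> let c t := S2_of (h t) in
  (forall t : R, is_derive t 1 (f \o c) (dirD f (c t) (curve' a b t))) /\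
  (forall t : R, is_derive t 1 (fun t => dirD f (c t) (curve' a b t))
    (dirD f (c t) (- (cos t *: a + sin t *: b)) + Hess f (c t) (curve' a b t) (curve' a b t))).
Proof.
move=> sf c; have cE t : coords (c t) = curve e a b t by [].
have g0 t : curve e a b t != 0 by rewrite -cE coords_neq0.
split=> t.
  have -> : f \o c = extend f \o curve e a b.
    by apply/funext => s /=; rewrite -cE extend_coords.
  have h1 := is_derive_along (differentiable_extend sf (g0 t)).
  apply: (is_derive_eq h1); rewrite /dirD; apply: eq_bigr => j _.
  by rewrite pdE.
pose F j : R -> R := (fun t => curve' a b t 0 j) * (extend (pd j f) \o curve e a b).
have -> : (fun t => dirD f (c t) (curve' a b t)) = \sum_j F j.
  apply/funext => s; rewrite fct_sumE /dirD; apply: eq_bigr => j _.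
  by rewrite /F !fctE /= -cE extend_coords.
have dF j := is_deriveM (is_derive_curve'_coord a b t j)
  (is_derive_along (differentiable_extend_pd j sf (g0 t))).
apply: (is_derive_eq (is_derive_sum dF)).
rewrite /dirD /Hess -big_split /=; apply: eq_bigr => j _.
rewrite /GRing.scale /= !mxE -cE extend_coords; ring.
Qed.

Lemma dirD_radial f (x : S2 R) : smooth f -> dirD f x (coords x) = 0.
Proof.
move=> sf; rewrite -(radial_derivative (differentiable_extend sf (coords_neq0 x))).
by apply: eq_bigr => i _; rewrite pdE.
Qed.

Lemma Hess_radial f (x : S2 R) w : smooth f -> Hess f x (coords x) w = 0.
Proof.
move=> sf; rewrite /Hess big1// => j _.
by rewrite (radial_derivative (differentiable_extend_pd j sf (coords_neq0 x))) mulr0.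
Qed.

Lemma dirDD f x u v (k l : R) : dirD f x (k *: u + l *: v) = k * dirD f x u + l * dirD f x v.
Proof.
by rewrite /dirD !mulr_sumr -big_split /=; apply: eq_bigr => j _; rewrite !mxE; ring.
Qed.

(** The trace of the Hessian in an orthonormal frame given by its completeness relation. *)
Lemma laplacian_frame f (x : S2 R) (u v w : V) :
  (forall i j, u 0 i * u 0 j + v 0 i * v 0 j + w 0 i * w 0 j = (i == j)%:R) ->
  laplacian f x = Hess f x u u + Hess f x v v + Hess f x w w.
Proof.
move=> fr; rewrite /Hess -!big_split /= /laplacian /divergence; apply: eq_bigr => j _.
rewrite !mulr_sumr -!big_split /= mxE.
transitivity (\sum_i (i == j)%:R * 'D_(delta_mx 0 i) (extend (pd j f)) (coords x)).
  rewrite (bigD1 j)//= eqxx mul1r big1 ?addr0// => i ij.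
  by rewrite (negbTE ij) mul0r.
by apply: eq_bigr => i _; rewrite -fr; ring.
Qed.

(** A matrix with orthonormal rows has orthonormal columns. *)
Lemma cross_orthonormal (p v : V) : dot p p = 1 -> dot v v = 1 -> dot p v = 0 ->
  forall i j, p 0 i * p 0 j + v 0 i * v 0 j + cross p v 0 i * cross p v 0 j = (i == j)%:R.
Proof.
move=> pp vv pv; set w := cross p v.
have [w0 w1 w2] := crossE p v; rewrite -/w in w0 w1 w2.
have pw : dot p w = 0 by rewrite dot3E w0 w1 w2; ring.
have vw : dot v w = 0 by rewrite dot3E w0 w1 w2; ring.
have ww : dot w w = 1.
  have -> : dot w w = dot p p * dot v v - dot p v ^+ 2 by rewrite !dot3E w0 w1 w2; ring.
  by rewrite pp vv pv; ring.
pose M : 'M[R]_3 := \matrix_(i, j) (nth p [:: p; v; w] i) 0 j.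
have MM : M *m M^T = 1%:M.
  apply/matrixP => i j; rewrite !mxE.
  transitivity (dot (nth p [:: p; v; w] i) (nth p [:: p; v; w] j)).
    by apply: eq_bigr => k _; rewrite !mxE.
  have dC (a b : V) : dot a b = dot b a by rewrite !dot3E; ring.
  by case: i => -[|[|[|//]]] i3; case: j => -[|[|[|//]]] j3 /=; rewrite ?pp ?vv ?ww // ?pv ?pw ?vw // dC ?pv ?pw ?vw.
move=> i j; have /matrixP/(_ i j) := mulmx1C MM; rewrite !mxE sum3 !mxE /=.
by rewrite /=.
Qed.

End zonal.

Section zonal_eigenfunction.
Context {R : realType}.
Local Notation V := ('rV[R]_3).
Implicit Types (f : S2 R -> R).

Lemma dotC (u v : V) : dot u v = dot v u.
Proof. by rewrite !dot3E; ring. Qed.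

Lemma dot_curve (p v : V) (t : R) : dot p p = 1 -> dot v v = 1 -> dot p v = 0 ->
  dot (curve 0 p v t) (curve 0 p v t) = 1.
Proof.
move=> pp vv pv; rewrite -(cos2Dsin2 t).
have -> : dot (curve 0 p v t) (curve 0 p v t) = cos t ^+ 2 * dot p p + sin t ^+ 2 * dot v v +
   2 * cos t * sin t * dot p v by rewrite /curve !dot3E !mxE; ring.
by rewrite pp vv pv; ring.
Qed.

Lemma rodrigues_curve (p x : V) (a : R) :
  rodrigues p a x = curve (dot p x *: p) (x - dot p x *: p) (cross p x) a.
Proof. by rewrite /rodrigues /curve; apply/rowP => i; rewrite !mxE; ring. Qed.

Lemma dirDZ f x (k : R) u : dirD f x (k *: u) = k * dirD f x u.
Proof. by rewrite -[k *: u]addr0 -[0](scale0r u) dirDD mul0r addr0. Qed.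

Lemma HessZ f x (k : R) u : Hess f x (k *: u) (k *: u) = k ^+ 2 * Hess f x u u.
Proof.
rewrite /Hess mulr_sumr; apply: eq_bigr => j _; rewrite !mulr_sumr.
by apply: eq_bigr => i _; rewrite !mxE; ring.
Qed.

(** Differentiate twice the constant function t |-> f (R_p^t x) at t = 0: the acceleration
    of the orbit points to the axis. *)
Lemma Hess_rotation f (p x : S2 R) : smooth f -> rotation_invariant p f ->
  Hess f x (cross (coords p) (coords x)) (cross (coords p) (coords x)) =
  dirD f x (coords x - dot (coords p) (coords x) *: coords p).
Proof.
move=> sf pf; set P := coords p; set X := coords x.
pose e := dot P X *: P; pose a := X - e; pose b := cross P X.
have h t : dot (curve e a b t) (curve e a b t) = 1.
  by rewrite -rodrigues_curve dot_rodrigues// coordsP.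
have [d1 d2] := curve_derivatives h sf.
set c := fun t => S2_of (h t) in d1 d2.
have cE t : f (c t) = f x.
  by rewrite -(pf t x); congr f; apply: coords_inj; rewrite -[RHS]/(rodrigues P t X) rodrigues_curve.
have fc : f \o c = cst (f x) by apply/funext.
have L0 t : dirD f (c t) (curve' a b t) = 0.
  by rewrite -(@derive_val _ _ _ _ _ _ _ (d1 t)) fc derive_cst.
have := @derive_val _ _ _ _ _ _ _ (d2 0).
have -> : (fun t => dirD f (c t) (curve' a b t)) = cst 0 by apply/funext.
rewrite derive_cst cos0 sin0 scale1r scale0r addr0.
rewrite /c; have -> : S2_of (h 0) = x.
  apply: coords_inj; transitivity (curve e a b 0) => //.
  rewrite /curve cos0 sin0 scale1r scale0r addr0.
  by rewrite /a addrC subrK.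
have -> : curve' a b 0 = b by rewrite /curve' cos0 sin0 scale1r scale0r subr0.
have -> : - a = (-1) *: a by rewrite scaleN1r.
rewrite dirDZ => /esym/eqP; rewrite addrC mulN1r subr_eq0 => /eqP.
by [].
Qed.

(** Along a meridian an invariant function depends on the colatitude only. The Laplacian
    in the frame (radius, meridian, parallel) becomes y'' + cot t y': the last frame
    vector contributes cot t y' by the second variation along the parallel. *)
Lemma zonal_meridian f (p : S2 R) (v : V) : smooth f ->
  (forall x, laplacian f x = - (6 * f x)) -> rotation_invariant p f ->
  dot v v = 1 -> dot (coords p) v = 0 -> forall (h : forall t : R, dot (curve 0 (coords p) v t) (curve 0 (coords p) v t) = 1),
  forall t, 0 <= t <= pi / 2 -> f (S2_of (h t)) = f p / 2 * (3 * cos t ^+ 2 - 1).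
Proof.
move=> sf lf pf vv pv h t; set P := coords p in pv h *; have pp : dot P P = 1 := coordsP p.
have [d1 d2] := curve_derivatives h sf.
set c := fun t => S2_of (h t) in d1 d2.
have XE s : coords (c s) = cos s *: P + sin s *: v by transitivity (curve 0 P v s); rewrite // /curve add0r.
have -> : f p = (f \o c) 0.
  by congr f; apply: coords_inj; rewrite XE cos0 sin0 scale1r scale0r addr0.
apply: (legendre_ode d1 d2).
(* y'(0) = 0, because the half-turn about p reverses the meridian. *)
- have even s : f (c (- s)) = f (c s).
    rewrite -(pf pi (c s)); congr f; apply: coords_inj.
    have e : dot P (coords (c s)) = cos s.
      have -> : dot P (coords (c s)) = cos s * dot P P + sin s * dot P v.
        by rewrite XE !dot3E !mxE; ring.
      by rewrite pp pv mulr1 mulr0 addr0.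
    rewrite XE cosN sinN -[RHS]/(rodrigues P pi (coords (c s))) /rodrigues e cospi sinpi XE.
    by apply/rowP => i; rewrite !mxE; ring.
  set y1 := dirD _ _ _.
  have d0 := d1 0; rewrite -/y1 in d0.
  have dO : is_derive (- 0 : R) 1 (f \o c) y1 by rewrite oppr0.
  have dN : is_derive (0 : R) 1 (f \o c) (- y1).
    have h0 := @is_derive1_comp R (f \o c) -%R 0 y1 (-1) dO (is_deriveN (is_derive_id (0 : R) 1)).
    have e : f \o c = (f \o c) \o -%R by apply/funext => s; rewrite /= even.
    by rewrite e; apply: (is_derive_eq h0); rewrite mulrN1.
  have := @derive_val _ _ _ _ _ _ _ dN.
  by rewrite (@derive_val _ _ _ _ _ _ _ d0); lra.
- move=> s /andP[s0 spi]; set X := coords (c s).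
  have sn : 0 < sin s by rewrite sin_gt0_pi// s0.
  set tau := curve' P v s; set w := cross P v.
  have y2E : dirD f (c s) (- (cos s *: P + sin s *: v)) = 0.
    by rewrite -XE -scaleN1r dirDZ dirD_radial// mulr0.
  have pX : dot P X = cos s.
    have -> : dot P X = cos s * dot P P + sin s * dot P v.
      by rewrite /X XE !dot3E !mxE; ring.
    by rewrite pp pv mulr1 mulr0 addr0.
  have aE : X - dot P X *: P = sin s *: v by rewrite pX /X XE addrAC subrr add0r.
  have bE : cross P X = sin s *: w.
    have [a0 a1 a2] := crossE P X; have [b0 b1 b2] := crossE P v; rewrite -/w in b0 b1 b2.
    clearbody w; clear -a0 a1 a2 b0 b1 b2 XE; apply: vec_ext; rewrite ?a0 ?a1 ?a2 [RHS]mxE ?b0 ?b1 ?b2 /X XE !mxE; ring.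
  have := Hess_rotation (c s) sf pf; rewrite -/P -/X aE bE HessZ dirDZ.
  have cs := cos2Dsin2 s.
  have vE : v = sin s *: X + cos s *: tau.
    apply/rowP => i; rewrite /X XE /tau /curve' !mxE.
    by rewrite -[LHS]mul1r -cs; ring.
  have -> : dirD f (c s) v = cos s * dirD f (c s) tau by rewrite {1}vE dirDD dirD_radial// mulr0 add0r.
  have fr := cross_orthonormal pp vv pv.
  have lapE : laplacian f (c s) = Hess f (c s) X X + Hess f (c s) tau tau + Hess f (c s) w w.
    have Xi i : X 0 i = cos s * P 0 i + sin s * v 0 i by rewrite /X XE !mxE.
    have ti i : tau 0 i = cos s * v 0 i - sin s * P 0 i by rewrite /tau /curve' !mxE.
    apply: laplacian_frame => i j; rewrite -fr !Xi !ti -/w.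
    transitivity ((cos s ^+ 2 + sin s ^+ 2) * (P 0 i * P 0 j + v 0 i * v 0 j) + w 0 i * w 0 j).
      by ring.
    by rewrite cs mul1r.
  rewrite lf Hess_radial// add0r in lapE.
  rewrite y2E add0r => e.
  have {}e : sin s * Hess f (c s) w w = cos s * dirD f (c s) tau.
    by apply: (mulfI (lt0r_neq0 sn)); rewrite mulrA -expr2.
  have -> : (f \o c) s = - ((Hess f (c s) tau tau + Hess f (c s) w w) / 6).
    by rewrite -lapE /=; field.
  by rewrite -e; field.
Qed.

Definition antipode (x : S2 R) : S2 R.
Proof.
apply: (@S2_of R (- coords x)).
by rewrite -(coordsP x) !dot3E !mxE; ring.
Defined.

Lemma coords_antipode x : coords (antipode x) = - coords x. Proof. by []. Qed.

(** Rotating about -p is rotating about p backwards; so what holds in the hemisphere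
    of p also holds in the opposite one. *)
Lemma rotation_invariant_antipode f (p : S2 R) : rotation_invariant p f ->
  rotation_invariant (antipode p) f.
Proof.
move=> pf a x; rewrite -(pf (- a) x); congr f; apply: coords_inj.
rewrite -[LHS]/(rodrigues (- coords p) a (coords x)) -[RHS]/(rodrigues (coords p) (- a) (coords x)).
rewrite /rodrigues cosN sinN.
have -> : dot (- coords p) (coords x) = - dot (coords p) (coords x) by rewrite !dot3E !mxE; ring.
have -> : cross (- coords p) (coords x) = - cross (coords p) (coords x).
  have [a0 a1 a2] := crossE (- coords p) (coords x); have [b0 b1 b2] := crossE (coords p) (coords x).
  by apply: vec_ext; rewrite ?a0 ?a1 ?a2 [RHS]mxE ?b0 ?b1 ?b2 !mxE; ring.
by apply/rowP => i; rewrite !mxE; ring.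
Qed.

Lemma dot_eq0 (u : V) : dot u u = 0 -> u = 0.
Proof. by move=> h; apply/eqP; apply/negPn/negP => /dot_gt0; rewrite h ltxx. Qed.

(** x is on the meridian that leaves P in the direction of its tangential part. *)
Lemma tangent_part (P x : V) : dot P P = 1 -> dot x x = 1 -> `|dot P x| < 1 ->
  exists v, [/\ dot v v = 1, dot P v = 0 &
    x = cos (acos (dot P x)) *: P + sin (acos (dot P x)) *: v].
Proof.
move=> pp xx; rewrite ltr_norml => /andP[d1 d2]; set d := dot P x in d1 d2 *.
have dm : -1 <= d <= 1 by rewrite !ltW.
have ck : cos (acos d) = d by apply: acosK; rewrite in_itv.
have sk := cos2Dsin2 (acos d); rewrite ck in sk.
set s := sin (acos d) in sk *.
have s2 : s ^+ 2 = 1 - d ^+ 2 by rewrite -sk; ring.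
have s0 : s != 0.
  apply/eqP => s0; move: s2; rewrite s0 expr0n /= => /esym/eqP.
  have : 0 < (1 - d) * (1 + d) by rewrite mulr_gt0//; lra.
  have -> : (1 - d) * (1 + d) = 1 - d ^+ 2 by ring.
  by move=> /gt_eqF ->.
exists (s^-1 *: (x - d *: P)); split.
- have -> : dot (s^-1 *: (x - d *: P)) (s^-1 *: (x - d *: P)) =
    (dot x x - 2 * d * dot P x + d ^+ 2 * dot P P) / s ^+ 2.
    by rewrite !dot3E !mxE; field.
  rewrite pp xx -/d s2 mulr1.
  have -> : 1 - 2 * d * d + d ^+ 2 = 1 - d ^+ 2 by ring.
  by rewrite divff// -s2 expf_neq0.
- have -> : dot P (s^-1 *: (x - d *: P)) = (dot P x - d * dot P P) / s.
    by rewrite !dot3E !mxE; field.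
  by rewrite pp -/d mulr1 subrr mul0r.
- by rewrite ck scalerA divff// scale1r addrC subrK.
Qed.

Lemma dot_norm_le1 (p x : S2 R) : `|dot (coords p) (coords x)| <= 1.
Proof.
set P := coords p; set X := coords x; have pp : dot P P = 1 := coordsP p.
have xx : dot X X = 1 := coordsP x.
have a : 0 <= dot (X - P) (X - P) by apply: sumr_ge0 => i _; rewrite -expr2 sqr_ge0.
have b : 0 <= dot (X + P) (X + P) by apply: sumr_ge0 => i _; rewrite -expr2 sqr_ge0.
have ea : dot (X - P) (X - P) = dot X X - 2 * dot P X + dot P P by rewrite !dot3E !mxE; ring.
have eb : dot (X + P) (X + P) = dot X X + 2 * dot P X + dot P P by rewrite !dot3E !mxE; ring.
by move: a b; rewrite ea eb pp xx ler_norml => a b; apply/andP; split; lra.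
Qed.

Lemma eq_pole (p x : S2 R) : dot (coords p) (coords x) = 1 -> x = p.
Proof.
set P := coords p; set X := coords x => d; have pp : dot P P = 1 := coordsP p.
have xx : dot X X = 1 := coordsP x.
apply: coords_inj; apply/eqP; rewrite -subr_eq0; apply/eqP/dot_eq0.
have -> : dot (X - P) (X - P) = dot X X - 2 * dot P X + dot P P by rewrite !dot3E !mxE; ring.
by rewrite d pp xx; ring.
Qed.

Lemma zonal_hemisphere f (p : S2 R) : smooth f ->
  (forall x, laplacian f x = - (6 * f x)) -> rotation_invariant p f ->
  forall x, 0 <= dot (coords p) (coords x) ->
    f x = f p / 2 * (3 * dot (coords p) (coords x) ^+ 2 - 1).
Proof.
move=> sf lf pf x; set d := dot _ _ => d0.
have := dot_norm_le1 p x; rewrite -/d le_eqVlt => /orP[/eqP d1|d1].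
  have dE : d = 1 by rewrite -d1 ger0_norm.
  by rewrite (eq_pole dE) dE; field.
have [v [vv pv xE]] := tangent_part (coordsP p) (coordsP x) d1.
have h t : dot (curve 0 (coords p) v t) (curve 0 (coords p) v t) = 1.
  by apply: dot_curve => //; exact: coordsP.
have d1' : d < 1 by rewrite (le_lt_trans (ler_norm _) d1).
have dm : -1 <= d <= 1 by apply/andP; split; [rewrite (le_trans _ d0)// lerN10|exact: ltW].
have ck : cos (acos d) = d by apply: acosK; rewrite in_itv.
have tP : 0 <= acos d <= pi / 2.
  rewrite acos_ge0//= leNgt; apply/negP => lt.
  have : cos (acos d) < 0.
    have p2 : 0 < pi / 2 :> R by rewrite divr_gt0// pi_gt0.
    rewrite -cos_pihalf ltr_cos// in_itv /=.
      by rewrite ltW//= ler_pdivrMr// ler_peMr ?pi_ge0// ler1n.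
    by rewrite acos_ge0//= acos_lepi.
  by rewrite ck ltNge d0.
have -> : x = S2_of (h (acos d)).
  by apply: coords_inj; rewrite xE; transitivity (curve 0 (coords p) v (acos d)); rewrite // /curve add0r.
by rewrite (zonal_meridian sf lf pf vv pv h tP) ck.
Qed.

Lemma exists_equator (p : S2 R) : exists x : S2 R, dot (coords p) (coords x) = 0.
Proof.
pose P := coords p; have pp : dot P P = 1 := coordsP p.
have ei i : dot (delta_mx 0 i : V) (delta_mx 0 i) = 1.
  rewrite /dot (bigD1 i)//= !mxE !eqxx mulr1 big1 ?addr0// => j ji.
  by rewrite !mxE (negbTE ji) andbF mul0r.
have Pe i : dot P (delta_mx 0 i) = P 0 i.
  rewrite /dot (bigD1 i)//= !mxE !eqxx mulr1 big1 ?addr0// => j ji.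
  by rewrite !mxE (negbTE ji) andbF mulr0.
have [i Pi] : exists i, `|P 0 i| < 1.
  have [h0|h0] := ltP `|P 0 0| 1; first by exists 0.
  exists 1; move: pp; rewrite dot3E -!expr2 => pp.
  have : 1 <= P 0 0 ^+ 2 by rewrite -real_normK ?num_real// -(expr1n _ 2) lerXn2r ?nnegrE.
  have := sqr_ge0 (P 0 1); have := sqr_ge0 (P 0 2) => a b c.
  have /eqP : P 0 1 ^+ 2 = 0 by lra.
  by rewrite sqrf_eq0 => /eqP ->; rewrite normr0.
have [v [vv pv _]] := @tangent_part P (delta_mx 0 i) pp (ei i) ltac:(by rewrite Pe).
by exists (S2_of vv).
Qed.

(** On each hemisphere f is a multiple of the zonal harmonic, and both multiples agree
    since this harmonic does not vanish on the equator. *)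
Lemma zonal_eigenfunctionE f (p : S2 R) : eigenfunction 6 f -> rotation_invariant p f ->
  exists2 c, c != 0 & forall x, f x = c * (3 * dot (coords p) (coords x) ^+ 2 - 1).
Proof.
move=> [sf [x0 fx0] ef] pf.
have lf x : laplacian f x = - (6 * f x) by rewrite -ef opprK.
have pf' := rotation_invariant_antipode pf.
have dN x : dot (coords (antipode p)) (coords x) = - dot (coords p) (coords x).
  by rewrite coords_antipode !dot3E !mxE; ring.
have [u pu] := exists_equator p.
have fp : f (antipode p) = f p.
  have e1 : f u = f p / 2 * (3 * 0 ^+ 2 - 1).
    by rewrite -{1}pu; apply: zonal_hemisphere => //; rewrite pu.
  have e2 : f u = f (antipode p) / 2 * (3 * 0 ^+ 2 - 1).
    have e0 : dot (coords (antipode p)) (coords u) = 0 by rewrite dN pu oppr0.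
    by rewrite -{1}e0; apply: zonal_hemisphere => //; rewrite e0.
  by move: e2; rewrite e1 expr0n /=; lra.
have fE x : f x = f p / 2 * (3 * dot (coords p) (coords x) ^+ 2 - 1).
  have [d0|d0] := leP 0 (dot (coords p) (coords x)); first exact: zonal_hemisphere.
  have := zonal_hemisphere sf lf pf' (x := x).
  by rewrite fp dN sqrrN; apply; rewrite oppr_ge0 ltW.
exists (f p / 2) => //; apply/eqP => c0; move: fx0.
by rewrite fE c0 mul0r eqxx.
Qed.

End zonal_eigenfunction.

(** * Harmonics of degree one and two *)

Section formal_integration.
Context {R : realType}.
Local Notation sigma := (@surface R).
Local Notation fn := (S2 R -> R).

(** (n-1)!!, so that the indices are exponents. *)
Fixpoint dfact (n : nat) : nat := if n is m.+2 then (m.+1 * dfact m)%N else 1%N.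

(** The classical value 4 pi (a-1)!! (b-1)!! (c-1)!! / (a+b+c+1)!! for even exponents. *)
Definition moment_value (a b c : nat) : R :=
  if odd a || odd b || odd c then 0
  else 4 * pi * ((dfact a * dfact b * dfact c)%:R / (dfact (a + b + c).+2)%:R).

Lemma dfact_gt0 n : (0 < dfact n)%N.
Proof.
suff : (0 < dfact n)%N && (0 < dfact n.+1)%N by case/andP.
by elim: n => // n /andP[h1 h2]; rewrite h2 /= muln_gt0 /= h1.
Qed.

Let nat2_ind (P : nat -> Prop) : P 0%N -> P 1%N -> (forall n, P n -> P n.+2) -> forall n, P n.
Proof.
move=> p0 p1 p2 n; suff : P n /\ P n.+1 by case.
by elim: n => [|n [a b]]; split=> //; exact: p2.
Qed.

Let step (a N : nat) (m m' : R) : N.+3%:R * m' = a.+1%:R * m -> m' = a.+1%:R / N.+3%:R * m.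
Proof. by move=> h; rewrite mulrAC -h mulrAC divff ?mul1r// pnatr_eq0. Qed.

Let value_step (k N x y : nat) : (0 < y)%N ->
  4 * pi * ((k.+1 * x)%:R / (N.+3 * y)%:R) = k.+1%:R / N.+3%:R * (4 * pi * (x%:R / y%:R)) :> R.
Proof.
by move=> _; rewrite !natrM invfM; ring.
Qed.

Lemma dfactSS n : dfact n.+2 = (n.+1 * dfact n)%N. Proof. by []. Qed.

Lemma moment_valueE a b c : moment a b c = moment_value a b c.
Proof.
elim/nat2_ind: c a b => [||c IH] a b; last first.
- rewrite (step (moment_rec_z a b c)) IH /moment_value oddS oddS negbK.
  case: ifP => _; first by rewrite mulr0.
  rewrite -(value_step _ _ _ (dfact_gt0 _)) -!dfactSS; congr (_ * (_%:R / _%:R)).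
    by rewrite dfactSS; ring.
  by congr (dfact _); lia.
- by rewrite moment_z1 /moment_value orbT.
elim/nat2_ind: b a => [||b IH] a; last first.
- rewrite (step (moment_rec_y a b 0)) IH /moment_value (oddS b.+1) (oddS b) negbK.
  case: ifP => _; first by rewrite mulr0.
  rewrite -(value_step _ _ _ (dfact_gt0 _)) -!dfactSS; congr (_ * (_%:R / _%:R)).
    by rewrite dfactSS; ring.
  by congr (dfact _); lia.
- by rewrite moment_y1 /moment_value orbT.
elim/nat2_ind: a => [||a IH]; last first.
- rewrite (step (moment_rec_x a 0 0)) IH /moment_value (oddS a.+1) (oddS a) negbK.
  case: ifP => _; first by rewrite mulr0.
  rewrite -(value_step _ _ _ (dfact_gt0 _)) -!dfactSS; congr (_ * (_%:R / _%:R)).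
  by rewrite dfactSS; ring.
- by rewrite moment_x1 /moment_value.
by rewrite moment000 /moment_value /= divff ?mulr1 ?oner_neq0.
Qed.

(** Polynomials as explicit lists of monomials, on which integration is a computation. *)
Definition fpoly := seq (R * (nat * nat * nat)).

Definition fmon (t : R * (nat * nat * nat)) : fn :=
  cst t.1 * mon t.2.1.1 t.2.1.2 t.2.2.

Definition feval (s : fpoly) : fn := foldr (fun t f => fmon t + f) 0 s.

Definition fmul1 (t : R * (nat * nat * nat)) (s : fpoly) : fpoly :=
  [seq (t.1 * u.1, ((t.2.1.1 + u.2.1.1)%N, (t.2.1.2 + u.2.1.2)%N, (t.2.2 + u.2.2)%N)) | u <- s].

Definition fmul (s s' : fpoly) : fpoly := foldr (fun t p => fmul1 t s' ++ p) [::] s.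

Definition fint (s : fpoly) : R :=
  foldr (fun t v => t.1 * moment_value t.2.1.1 t.2.1.2 t.2.2 + v) 0 s.

Lemma feval_cat s s' : feval (s ++ s') = feval s + feval s'.
Proof. by elim: s => [|t s IH] /=; rewrite ?add0r// IH addrA. Qed.

Lemma feval_mul1 t s : feval (fmul1 t s) = fmon t * feval s.
Proof.
elim: s => [|u s IH] /=; first by rewrite mulr0.
rewrite IH mulrDr /fmon /= -mon_mul; congr (_ + _).
by apply/funext => x; rewrite !fctE; ring.
Qed.

Lemma feval_mul s s' : feval (fmul s s') = feval s * feval s'.
Proof.
elim: s => [|t s IH] /=; first by rewrite mul0r.
by rewrite feval_cat IH feval_mul1 mulrDl.
Qed.

Lemma fmon_polyS t : polyS (t.2.1.1 + t.2.1.2 + t.2.2) (fmon t).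
Proof. by apply: polySZ; exact: polyS_mon. Qed.

Lemma feval_polyS s : exists n, polyS n (feval s).
Proof.
elim: s => [|t s [n pn]]; first by exists 0%N; exact: polyS0.
exists (maxn (t.2.1.1 + t.2.1.2 + t.2.2) n); apply: polySD.
  by apply: polyS_le (fmon_polyS t); rewrite leq_maxl.
by apply: polyS_le pn; rewrite leq_maxr.
Qed.

Lemma feval_L2 s : feval s \in @L2 R.
Proof. by have [n /polyS_L2] := feval_polyS s. Qed.

Lemma ip_feval s s' : ip (feval s) (feval s') = fint (fmul s s').
Proof.
have one : cst 1 \in @L2 R by exact: L2_cst.
have E u : ip (feval u) (cst 1) = fint u.
  elim: u => [|t u IH] /=.
    by rewrite (_ : 0 = cst 0 * cst 1) ?ipZl ?mul0r ?cst0_mul.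
  have tL := polyS_L2 (fmon_polyS t).
  rewrite (ipDl tL (feval_L2 u) one) IH /fmon ipZl//; last exact: mon_L2.
  rewrite -moment_valueE; congr (_ * _ + _); apply: eq_Rintegral => x _.
  by rewrite mulr1.
rewrite -E feval_mul; apply: eq_Rintegral => x _.
by rewrite mulr1.
Qed.

End formal_integration.

Section degree_two.
Context {R : realType}.
Local Notation fn := (S2 R -> R).

(** Traceless symmetric matrices of order 3, by their independent entries. *)
Record tsym := Tsym { a11 : R; a22 : R; a12 : R; a13 : R; a23 : R }.
Implicit Types (A B : tsym) (b u v : 'rV[R]_3).

Definition a33 A : R := - (a11 A + a22 A).

Definition lin b : fn := fun x => dot b (coords x).

Definition qform A v : R := a11 A * v 0 0 ^+ 2 + a22 A * v 0 1 ^+ 2 + a33 A * v 0 2 ^+ 2 +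
  2 * (a12 A * (v 0 0 * v 0 1) + a13 A * (v 0 0 * v 0 2) + a23 A * (v 0 1 * v 0 2)).

Definition quad A : fn := fun x => qform A (coords x).

Definition tdot A B : R := a11 A * a11 B + a22 A * a22 B + a33 A * a33 B +
  2 * (a12 A * a12 B + a13 A * a13 B + a23 A * a23 B).

Definition tr3 A : R := a11 A ^+ 3 + a22 A ^+ 3 + a33 A ^+ 3 +
  3 * ((a11 A + a22 A) * a12 A ^+ 2 + (a11 A + a33 A) * a13 A ^+ 2 + (a22 A + a33 A) * a23 A ^+ 2)
  + 6 * a12 A * a13 A * a23 A.

Let lp b : fpoly := [:: (b 0 0, (1, 0, 0)%N); (b 0 1, (0, 1, 0)%N); (b 0 2, (0, 0, 1)%N)].

Let qp A : fpoly := [:: (a11 A, (2, 0, 0)%N); (a22 A, (0, 2, 0)%N); (a33 A, (0, 0, 2)%N);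
  (2 * a12 A, (1, 1, 0)%N); (2 * a13 A, (1, 0, 1)%N); (2 * a23 A, (0, 1, 1)%N)].

Let one : fpoly := [:: (1 : R, (0, 0, 0)%N)].

Let fct0 (x : S2 R) : (0 : fn) x = 0. Proof. by []. Qed.

Let linE b : lin b = feval (lp b).
Proof.
by apply/funext => x; rewrite /lin dot3E /= !fctE /fmon /= !fctE /mon !expr0 !expr1 (fct0 x); ring.
Qed.

Let quadE A : quad A = feval (qp A).
Proof.
by apply/funext => x; rewrite /quad /qform /= !fctE /fmon /= !fctE /mon !expr0 !expr1 (fct0 x); ring.
Qed.

Let oneE : cst 1 = feval one :> fn.
Proof.
by apply/funext => x; rewrite /= !fctE /fmon /= !fctE /mon !expr0 (fct0 x); ring.
Qed.

Lemma ip_lin b b' : ip (lin b) (lin b') = 4 * pi / 3 * dot b b'.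
Proof.
by rewrite !linE ip_feval dot3E /fint /= /moment_value /=; field.
Qed.

Lemma ip_lin_quad b A : ip (lin b) (quad A) = 0.
Proof.
by rewrite linE quadE ip_feval /fint /= /moment_value /=; field.
Qed.

Lemma ip_lin_one b : ip (lin b) (cst 1) = 0.
Proof.
by rewrite linE oneE ip_feval /fint /= /moment_value /=; field.
Qed.

Lemma ip_quad_one A : ip (quad A) (cst 1) = 0.
Proof.
by rewrite quadE oneE ip_feval /fint /= /moment_value /= /a33; field.
Qed.

Lemma ip_one_one : ip (cst 1) (cst 1) = 4 * pi :> R.
Proof.
by rewrite oneE ip_feval /fint /= /moment_value /=; field.
Qed.

Lemma ip_quad A B : ip (quad A) (quad B) = 8 * pi / 15 * tdot A B.
Proof.
by rewrite !quadE ip_feval /fint /= /moment_value /= /tdot /a33; field.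
Qed.

Lemma cubic_integral b A : \int[@surface R]_x ((lin b x + quad A x) ^+ 3) =
  8 * pi / 5 * qform A b + 32 * pi / 105 * tr3 A.
Proof.
pose s := lp b ++ qp A.
have -> : \int[@surface R]_x ((lin b x + quad A x) ^+ 3) = ip (feval s) (feval (fmul s s)).
  apply: eq_Rintegral => x _; rewrite feval_mul feval_cat -linE -quadE !fctE.
  by rewrite !exprS expr0 mulr1.
rewrite ip_feval /fint /= /moment_value /= /qform /tr3 /a33.
by field.
Qed.


(** On traceless matrices v^T A v = <A, v v^T - |v|^2 I / 3>, and the second matrix has
    squared norm 2/3 |v|^4; this is the Cauchy-Schwarz inequality. *)
Lemma qform_CS A v : qform A v ^+ 2 <= 2 / 3 * tdot A A * dot v v ^+ 2.
Proof.
pose n := dot v v / 3.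
pose D1 := v 0 0 ^+ 2 - n; pose D2 := v 0 1 ^+ 2 - n; pose D3 := v 0 2 ^+ 2 - n.
pose D4 := v 0 0 * v 0 1; pose D5 := v 0 0 * v 0 2; pose D6 := v 0 1 * v 0 2.
rewrite -subr_ge0.
have -> : 2 / 3 * tdot A A * dot v v ^+ 2 - qform A v ^+ 2 =
   (a11 A * D2 - a22 A * D1) ^+ 2 + (a11 A * D3 - a33 A * D1) ^+ 2 + (a22 A * D3 - a33 A * D2) ^+ 2
   + 2 * ((a11 A * D4 - a12 A * D1) ^+ 2 + (a11 A * D5 - a13 A * D1) ^+ 2 + (a11 A * D6 - a23 A * D1) ^+ 2
   + (a22 A * D4 - a12 A * D2) ^+ 2 + (a22 A * D5 - a13 A * D2) ^+ 2 + (a22 A * D6 - a23 A * D2) ^+ 2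
   + (a33 A * D4 - a12 A * D3) ^+ 2 + (a33 A * D5 - a13 A * D3) ^+ 2 + (a33 A * D6 - a23 A * D3) ^+ 2)
   + 4 * ((a12 A * D5 - a13 A * D4) ^+ 2 + (a12 A * D6 - a23 A * D4) ^+ 2 + (a13 A * D6 - a23 A * D5) ^+ 2).
  by rewrite /D1 /D2 /D3 /D4 /D5 /D6 /n /tdot /qform /a33 dot3E; field.
by do ?[exact: sqr_ge0|exact: ler0n|apply: addr_ge0|apply: mulr_ge0].
Qed.

Lemma qform_le A v (mu : R) : 0 <= mu -> tdot A A <= 6 * mu ^+ 2 ->
  qform A v <= 2 * mu * dot v v.
Proof.
move=> mu0 h; have n0 : 0 <= dot v v by apply: sumr_ge0 => i _; rewrite -expr2 sqr_ge0.
have r0 : 0 <= 2 * mu * dot v v by rewrite !mulr_ge0.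
apply: le_trans (ler_norm _) _.
rewrite -(@ler_sqr R) ?nnegrE// real_normK ?num_real//.
apply: le_trans (qform_CS A v) _.
have -> : (2 * mu * dot v v) ^+ 2 = 2 / 3 * (6 * mu ^+ 2) * dot v v ^+ 2 by field.
by rewrite ler_wpM2r ?sqr_ge0// ler_wpM2l// divr_ge0.
Qed.

(** By the previous bound 2 mu - A is positive semi-definite, hence so is
    (mu + A) (2 mu - A) (mu + A), whose trace is 6 mu^3 - tr A^3. This avoids
    diagonalising A. *)
Lemma tr3_le A (mu : R) : 0 <= mu -> tdot A A <= 6 * mu ^+ 2 -> tr3 A <= 6 * mu ^+ 3.
Proof.
move=> mu0 h.
pose v1 := vec3 (mu + a11 A) (a12 A) (a13 A).
pose v2 := vec3 (a12 A) (mu + a22 A) (a23 A).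
pose v3 := vec3 (a13 A) (a23 A) (mu + a33 A).
have f1 := qform_le v1 mu0 h; have f2 := qform_le v2 mu0 h; have f3 := qform_le v3 mu0 h.
rewrite -subr_ge0.
have -> : 6 * mu ^+ 3 - tr3 A = (2 * mu * dot v1 v1 - qform A v1) +
   (2 * mu * dot v2 v2 - qform A v2) + (2 * mu * dot v3 v3 - qform A v3).
  by rewrite /qform /tr3 !dot_vec3 !mxE /= /a33; ring.
by apply: addr_ge0; [apply: addr_ge0|]; rewrite subr_ge0.
Qed.

(** c (3 P P^T - I), the matrix of a zonal harmonic when P is a unit vector. *)
Definition axial (c : R) (P : 'rV[R]_3) : tsym :=
  Tsym (c * (3 * P 0 0 ^+ 2 - 1)) (c * (3 * P 0 1 ^+ 2 - 1))
       (3 * c * (P 0 0 * P 0 1)) (3 * c * (P 0 0 * P 0 2)) (3 * c * (P 0 1 * P 0 2)).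

Let axial33 c P : dot P P = 1 -> a33 (axial c P) = c * (3 * P 0 2 ^+ 2 - 1).
Proof.
rewrite dot3E => pp; rewrite /a33 /=.
have -> : P 0 2 ^+ 2 = 1 - P 0 0 * P 0 0 - P 0 1 * P 0 1 by rewrite -pp; ring.
by ring.
Qed.

Lemma qform_axial c P v : dot P P = 1 ->
  qform (axial c P) v = c * (3 * dot P v ^+ 2 - dot v v).
Proof. by move=> pp; rewrite /qform axial33// !dot3E /=; ring. Qed.

Lemma quad_axial c (p x : S2 R) :
  quad (axial c (coords p)) x = c * (3 * dot (coords p) (coords x) ^+ 2 - 1).
Proof. by rewrite /quad qform_axial ?coordsP. Qed.

Lemma tdot_axial c P B : dot P P = 1 -> tdot B (axial c P) = 3 * c * qform B P.
Proof. by move=> pp; rewrite /tdot axial33// /qform /= /a33; ring. Qed.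

Lemma tdot_axial2 c P : dot P P = 1 -> tdot (axial c P) (axial c P) = 6 * c ^+ 2.
Proof. by move=> pp; rewrite tdot_axial// qform_axial// pp; ring. Qed.

Lemma tr3_axial c P : dot P P = 1 -> tr3 (axial c P) = 6 * c ^+ 3.
Proof.
move=> pp; rewrite /tr3 axial33//=; rewrite dot3E in pp.
pose t := P 0 0 * P 0 0 + P 0 1 * P 0 1 + P 0 2 * P 0 2.
transitivity (c ^+ 3 * (27 * t ^+ 3 - 27 * t ^+ 2 + 9 * t - 3)).
  by rewrite /t; ring.
by rewrite /t pp; ring.
Qed.

Definition tsub A B : tsym := Tsym (a11 A - a11 B) (a22 A - a22 B) (a12 A - a12 B)
  (a13 A - a13 B) (a23 A - a23 B).

Definition tscale (k : R) A : tsym := Tsym (k * a11 A) (k * a22 A) (k * a12 A) (k * a13 A) (k * a23 A).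

Lemma quadB A B : quad A - quad B = quad (tsub A B).
Proof. by apply/funext => x; rewrite !fctE /quad /qform /a33 /=; ring. Qed.

Lemma linB b b' : lin b - lin b' = lin (b - b').
Proof. by apply/funext => x; rewrite !fctE /lin !dot3E !mxE; ring. Qed.

Lemma lin_polyS b : polyS 1 (lin b).
Proof.
have -> : lin b = cst (b 0 0) * crd 0 + cst (b 0 1) * crd 1 + cst (b 0 2) * crd 2.
  by apply/funext => x; rewrite /lin dot3E !fctE /crd.
by do 2?apply: polySD; apply: polySZ; exact: polyS_crd.
Qed.

Lemma quad_polyS A : polyS 2 (quad A).
Proof.
have X i j : polyS 2 (crd i * crd j : fn) by apply: (@polySM _ 1 1); exact: polyS_crd.
have -> : quad A = cst (a11 A) * (crd 0 * crd 0) + cst (a22 A) * (crd 1 * crd 1) + cst (a33 A) * (crd 2 * crd 2)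
  + (cst (2 * a12 A) * (crd 0 * crd 1) + cst (2 * a13 A) * (crd 0 * crd 2) + cst (2 * a23 A) * (crd 1 * crd 2)).
  by apply/funext => x; rewrite /quad /qform !fctE /crd /=; ring.
by do 3?apply: polySD; do 2?apply: polySD; apply: polySZ; exact: X.
Qed.

(** The relation |x|^2 = 1 absorbs the trace of the quadratic part in the constant. *)
Lemma polyS2_normal_form q : polyS 2 q -> exists k b A, q = cst k + lin b + quad A.
Proof.
elim=> [a b c abc|g h _ [k [b [A ->]]] _ [l [b' [A' ->]]]|k g _ [l [b [A ->]]]]; first last.
- exists (k * l), (k *: b), (tscale k A).
  by apply/funext => x; rewrite !fctE /lin /quad /qform /a33 !dot3E !mxE /=; ring.
- exists (k + l), (b + b'), (Tsym (a11 A + a11 A') (a22 A + a22 A') (a12 A + a12 A')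
    (a13 A + a13 A') (a23 A + a23 A')).
  by apply/funext => x; rewrite !fctE /lin /quad /qform /a33 !dot3E !mxE /=; ring.
have s1 x : coords x 0 2 ^+ 2 = 1 - coords x 0 0 ^+ 2 - coords x 0 1 ^+ 2 :> R.
  by rewrite -(coordsP x) dot3E; ring.
have L k (v : 'rV[R]_3) A : (forall x, mon a b c x = k + dot v (coords x) + qform A (coords x)) ->
    exists k b0 A, mon a b c = cst k + lin b0 + quad A.
  by move=> e; exists k, v, A; apply/funext => x; rewrite e.
case: a abc L => [|[|[|a]]] abc L; case: b abc L => [|[|[|b]]] abc L;
  case: c abc L => [|[|[|c]]] abc L; try (exfalso; lia).
- by apply: (L 1 0 (Tsym 0 0 0 0 0)) => x; rewrite /mon dot3E /qform /a33 !mxE /=; ring.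
- by apply: (L 0 (vec3 0 0 1) (Tsym 0 0 0 0 0)) => x; rewrite /mon dot3E /qform /a33 !mxE /=; ring.
- by apply: (L (1/3) 0 (Tsym (-1/3) (-1/3) 0 0 0)) => x; rewrite /mon dot3E /qform /a33 !mxE /= s1; field.
- by apply: (L 0 (vec3 0 1 0) (Tsym 0 0 0 0 0)) => x; rewrite /mon dot3E /qform /a33 !mxE /=; ring.
- by apply: (L 0 0 (Tsym 0 0 0 0 (1/2))) => x; rewrite /mon dot3E /qform /a33 !mxE /=; field.
- by apply: (L (1/3) 0 (Tsym (-1/3) (2/3) 0 0 0)) => x; rewrite /mon dot3E /qform /a33 !mxE /= s1; field.
- by apply: (L 0 (vec3 1 0 0) (Tsym 0 0 0 0 0)) => x; rewrite /mon dot3E /qform /a33 !mxE /=; ring.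
- by apply: (L 0 0 (Tsym 0 0 0 (1/2) 0)) => x; rewrite /mon dot3E /qform /a33 !mxE /=; field.
- by apply: (L 0 0 (Tsym 0 0 (1/2) 0 0)) => x; rewrite /mon dot3E /qform /a33 !mxE /=; field.
- by apply: (L (1/3) 0 (Tsym (2/3) (-1/3) 0 0 0)) => x; rewrite /mon dot3E /qform /a33 !mxE /= s1; field.
Qed.

End degree_two.

(** * Splitting a vorticity into harmonics *)

Section decomposition.
Context {R : realType}.
Local Notation sigma := (@surface R).
Local Notation fn := (S2 R -> R).
Local Notation V := ('rV[R]_3).

Local Notation linL2 b := (polyS_L2 (lin_polyS b)).
Local Notation quadL2 A := (polyS_L2 (quad_polyS A)).

Lemma lin_perp (b : V) q : polyS 0 q -> ip (lin b) q = 0.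
Proof.
elim=> [a c d|g h pg eg ph eh|k g pg eg].
- rewrite leqn0 !addn_eq0 => /andP[/andP[/eqP-> /eqP->] /eqP->].
  rewrite -(ip_lin_one b); congr (ip _ _).
  by apply/funext => x; rewrite /mon !expr0 !mulr1.
- by rewrite (ipDr (polyS_L2 pg) (polyS_L2 ph) (linL2 b)) eg eh addr0.
- by rewrite (ipZr _ (linL2 b) (polyS_L2 pg)) eg mulr0.
Qed.

Lemma quad_perp (A : @tsym R) q : polyS 1 q -> ip (quad A) q = 0.
Proof.
have l0 b : ip (quad A) (lin b) = 0 by rewrite ipC ip_lin_quad.
elim=> [a c d|g h pg eg ph eh|k g pg eg].
- case: a c d => [|[|a]] [|[|c]] [|[|d]] acd; try (exfalso; lia).
  + rewrite -(ip_quad_one A); congr (ip _ _).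
    by apply/funext => x; rewrite /mon !expr0 !mulr1.
  + rewrite -(l0 (vec3 0 0 1)); congr (ip _ _).
    by apply/funext => x; rewrite /mon /lin dot3E !mxE /=; ring.
  + rewrite -(l0 (vec3 0 1 0)); congr (ip _ _).
    by apply/funext => x; rewrite /mon /lin dot3E !mxE /=; ring.
  + rewrite -(l0 (vec3 1 0 0)); congr (ip _ _).
    by apply/funext => x; rewrite /mon /lin dot3E !mxE /=; ring.
- by rewrite (ipDr (polyS_L2 pg) (polyS_L2 ph) (quadL2 A)) eg eh addr0.
- by rewrite (ipZr _ (quadL2 A) (polyS_L2 pg)) eg mulr0.
Qed.

Definition harmonic_split (w : fn) (b : V) (A : @tsym R) (r : fn) :=
  [/\ w = lin b + quad A + r, r \in @L2 R & forall q, polyS 2 q -> ip r q = 0].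

Lemma harmonic_split_exists (w : fn) : w \in @L2 R -> mean_zero w ->
  exists b A r, harmonic_split w b A r.
Proof.
move=> wL w0; have [p pp wp] := projection_exists 2 wL.
have [k [b [A pE]]] := polyS2_normal_form pp.
have one : cst 1 \in @L2 R by exact: L2_cst.
have pL := polyS_L2 pp; have lL := linL2 b; have qL := quadL2 A.
have kL : cst k \in @L2 R by exact: L2_cst.
have k0 : k = 0.
  have : ip w (cst 1) = 0 by rewrite -[RHS]w0; apply: eq_Rintegral => x _; rewrite mulr1.
  have -> : w = (w - p) + p by rewrite subrK.
  rewrite (ipDl (L2B wL pL) pL one) wp ?add0r; last exact: polyS_cst.
  rewrite pE (ipDl (L2D kL lL) qL one) (ipDl kL lL one) ip_lin_one ip_quad_one !addr0.
  have -> : cst k = cst k * cst 1 :> fn by apply/funext => x; rewrite !fctE mulr1.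
  rewrite ipZl// ip_one_one => /eqP; rewrite mulf_eq0 => /orP[/eqP //|].
  by rewrite mulf_eq0 (gt_eqF (pi_gt0 R)) orbF => /eqP; lra.
exists b, A, (w - p); split=> //; last exact: L2B.
have -> : lin b + quad A = p by rewrite pE k0; apply/funext => x; rewrite !fctE add0r.
by rewrite addrC subrK.
Qed.

Section split.
Context (w : fn) (b : V) (A : @tsym R) (r : fn) (spl : harmonic_split w b A r).

Let wE : w = lin b + quad A + r. Proof. by case: spl. Qed.
Let rL : r \in @L2 R. Proof. by case: spl. Qed.
Let r0 q : polyS 2 q -> ip r q = 0. Proof. by case: spl => _ _; apply. Qed.
Let r_lin b' : ip r (lin b') = 0.
Proof. by apply: r0; apply: polyS_le (lin_polyS b'). Qed.
Let r_quad A' : ip r (quad A') = 0. Proof. by apply: r0; exact: quad_polyS. Qed.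

Lemma split_ip_lin b' : ip w (lin b') = 4 * pi / 3 * dot b b'.
Proof.
rewrite wE (ipDl (L2D (linL2 b) (quadL2 A)) rL (linL2 b')) (ipDl (linL2 b) (quadL2 A) (linL2 b')).
by rewrite r_lin ip_lin (ipC (quad A)) ip_lin_quad !addr0.
Qed.

Lemma split_ip : ip w w = 4 * pi / 3 * dot b b + 8 * pi / 15 * tdot A A + ip r r.
Proof.
have lq : lin b + quad A \in @L2 R by exact: (L2D (linL2 b) (quadL2 A)).
rewrite wE (ipDl lq rL (L2D lq rL)) (ipDr lq rL lq) (ipDr lq rL rL).
rewrite (ipDr (linL2 b) (quadL2 A) lq) (ipDr (linL2 b) (quadL2 A) rL) r_lin r_quad.
rewrite (ipDl (linL2 b) (quadL2 A) rL) (ipDl (linL2 b) (quadL2 A) (linL2 b)) (ipDl (linL2 b) (quadL2 A) (quadL2 A)).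
rewrite !(ipC _ r) r_lin r_quad (ipC (quad A) (lin b)) ip_lin_quad ip_lin ip_quad.
by rewrite !addr0 !add0r.
Qed.

(** The linear and the quadratic part are eigenvectors for 2 and 6; the spectral gap
    bounds what is left. *)
Lemma split_energy (psi : fn) : psi \in @L2 R ->
  (forall n q, polyS n q -> ip psi (laplacian q) = ip w q) ->
  exists e, 0 <= e <= ip r r / 12 /\
    - ip w psi = 4 * pi / 3 * dot b b / 2 + 8 * pi / 15 * tdot A A / 6 + e.
Proof.
move=> psiL wk; exists (- ip r psi).
have eig n h : polyS n.+1 h -> (forall q, polyS n q -> ip h q = 0) ->
    n.+1%:R * n.+2%:R * ip psi h = - ip w h.
  by move=> ph hq; rewrite -(wk _ _ ph) (harmonic_eigen ph hq psiL) mulNr opprK.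
split.
  apply: spectral_gap => // n h n1 ph hq; rewrite eig//; congr (- _).
  rewrite wE (ipDl (L2D (linL2 b) (quadL2 A)) rL (polyS_L2 ph)).
  rewrite (ipC (_ + _) h) hq ?add0r//; apply: polySD.
    by apply: polyS_le (lin_polyS b); lia.
  by apply: polyS_le (quad_polyS A); lia.
have e1 := eig _ _ (lin_polyS b) (@lin_perp b).
have e2 := eig _ _ (quad_polyS A) (@quad_perp A).
rewrite split_ip_lin in e1.
have wq : ip w (quad A) = 8 * pi / 15 * tdot A A.
  rewrite wE (ipDl (L2D (linL2 b) (quadL2 A)) rL (quadL2 A)) (ipDl (linL2 b) (quadL2 A) (quadL2 A)).
  by rewrite r_quad ip_quad ip_lin_quad addr0 add0r.
rewrite wq in e2.
rewrite wE (ipDl (L2D (linL2 b) (quadL2 A)) rL psiL) (ipDl (linL2 b) (quadL2 A) psiL).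
rewrite (ipC (lin b)) (ipC (quad A)); lra.
Qed.

End split.

Lemma harmonic_split_sub w b A r w' b' A' : harmonic_split w b A r ->
  w' = lin b' + quad A' -> harmonic_split (w - w') (b - b') (tsub A A') r.
Proof.
move=> [-> rL r0] ->; split=> //; rewrite -linB -quadB.
by apply/funext => x; rewrite !fctE; ring.
Qed.

(** Eliminate the quadratic part between energy and enstrophy: |r|^2 - 6 e is conserved,
    where e, the energy of r up to a factor, is between 0 and |r|^2 / 12. *)
Lemma high_modes_stable (w w' psi psi' : fn) b A r A' r' :
  harmonic_split w b A r -> harmonic_split w' b A' r' ->
  psi \in @L2 R -> psi' \in @L2 R ->
  (forall n q, polyS n q -> ip psi (laplacian q) = ip w q) ->
  (forall n q, polyS n q -> ip psi' (laplacian q) = ip w' q) ->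
  ip w psi = ip w' psi' -> ip w w = ip w' w' ->
  ip r' r' <= 2 * ip r r /\
  8 * pi / 15 * tdot A' A' + ip r' r' = 8 * pi / 15 * tdot A A + ip r r.
Proof.
move=> s s' psiL psi'L wk wk' en ens.
have [e [/andP[e0 e1] eE]] := split_energy s psiL wk.
have [e' [/andP[e'0 e'1] e'E]] := split_energy s' psi'L wk'.
rewrite (split_ip s) (split_ip s') in ens; rewrite en e'E in eE.
by split; lra.
Qed.

End decomposition.

(** * The cubic Casimir *)

Section axial_stability.
Context {R : realType}.
Local Notation V := ('rV[R]_3).
Implicit Types (A B : @tsym R).

Let tscale_qform k A (v : V) : qform (tscale k A) v = k * qform A v.
Proof. by rewrite /qform /a33 /=; ring. Qed.

Let tscale_tr3 k A : tr3 (tscale k A) = k ^+ 3 * tr3 A.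
Proof. by rewrite /tr3 /a33 /=; ring. Qed.

Let tdot_tscale k A B : tdot (tscale k A) B = k * tdot A B.
Proof. by rewrite /tdot /a33 /=; ring. Qed.

Let tdot_tscaler k A B : tdot A (tscale k B) = k * tdot A B.
Proof. by rewrite /tdot /a33 /=; ring. Qed.

Lemma tdot_sub A B : tdot (tsub A B) (tsub A B) = tdot A A - 2 * tdot A B + tdot B B.
Proof. by rewrite /tdot /tsub /a33 /=; ring. Qed.

Let tscale_axial k c (P : V) : tscale k (axial c P) = axial (k * c) P.
Proof. by rewrite /tscale /axial /=; congr Tsym; ring. Qed.

Lemma tdot_ge0 A : 0 <= tdot A A.
Proof.
rewrite /tdot -!expr2.
by do ?[exact: sqr_ge0|exact: ler0n|apply: addr_ge0|apply: mulr_ge0].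
Qed.

Let axial_stability_pos (P : V) (c k1 k2 : R) A (L d D : R) : dot P P = 1 -> 0 < c -> 0 < k1 -> 0 < k2 ->
  0 <= d <= D -> 0 <= L -> tdot A A <= 6 * (c + d) ^+ 2 ->
  k1 * (2 * c - qform A P) + k2 * (6 * c ^+ 3 - tr3 A) <= L * d ->
  tdot (tsub A (axial c P)) (tsub A (axial c P)) <=
   (6 * (2 * c + D) + 6 * c * ((L + 18 * k2 * (c + D) ^+ 2) / k1)) * d.
Proof.
move=> pp c0 k10 k20 /andP[d0 dD] L0 h1 h2.
have cd0 : 0 <= c + d by rewrite addr_ge0// ltW.
have h3 := tr3_le cd0 h1.
rewrite tdot_sub tdot_axial2// tdot_axial//.
have h4 : (c + d) ^+ 3 - c ^+ 3 <= 3 * (c + D) ^+ 2 * d.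
  have -> : (c + d) ^+ 3 - c ^+ 3 = ((c + d) ^+ 2 + (c + d) * c + c ^+ 2) * d by ring.
  rewrite ler_wpM2r//.
  have e1 : (c + d) ^+ 2 <= (c + D) ^+ 2 by rewrite ler_sqr ?nnegrE ?lerD2l//; lra.
  have e2 : c ^+ 2 <= (c + D) ^+ 2 by rewrite ler_sqr ?nnegrE//; lra.
  have e3 : (c + d) * c <= (c + D) ^+ 2 by rewrite expr2 ler_pM//; lra.
  by lra.
have h5 : k1 * (2 * c - qform A P) <= (L + 18 * k2 * (c + D) ^+ 2) * d.
  have : k2 * tr3 A <= k2 * (6 * (c + d) ^+ 3) by rewrite ler_pM2l.
  have : k2 * ((c + d) ^+ 3 - c ^+ 3) <= k2 * (3 * (c + D) ^+ 2 * d) by rewrite ler_pM2l.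
  by lra.
have h6 : 2 * c - qform A P <= (L + 18 * k2 * (c + D) ^+ 2) / k1 * d.
  by rewrite mulrAC ler_pdivlMr// mulrC.
have h7 : c * (2 * c - qform A P) <= c * ((L + 18 * k2 * (c + D) ^+ 2) / k1 * d) by rewrite ler_pM2l.
have h8 : d * d <= D * d by rewrite ler_wpM2r.
have : tdot A A <= 6 * c ^+ 2 + 12 * c * d + 6 * (d * d) by apply: (le_trans h1); lra.
lra.
Qed.

(** Multiplying c and A by the sign of c reduces to c > 0. There, the cubic functional is
    the sum of two terms that are both maximal at the axial matrix up to O(d), so
    that each of them is nearly maximal; and the linear one controls the distance. *)
Lemma axial_stability (P : V) (c k1 k2 : R) A (L d D : R) : dot P P = 1 -> c != 0 ->
  0 < k1 -> 0 < k2 -> 0 <= d <= D -> 0 <= L -> tdot A A <= 6 * (`|c| + d) ^+ 2 ->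
  `|k1 * (2 * c - qform A P) + k2 * (6 * c ^+ 3 - tr3 A)| <= L * d ->
  tdot (tsub A (axial c P)) (tsub A (axial c P)) <=
   (6 * (2 * `|c| + D) + 6 * `|c| * ((L + 18 * k2 * (`|c| + D) ^+ 2) / k1)) * d.
Proof.
move=> pp c0 k10 k20 dD L0 h1 h2.
pose s := Num.sg c; have s2 : s * s = 1 by rewrite -expr2 sqr_sg c0.
have s3 : s ^+ 3 = s by rewrite exprS expr2 s2 mulr1.
have cs : `|c| = s * c by rewrite normrEsg.
have cs3 : `|c| ^+ 3 = s * c ^+ 3 by rewrite cs exprMn s3.
have -> : tdot (tsub A (axial c P)) (tsub A (axial c P)) =
    tdot (tsub (tscale s A) (axial `|c| P)) (tsub (tscale s A) (axial `|c| P)).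
  have -> : tsub (tscale s A) (axial `|c| P) = tscale s (tsub A (axial c P)).
    by rewrite cs -tscale_axial /tsub /tscale /=; congr Tsym; ring.
  by rewrite tdot_tscale tdot_tscaler mulrA s2 mul1r.
apply: axial_stability_pos => //; first by rewrite normr_gt0.
  by rewrite tdot_tscale tdot_tscaler mulrA s2 mul1r.
rewrite tscale_qform tscale_tr3 cs3 s3 {1}cs.
have -> : k1 * (2 * (s * c) - s * qform A P) + k2 * (6 * (s * c ^+ 3) - s * tr3 A) =
  s * (k1 * (2 * c - qform A P) + k2 * (6 * c ^+ 3 - tr3 A)) by ring.
apply: le_trans (ler_norm _) _; rewrite normrM normr_sg c0 mul1r.
exact: h2.
Qed.

End axial_stability.

Section casimir.
Context {R : realType}.
Local Notation sigma := (@surface R).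
Local Notation fn := (S2 R -> R).

Definition clamp (M s : R) : R := Num.max (- M) (Num.min s M).

(** The cube, made bounded and Lipschitz by truncation. *)
Definition clamp3 (M s : R) : R := clamp M s ^+ 3.

Lemma clamp_id M s : `|s| <= M -> clamp M s = s.
Proof.
rewrite ler_norml => /andP[a b]; rewrite /clamp min_l// max_r//.
Qed.

Lemma clamp_le M s : 0 <= M -> `|clamp M s| <= M.
Proof.
move=> M0; rewrite /clamp ler_norml; apply/andP; split.
  by rewrite le_max lexx.
by rewrite ge_max ge_min lexx orbT andbT; lra.
Qed.

Lemma clamp_lip M s t : 0 <= M -> `|clamp M s - clamp M t| <= `|s - t|.
Proof.
move=> M0; rewrite /clamp.
wlog st : s t / s <= t.
  move=> h; have [/h//|ts] := leP s t.
  by rewrite distrC (distrC s); apply: h; exact: ltW.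
have e : `|s - t| = t - s by rewrite distrC ger0_norm// subr_ge0.
rewrite e ler_norml !maxEle !minEle.
have mm : - M <= M by lra.
case: (leP s M) => ?; case: (leP t M) => ?; rewrite ?mm; case: (leP (- M) s) => ?; case: (leP (- M) t) => ?;
  by apply/andP; split; lra.
Qed.

Lemma clamp3_lip M s t : 0 <= M -> `|clamp3 M s - clamp3 M t| <= 3 * M ^+ 2 * `|s - t|.
Proof.
move=> M0; rewrite /clamp3; set x := clamp M s; set y := clamp M t.
have hx : `|x| <= M := clamp_le s M0; have hy : `|y| <= M := clamp_le t M0.
have -> : x ^+ 3 - y ^+ 3 = (x ^+ 2 + x * y + y ^+ 2) * (x - y) by ring.
rewrite normrM ler_pM//; last exact: clamp_lip.
have -> : 3 * M ^+ 2 = M ^+ 2 + M * M + M ^+ 2 by ring.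
rewrite (le_trans (ler_normD _ _))// lerD//; last by rewrite normrX lerXn2r ?nnegrE.
rewrite (le_trans (ler_normD _ _))// lerD//; first by rewrite normrX lerXn2r ?nnegrE.
by rewrite normrM ler_pM.
Qed.

Lemma continuous_clamp3 M : 0 <= M -> continuous (clamp3 M).
Proof.
move=> M0 s; apply/cvgrPdist_le => e e0 /=.
have k0 : 0 < 3 * M ^+ 2 + 1 by rewrite ltr_wpDl// mulr_ge0// sqr_ge0.
near=> t; rewrite (le_trans (clamp3_lip _ _ M0))//.
have : `|s - t| <= e / (3 * M ^+ 2 + 1).
  by near: t; apply: cvgr_dist_le => //; rewrite divr_gt0.
rewrite ler_pdivlMr// mulrDr mulr1 mulrC; apply: le_trans.
by rewrite lerDl.
Unshelve. all: by end_near. Qed.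

Lemma clamp3_integrable M (w : fn) : 0 <= M -> w \in @L2 R ->
  sigma.-integrable setT (EFin \o (clamp3 M \o w)).
Proof.
move=> M0 wL; apply: (@bounded_integrable _ _ (M ^+ 3)).
  apply: measurableT_comp; last exact: L2_measurable.
  exact: continuous_measurable_fun (continuous_clamp3 M0).
by move=> x; rewrite /= /clamp3 normrX lerXn2r ?nnegrE// clamp_le.
Qed.

Lemma clamp3_integral_lip M (v w : fn) : 0 <= M -> v \in @L2 R -> w \in @L2 R ->
  `|\int[sigma]_x clamp3 M (v x) - \int[sigma]_x clamp3 M (w x)| <=
     3 * M ^+ 2 * Num.sqrt (4 * pi) * nrm (v - w).
Proof.
move=> M0 vL wL.
have iv := clamp3_integrable M0 vL; have iw := clamp3_integrable M0 wL.
have dL := L2B vL wL.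
pose d : fn := fun x => `|v x - w x|.
have dL' : d \in @L2 R.
  apply/L2P; split; first exact: measurableT_comp (L2_measurable dL).
  have [_] := (L2P (v - w)).1 dL; congr (_.-integrable _ _).
  by apply/funext => x; rewrite /d /= real_normK ?num_real.
have one : cst 1 \in @L2 R by exact: L2_cst.
have dd : ip d d = ip (v - w) (v - w).
  by apply: eq_Rintegral => x _; rewrite /d !fctE -!expr2 real_normK ?num_real.
have h : ip d (cst 1) <= Num.sqrt (4 * pi) * nrm (v - w).
  have := CS_nrm dL' one; rewrite /nrm dd ip_one_one mulrC.
  by apply: le_trans; exact: ler_norm.
rewrite -RintegralB//.
have ivw := integrableB measurableT iv iw.
apply: le_trans (le_normr_Rintegral measurableT _) _; first exact: ivw.
rewrite -mulrA; apply: (@le_trans _ _ (3 * M ^+ 2 * ip d (cst 1))); last first.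
  by rewrite ler_wpM2l// mulr_ge0// sqr_ge0.
rewrite /ip -RintegralZl//; last exact: ip_integrable.
apply: le_Rintegral => //.
- exact: integrable_norm ivw.
- have := ip_integrable (L2Z (3 * M ^+ 2) dL') one; congr (_.-integrable _ _).
  by apply/funext => x /=; rewrite !fctE !mulr1.
- by move=> x _; rewrite mulr1; exact: clamp3_lip.
Qed.

End casimir.

(** * The stability estimate *)

Section stability.
Context {R : realType}.
Local Notation sigma := (@surface R).
Local Notation fn := (S2 R -> R).
Local Notation V := ('rV[R]_3).
Local Notation linL2 b := (polyS_L2 (lin_polyS b)).
Local Notation quadL2 A := (polyS_L2 (quad_polyS A)).

Lemma normL2_nrm (f : fn) : f \in @L2 R -> normL2 f = nrm f.
Proof. by move=> fL; rewrite /nrm -normL2_sqr// sqrtr_sqr ger0_norm// normL2_ge0. Qed.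

(** An initial datum is prescribed up to a null set only. *)
Lemma ae_eq_nrm (f g : fn) : f \in @L2 R -> g \in @L2 R ->
  {ae sigma, forall x, f x = g x} -> nrm f = nrm g.
Proof.
move=> fL gL fg; rewrite /nrm /ip; congr Num.sqrt; rewrite /Rintegral; congr fine.
apply: ae_eq_integral => //; try exact: measurable_int (ip_integrable _ _).
by apply: filterS fg => x /= -> _.
Qed.

(** Lagrange's identity |b|^2 |x|^2 - (b.x)^2 = |b x x|^2. *)
Lemma lin_le (b : V) (x : S2 R) : `|lin b x| <= Num.sqrt (dot b b).
Proof.
rewrite -(@ler_sqr R) ?nnegrE ?sqrtr_ge0// real_normK ?num_real//.
have b0 : 0 <= dot b b by apply: sumr_ge0 => i _; rewrite -expr2 sqr_ge0.
rewrite sqr_sqrtr// -subr_ge0.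
set X := coords x; have xx : dot X X = 1 := coordsP x.
have -> : dot b b - lin b x ^+ 2 = dot (cross b X) (cross b X).
  have [c0 c1 c2] := crossE b X; rewrite [RHS]dot3E c0 c1 c2.
  rewrite -[dot b b]mulr1 -xx /lin -/X !dot3E; ring.
by apply: sumr_ge0 => i _; rewrite -expr2 sqr_ge0.
Qed.

Lemma quad_le (A : @tsym R) (mu : R) (x : S2 R) : 0 <= mu -> tdot A A <= 6 * mu ^+ 2 ->
  `|quad A x| <= 2 * mu.
Proof.
move=> mu0 h; rewrite -(@ler_sqr R) ?nnegrE ?mulr_ge0// real_normK ?num_real//.
apply: le_trans (qform_CS A (coords x)) _; rewrite coordsP expr1n mulr1.
have -> : (2 * mu) ^+ 2 = 2 / 3 * (6 * mu ^+ 2) by field.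
by rewrite ler_wpM2l// divr_ge0.
Qed.

Lemma clamp3_integralE (M : R) (b : V) A : (forall x, `|lin b x + quad A x| <= M) ->
  \int[sigma]_x clamp3 M ((lin b + quad A) x) =
  8 * pi / 5 * qform A b + 32 * pi / 105 * tr3 A.
Proof.
move=> hM; rewrite -cubic_integral; apply: eq_Rintegral => x _.
by rewrite -[(lin b + quad A) x]/(lin b x + quad A x) /clamp3 (clamp_id (hM x)).
Qed.

Lemma stream_function_poly (w psi : fn) : stream_function w psi ->
  forall n q, polyS n q -> ip psi (laplacian q) = ip w q.
Proof. by move=> [_ _ h] n q pq; exact: h (polyS_smooth pq). Qed.

Lemma casimir_ip (omega : R -> fn) t : casimirs_conserved omega -> 0 <= t ->
  omega t \in @L2 R -> omega 0 \in @L2 R -> ip (omega t) (omega t) = ip (omega 0) (omega 0).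
Proof.
move=> cas t0 tL oL.
have e (w : fn) : ip w w = \int[sigma]_x (w x ^+ 2) by apply: eq_Rintegral => x _; rewrite expr2.
rewrite !e; apply: (cas (fun s => s ^+ 2)) => //.
- by move=> x; exact: exprn_continuous.
- by have [_] := (L2P (omega t)).1 tL.
- by have [_] := (L2P (omega 0)).1 oL.
Qed.

Section rossby_haurwitz_estimate.
Context (P : V) (Omega c : R) (pp : dot P P = 1) (c0 : c != 0) (Omega0 : Omega != 0).

(* kap is |quad A|^2 / |A|^2, and s |c| is the norm of the quadratic part of the reference
   wave: an error eps on that norm is an error d = eps / s <= D on |A| / sqrt 6. *)
Let kap : R := 8 * pi / 15.
Let s := Num.sqrt (6 * kap).
Let D := s^-1.
Let M := `|Omega| + 2 * (`|c| + D).
Let Lc := 3 * M ^+ 2 * Num.sqrt (4 * pi).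
Let k1 := 8 * pi / 5 * Omega ^+ 2.
Let k2 : R := 32 * pi / 105.
Let C0 := 6 * (2 * `|c| + D) + 6 * `|c| * ((4 * Lc * s + 18 * k2 * (`|c| + D) ^+ 2) / k1).
Let wb : fn := lin (Omega *: P) + quad (axial c P).

Let kap_gt0 : 0 < kap. Proof. by have := pi_gt0 R; rewrite /kap; lra. Qed.
Let s_gt0 : 0 < s. Proof. by rewrite sqrtr_gt0 mulr_gt0. Qed.
Let s2 : s ^+ 2 = 6 * kap. Proof. by rewrite sqr_sqrtr// mulr_ge0// ltW. Qed.
Let D_gt0 : 0 < D. Proof. by rewrite invr_gt0. Qed.
Let k1_gt0 : 0 < k1.
Proof. by rewrite mulr_gt0// ?exprn_even_gt0//; have := pi_gt0 R; lra. Qed.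
Let k2_gt0 : 0 < k2. Proof. by have := pi_gt0 R; rewrite /k2; lra. Qed.
Let M_ge0 : 0 <= M. Proof. by rewrite addr_ge0// mulr_ge0// addr_ge0// ltW. Qed.
Let Lc_ge0 : 0 <= Lc. Proof. by rewrite !mulr_ge0 ?sqrtr_ge0// sqr_ge0. Qed.
Let C0_ge0 : 0 <= C0.
Proof.
have [s0 k10 k20 D0] := And4 (ltW s_gt0) (ltW k1_gt0) (ltW k2_gt0) (ltW D_gt0).
by rewrite /C0; do ?[exact: sqr_ge0|exact: ler0n|exact: normr_ge0|done|
  apply: addr_ge0|apply: mulr_ge0|rewrite invr_ge0].
Qed.

Context (w w' : fn) (b : V) (A A' : @tsym R) (r r' : fn).
Context (spl : harmonic_split w b A r) (spl' : harmonic_split w' b A' r').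
Let eps := nrm (w - wb).
Let b1 := b - Omega *: P.
Let d := eps * D.

Let eps_ge0 : 0 <= eps. Proof. exact: nrm_ge0. Qed.
Let sub : harmonic_split (w - wb) b1 (tsub A (axial c P)) r.
Proof. exact: harmonic_split_sub spl _. Qed.
Let sub' : harmonic_split (w' - wb) b1 (tsub A' (axial c P)) r'.
Proof. exact: harmonic_split_sub spl' _. Qed.
Let rL : r \in @L2 R. Proof. by case: spl. Qed.
Let rL' : r' \in @L2 R. Proof. by case: spl'. Qed.

Let epsE : eps ^+ 2 = 4 * pi / 3 * dot b1 b1 +
  kap * tdot (tsub A (axial c P)) (tsub A (axial c P)) + ip r r.
Proof. by rewrite nrm_sqr (split_ip sub). Qed.

Let b1_ge0 : 0 <= 4 * pi / 3 * dot b1 b1.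
Proof.
rewrite mulr_ge0//; first by have := pi_gt0 R; lra.
by apply: sumr_ge0 => i _; rewrite -expr2 sqr_ge0.
Qed.

Let sub_ge0 : 0 <= kap * tdot (tsub A (axial c P)) (tsub A (axial c P)).
Proof. by rewrite mulr_ge0 ?tdot_ge0// ltW. Qed.

Let b1_le : 4 * pi / 3 * dot b1 b1 <= eps ^+ 2.
Proof. by rewrite epsE -addrA lerDl addr_ge0// ip_ge0. Qed.

Let nrm_b1 : nrm (lin b1) <= eps.
Proof. by rewrite -(@ler_sqr R) ?nnegrE ?nrm_ge0// nrm_sqr ip_lin. Qed.

Let r_le : ip r r <= eps ^+ 2.
Proof. by rewrite epsE lerDr addr_ge0. Qed.

Let split_nrm A1 r1 : r1 \in @L2 R -> (forall q, polyS 2 q -> ip r1 q = 0) ->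
  nrm (quad A1 + r1) ^+ 2 = kap * tdot A1 A1 + ip r1 r1.
Proof.
move=> r1L r10; have qL := polyS_L2 (quad_polyS A1).
rewrite nrm_sqr (ipDl qL r1L (L2D qL r1L)) !(ipDr qL r1L) // ip_quad.
by rewrite (ipC (quad A1)) r10 ?addr0 ?add0r//; exact: quad_polyS.
Qed.

(** |q'|^2 <= |q'|^2 + |r'|^2 = |q + r|^2, and q + r is within eps of the quadratic part
    of the reference wave. *)
Lemma quad_part_bound : kap * tdot A' A' + ip r' r' = kap * tdot A A + ip r r ->
  tdot A' A' <= 6 * (`|c| + d) ^+ 2.
Proof.
move=> qq; have [_ _ r0] := spl.
have e1 : quad A + r = quad (axial c P) + (quad (tsub A (axial c P)) + r).
  by apply/funext => x; rewrite -quadB !fctE; ring.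
have e3 : nrm (quad (tsub A (axial c P)) + r) <= eps.
  rewrite -(@ler_sqr R) ?nnegrE ?nrm_ge0// epsE split_nrm//.
  by rewrite -addrA lerDr.
have e4 : nrm (quad (axial c P)) = `|c| * s.
  rewrite /nrm ip_quad tdot_axial2// -/kap.
  have -> : kap * (6 * c ^+ 2) = (c * s) ^+ 2 by rewrite exprMn s2; ring.
  by rewrite sqrtr_sqr normrM (gtr0_norm s_gt0).
have e5 : nrm (quad A + r) <= `|c| * s + eps.
  rewrite e1 (le_trans (nrmD _ _)) ?e4 ?lerD2l//; first exact: (quadL2 _).
  exact: (L2D (quadL2 _) rL).
have e6 : kap * tdot A' A' <= (`|c| * s + eps) ^+ 2.
  apply: (@le_trans _ _ (nrm (quad A + r) ^+ 2)).
    by rewrite split_nrm// -qq lerDl ip_ge0.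
  by rewrite ler_sqr ?nnegrE ?nrm_ge0// addr_ge0// mulr_ge0// ltW.
rewrite -(ler_pM2l kap_gt0); apply: le_trans e6 _.
have -> : `|c| * s + eps = s * (`|c| + d) by rewrite /d /D; field; rewrite gt_eqF.
by rewrite exprMn s2 le_eqVlt; apply/orP; left; apply/eqP; ring.
Qed.

Let J (v : fn) := \int[sigma]_x clamp3 M (v x).

(** The functions w and w' stand for the vorticity at time 0 and at time t. They are only
    known to share b, the energy and enstrophy balance, and the truncated cubic
    Casimir J; the level M bounds l + q for every admissible quadratic part q. *)
Lemma rossby_haurwitz_estimate : eps < 1 -> ip r' r' <= 2 * ip r r ->
  kap * tdot A' A' + ip r' r' = kap * tdot A A + ip r r ->
  J w' = J w -> w \in @L2 R -> w' \in @L2 R ->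
  nrm (w' - wb) <= Num.sqrt (3 + kap * (C0 * D)) * Num.sqrt eps.
Proof.
move=> eps1 rr qq Jw wL w'L; have tA := quad_part_bound qq.
have wbL : wb \in @L2 R by exact: (L2D (linL2 _) (quadL2 _)).
have lr : nrm r' <= 2 * eps.
  rewrite -(@ler_sqr R) ?nnegrE ?nrm_ge0 ?mulr_ge0// nrm_sqr exprMn.
  apply: (le_trans rr); apply: ler_pM => //; first exact: ip_ge0.
  by rewrite expr2 ler_peMr// ler1n.
have /andP[d0 dD] : 0 <= d <= D.
  by rewrite mulr_ge0 ?(ltW D_gt0)//= ler_piMl ?(ltW D_gt0)// ltW.
have cd0 : 0 <= `|c| + d by rewrite addr_ge0.
have bd (B : @tsym R) : tdot B B <= 6 * (`|c| + d) ^+ 2 ->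
    forall x, `|lin (Omega *: P) x + quad B x| <= M.
  move=> hB x; rewrite (le_trans (ler_normD _ _))// lerD//.
    rewrite (le_trans (lin_le _ _))//.
    have -> : dot (Omega *: P) (Omega *: P) = Omega ^+ 2 * dot P P by rewrite !dot3E !mxE; ring.
    by rewrite pp mulr1 sqrtr_sqr.
  by rewrite (le_trans (quad_le x cd0 hB))// ler_pM2l// lerD2l.
have tAb : tdot (axial c P) (axial c P) <= 6 * (`|c| + d) ^+ 2.
  by rewrite tdot_axial2// ler_pM2l// -[c ^+ 2]real_normK ?num_real// ler_sqr ?nnegrE// lerDl.
have Jlip u v : u \in @L2 R -> v \in @L2 R -> `|J u - J v| <= Lc * nrm (u - v).
  by move=> uL vL; exact: clamp3_integral_lip.
have lA : lin (Omega *: P) + quad A' \in @L2 R by exact: (L2D (linL2 _) (quadL2 _)).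
(* Replace w by the reference wave, and w' by its part of degree at most two in which b
   has been moved to Omega P. *)
have J1 : `|J w - J wb| <= Lc * eps by exact: Jlip.
have J2 : `|J w' - J (lin (Omega *: P) + quad A')| <= Lc * (3 * eps).
  rewrite (le_trans (Jlip _ _ w'L lA))// ler_wpM2l//.
  have -> : w' - (lin (Omega *: P) + quad A') = lin b1 + r'.
    by have [-> _ _] := spl'; apply/funext => x; rewrite /b1 -linB !fctE; ring.
  rewrite (le_trans (nrmD (linL2 _) rL'))//.
  by have -> : 3 * eps = eps + 2 * eps; [ring|exact: lerD].
have qP B : qform B (Omega *: P) = Omega ^+ 2 * qform B P by rewrite /qform !mxE; ring.
have J3 : J wb = k1 * (2 * c) + k2 * (6 * c ^+ 3).
  rewrite /J /wb clamp3_integralE; last exact: bd.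
  by rewrite qP qform_axial// tr3_axial// pp /k1 /k2; ring.
have J4 : J (lin (Omega *: P) + quad A') = k1 * qform A' P + k2 * tr3 A'.
  rewrite /J clamp3_integralE; last exact: bd.
  by rewrite qP /k1 /k2; ring.
have K : `|k1 * (2 * c - qform A' P) + k2 * (6 * c ^+ 3 - tr3 A')| <= 4 * Lc * s * d.
  have -> : 4 * Lc * s * d = Lc * (3 * eps) + Lc * eps by rewrite /d /D; field; rewrite gt_eqF.
  have -> : k1 * (2 * c - qform A' P) + k2 * (6 * c ^+ 3 - tr3 A') =
     (J w' - J (lin (Omega *: P) + quad A')) - (J w - J wb).
    by rewrite Jw J3 J4; ring.
  by rewrite (le_trans (ler_normB _ _))// lerD.
have dd : 0 <= d <= D by rewrite d0.
have Ls0 : 0 <= 4 * Lc * s by rewrite !mulr_ge0// ltW.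
have fin := axial_stability pp c0 k1_gt0 k2_gt0 dd Ls0 tA K; rewrite -/C0 in fin.
rewrite -(@ler_sqr R) ?nnegrE ?nrm_ge0 ?mulr_ge0 ?sqrtr_ge0//.
rewrite nrm_sqr (split_ip sub') -/kap exprMn !sqr_sqrtr//; last first.
  exact: addr_ge0 (ler0n _ 3) (mulr_ge0 (ltW kap_gt0) (mulr_ge0 C0_ge0 (ltW D_gt0))).
have -> : (3 + kap * (C0 * D)) * eps = eps + kap * (C0 * d) + 2 * eps by rewrite /d; ring.
have e2 : eps ^+ 2 <= eps by rewrite expr2 ler_piMl// ltW.
apply: lerD; first apply: lerD.
- exact: le_trans b1_le e2.
- by rewrite ler_pM2l.
- apply: (le_trans rr); rewrite ler_pM2l//; exact: le_trans r_le e2.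
Qed.

End rossby_haurwitz_estimate.

End stability.

Theorem theorem1p1 (R : realType) (p : S2 R) (Omega : R) (Y2 : S2 R -> R)
    (Omega_neq0 : Omega != 0)
    (Y2_eigen : eigenfunction 6 Y2)
    (Y2_zonal : rotation_invariant p Y2) :
  exists C eps : R, [/\ 0 < C, 0 < eps &
    forall (omega0 : S2 R -> R) (omega : R -> S2 R -> R),
      vorticity omega0 ->
      euler_solution omega0 omega ->
      normL2 (omega0 \- rossby_haurwitz p Omega Y2) < eps ->
      forall t : R, 0 <= t ->
        normL2 (omega t \- rossby_haurwitz p Omega Y2) <=
          C * (normL2 (omega0 \- rossby_haurwitz p Omega Y2)) `^ 2^-1].
Proof.
have [c c0 Y2E] := zonal_eigenfunctionE Y2_eigen Y2_zonal.
set wb := rossby_haurwitz p Omega Y2.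
pose P := coords p; have pp : dot P P = 1 := coordsP p.
have wbE : wb = lin (Omega *: P) + quad (axial c P).
  apply/funext => x; rewrite /wb /rossby_haurwitz Y2E !fctE quad_axial /lin !dot3E !mxE.
  by rewrite /P; ring.
have wbL : wb \in @L2 R by rewrite wbE; exact: L2D (polyS_L2 (lin_polyS _)) (polyS_L2 (quad_polyS _)).
have est := rossby_haurwitz_estimate pp c0 Omega_neq0.
move: est; set K := 3 + _; set M := `|Omega| + _ => est.
(* The summand 1 only makes the positivity of the constant immediate. *)
exists (Num.sqrt K + 1), 1; split; [by rewrite ltr_wpDl// sqrtr_ge0|exact: ltr01|].
move=> omega0 omega [w0L _] [init vort _ [cas ang] [psi [u [str _ _ en]]]].
have [oL om0] := vort 0 (lexx 0).
rewrite -[omega0 \- wb]/(omega0 - wb) normL2_nrm; last exact: L2B.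
have <- : nrm (omega 0 - wb) = nrm (omega0 - wb).
  by apply: ae_eq_nrm; [exact: L2B|exact: L2B|apply: filterS init => x; rewrite !fctE => ->].
move=> eps1 t t0; have [tL omt] := vort t t0.
rewrite -[omega t \- wb]/(omega t - wb) normL2_nrm; last exact: L2B.
have [b [A [r spl]]] := harmonic_split_exists oL om0.
have [b' [A' [r' spl']]] := harmonic_split_exists tL omt.
(* Angular momentum is the inner product with the coordinates, which only sees b. *)
have bb : b' = b.
  apply/rowP => i; have /rowP/(_ i) := ang t t0; rewrite !mxE => e.
  have dE (v : 'rV[R]_3) : dot v (delta_mx 0 i) = v 0 i.
    rewrite /dot (bigD1 i)//= !mxE !eqxx mulr1 big1 ?addr0// => j ji.
    by rewrite !mxE (negbTE ji) andbF mulr0.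
  have lE (w : S2 R -> R) : \int[@surface R]_x (w x * coords x 0 i) = ip w (lin (delta_mx 0 i)).
    by apply: eq_Rintegral => x _; rewrite /lin dotC dE.
  move: e; rewrite !lE (split_ip_lin spl) (split_ip_lin spl') !dE.
  by apply: mulfI; rewrite mulf_neq0// ?mulf_neq0// ?gt_eqF// ?invr_gt0// pi_gt0.
subst b'.
have [psi0L _ _] := str 0 (lexx 0); have [psitL _ _] := str t t0.
have enE : ip (omega 0) (psi 0) = ip (omega t) (psi t).
  have := en t t0; rewrite /energy => /esym; apply: mulfI.
  by rewrite oppr_eq0 invr_eq0 pnatr_eq0.
have [rr qq] := high_modes_stable spl spl' psi0L psitL (stream_function_poly (str 0 (lexx 0)))
  (stream_function_poly (str t t0)) enE (esym (casimir_ip cas t0 tL oL)).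
have M0 : 0 <= M.
  by rewrite addr_ge0// mulr_ge0// addr_ge0// invr_ge0 sqrtr_ge0.
(* The truncation makes the cubic Casimir integrable, hence conserved. *)
have Jom : \int[@surface R]_x clamp3 M (omega t x) = \int[@surface R]_x clamp3 M (omega 0 x).
  apply: (cas (clamp3 M)) => //; first exact: continuous_clamp3.
    exact: clamp3_integrable.
  exact: clamp3_integrable.
rewrite powR12_sqrt ?nrm_ge0// wbE in eps1 *.
apply: le_trans (est _ _ _ _ _ _ _ spl spl' eps1 rr qq Jom oL tL) _.
by rewrite ler_wpM2r ?sqrtr_ge0// lerDl.
Qed.
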